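(* Let $I$ be an inner function and let $Q=L^\infty\cap(H^2+\overline{IH^2})$. Then $l\in(K_I^1\cap zH^1)^*$ if and only if there is a unique $v+Q\in L^\infty/Q$ such that $$l(f)=l_{v+Q}(f):=\int_{\mathbb{T}}f(\zeta)\,v(\zeta)\,dm(\zeta)\qquad\text{for all } f\in K_I^1\cap zH^1.$$ Furthermore $\|l_{v+Q}\|=\|v+Q\|_{L^\infty/Q}$.
   Context: All $L^p$ spaces are on the unit circle $\mathbb{T}$ with normalised Lebesgue measure $m$. $H^p$ is the Hardy space, viewed as a closed subspace of $L^p$ via boundary values. An inner function is a function $I\in H^2$ that is unimodular a.e. on $\mathbb{T}$. $\overline{H^p_0}:=\{\overline f:f\in zH^p\}$ and the model space is $K_I^p:=H^p\cap I\,\overline{H^p_0}$. $\overline{IH^2}=\{\overline{Ih}:h\in H^2\}$. The space $K_I^1\cap zH^1$ carries the $L^1$ norm, $(\cdot)^*$ denotes the Banach space dual, and $\|v+Q\|_{L^\infty/Q}=\inf_{q\in Q}\|v+q\|_\infty$ is the quotient norm. *)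

(* Defs.v *)
From HB Require Import structures.
From mathcomp Require Import all_boot all_order all_algebra.
From mathcomp Require Import all_classical all_reals all_analysis.
From mathcomp Require Import complex.

Set Implicit Arguments.
Unset Strict Implicit.
Unset Printing Implicit Defensive.

Import Order.TTheory GRing.Theory Num.Theory numFieldNormedType.Exports.

Local Open Scope classical_set_scope.
Local Open Scope ring_scope.
Local Open Scope complex_scope.

Record circle (R : realType) :=
  Circle { circle_val :> R[i]; _ : `|circle_val| == 1 }.

Section circle_measure.
Variable R : realType.

HB.instance Definition _ := [isSub for @circle_val R].
HB.instance Definition _ := [Choice of circle R by <:].

Lemma norm_expi (t : R) : `|cos t +i* sin t| == 1 :> R[i].
Proof. by rewrite normc_def /= cos2Dsin2 sqrtr1. Qed.

Definition expi (t : R) : circle R := Circle (norm_expi t).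

HB.instance Definition _ := isPointed.Build (circle R) (expi 0).

(* The sigma-algebra coinduced by expi.  As expi is a Borel isomorphism from
   [0, 2 pi[ onto the circle, these are exactly the Borel sets. *)
Definition circle_measurable : set (set (circle R)) :=
  [set A | measurable (expi @^-1` A)].

Let circle_measurable0 : circle_measurable set0.
Proof. by rewrite /circle_measurable /= preimage_set0. Qed.

Let circle_measurableC A : circle_measurable A -> circle_measurable (~` A).
Proof. by move=> mA; apply: measurableC. Qed.

Let circle_measurable_bigcup (F : (set (circle R))^nat) :
  (forall k, circle_measurable (F k)) -> circle_measurable (\bigcup_k F k).
Proof.
move=> mF; rewrite /circle_measurable /= preimage_bigcup.
by apply: bigcup_measurable => k _; exact: mF.
Qed.

HB.instance Definition _ := @isMeasurable.Build default_measure_display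
  (circle R) circle_measurable circle_measurable0 circle_measurableC
  circle_measurable_bigcup.

Lemma measurable_expi : measurable_fun [set: measurableTypeR R] expi.
Proof. by move=> _ A mA; rewrite setTI. Qed.

Lemma pi2_gt0 : 0 < 2 * pi :> R.
Proof. by rewrite mulr_gt0// pi_gt0. Qed.

(* Normalised Lebesgue measure on the circle: the law of e^(it) for t uniformly
   distributed on [0, 2 pi]. *)
Definition circle_leb : set (circle R) -> \bar R :=
  pushforward (uniform_prob pi2_gt0) expi.

Let circle_leb0 : circle_leb set0 = 0%E.
Proof. by rewrite /circle_leb /pushforward preimage_set0 measure0. Qed.

Let circle_leb_ge0 A : (0 <= circle_leb A)%E.
Proof. by rewrite /circle_leb /pushforward; exact: measure_ge0. Qed.

Let circle_leb_sigma_additive : semi_sigma_additive circle_leb.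
Proof.
exact: (@measure_semi_sigma_additive _ _ _
  (measure_function_pushforward__canonical__measure_function_Measure
     (uniform_prob pi2_gt0) measurable_expi)).
Qed.

HB.instance Definition _ := isMeasure.Build _ _ _ circle_leb
  circle_leb0 circle_leb_ge0 circle_leb_sigma_additive.

Let circle_leb_setT : circle_leb [set: circle R] = 1%E.
Proof. by rewrite /circle_leb /pushforward preimage_setT probability_setT. Qed.

HB.instance Definition _ :=
  @Measure_isProbability.Build _ _ R circle_leb circle_leb_setT.

End circle_measure.

Section function_spaces.
Variable R : realType.
Local Notation C := R[i].
Local Notation T := (circle R).
Local Notation m := (@circle_leb R).
Implicit Types (p : \bar R) (f g h v I : T -> C).

Definition cmeasurable f :=
  measurable_fun [set: T] (fun x => complex.Re (f x)) /\
  measurable_fun [set: T] (fun x => complex.Im (f x)).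

Definition cintegral f : C :=
  Rintegral m [set: T] (fun x => complex.Re (f x)) +i*
  Rintegral m [set: T] (fun x => complex.Im (f x)).

Definition Lp_norm p f : \bar R := Lnorm m p (fun x => (Normc.normc (f x))%:E).

(* Function spaces are sets of functions, closed under a.e. equality, in place
   of sets of a.e. classes. *)
Definition Lp_space p : set (T -> C) :=
  [set f | cmeasurable f /\ (Lp_norm p f < +oo)%E].

(* R[i]^o carries the usual topology of the complex plane. *)
Definition holomorphic_disc (F : C -> C) :=
  forall z : C, `|z| < 1 -> derivable (F : C^o -> C^o) z 1.

Definition dilate (F : C -> C) (r : R) : T -> C := fun x => F (r%:C * val x).

Definition boundary_value (F : C -> C) f :=
  \forall x \ae m, (dilate F r x : C^o) @[r --> (1 : R)^'-] --> (f x : C^o).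

Definition hardy p : set (T -> C) :=
  [set f | Lp_space p f /\ exists F : C -> C,
    [/\ holomorphic_disc F,
        exists M : R, forall r : R, 0 <= r < 1 ->
          (Lp_norm p (dilate F r) <= M%:E)%E
      & boundary_value F f]].

(* z H^p *)
Definition hardy0 p : set (T -> C) :=
  [set f | exists2 g, hardy p g & f = (fun x => val x * g x)].

Definition inner I := hardy 2%:E I /\ \forall x \ae m, `|I x| = 1.

Definition model_space p I : set (T -> C) :=
  [set f | hardy p f /\
    exists2 h, hardy0 p h & \forall x \ae m, f x = I x * (h x)^*].

(* K_I^1 `&` z H^1 *)
Definition model_space0 I : set (T -> C) := model_space 1%E I `&` hardy0 1%E.

(* L^oo `&` (H^2 + conj (I H^2)) *)
Definition Qspace I : set (T -> C) :=
  [set v | Lp_space +oo%E v /\ exists a b,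
    [/\ hardy 2%:E a, hardy 2%:E b
      & \forall x \ae m, v x = a x + (I x * b x)^*]].

Definition coset (Q : set (T -> C)) v : set (T -> C) :=
  [set w | exists2 q, Q q & w = (fun x => v x + q x)].

(* L^oo / Q *)
Definition Linfty_quotient (Q : set (T -> C)) : set (set (T -> C)) :=
  [set V | exists2 v, Lp_space +oo%E v & V = coset Q v].

Definition quotient_norm (Q : set (T -> C)) v : \bar R :=
  ereal_inf [set Lp_norm +oo%E (fun x => v x + q x) | q in Q].

(* The bounded linear functionals on the subspace K of L^1; only the values of
   l on K are relevant.  Boundedness makes l constant on a.e. classes. *)
Definition L1_dual (K : set (T -> C)) (l : (T -> C) -> C) :=
  (forall (a : C) f g, K f -> K g ->
     l (fun x => a * f x + g x) = a * l f + l g) /\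
  (exists M : R, forall f, K f ->
     ((Normc.normc (l f))%:E <= M%:E * Lp_norm 1%E f)%E).

Definition L1_dual_norm (K : set (T -> C)) (l : (T -> C) -> C) : \bar R :=
  ereal_sup [set (Normc.normc (l f))%:E | f in
    [set f | K f /\ (Lp_norm 1%E f <= 1)%E]].

Definition pairing v f : C := cintegral (fun x => f x * v x).

End function_spaces.

(* Main.v *)
Require Import Defs.
From mathcomp Require Import all_boot all_order all_algebra.
From mathcomp Require Import all_classical all_reals all_analysis.
From mathcomp Require Import complex.
From mathcomp Require Import measurable_realfun ess_sup_inf ring lra.

Set Implicit Arguments.
Unset Strict Implicit.
Unset Printing Implicit Defensive.

Import Order.TTheory GRing.Theory Num.Theory numFieldNormedType.Exports.

Local Open Scope classical_set_scope.
Local Open Scope ring_scope.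
Local Open Scope complex_scope.

(* The set K = K_I^1 `&` zH^1 consists of the integrable f whose Fourier
   coefficients of index <= 0 vanish and which are of the form I * conj h, with h
   of the same kind; for this description one needs F. Riesz's theorem that H^1
   functions are the Poisson integrals of their boundary values.

   Q is the annihilator of K in L^oo.  That an annihilating v lies in Q is an
   orthogonality argument in L^2: write v = a + conj c by means of the Riesz
   projection and test v against the part of c which is orthogonal to I H^2.
   Conversely let v = a + conj (I b) be bounded, and put S = a + I b and
   D = a - I b.  Then v = Re S + i Im D, so that S and D map the disc into the
   cross where |Re| <= c or |Im| <= c.  There the map z / (1 + eps z^4) is bounded,
   and it commutes with the multiplication by i; applied to S and D it gives
   bounded functions of the form A + conj (I B), with A and B in H^oo, which
   annihilate K and converge boundedly to v as eps tends to 0.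

   Finally, by the Hahn-Banach theorem a functional on K extends to L^1 with the
   same norm, and the extension is represented on K by the L^2 function w with the
   corresponding Fourier coefficients; |w| is at most the norm, since this holds
   for the Poisson integrals of w. *)

(** * Complex numbers and complex integrals *)

(** The delicate point in Riesz's theorem is that an L^1 bound on the circles |z| = r does not by
    itself prevent mass from concentrating as r tends to 1. Square roots of moduli are bounded in
    L^2, so their Poisson inequality survives the limit; squaring it gives |G| <= P[|g|], and this
    majorant forces the dilates to converge in L^1. The Poisson inequality for |G|^(1/2) comes from
    the one for log |G|, where zeros of G are handled by adding a small constant to |G|.

    For bounded v = a + conj (I b) the integral of f v cannot be split, since a and b are merely in
    L^2 and f merely in L^1; hence the detour through bounded functions. The power 4 is chosen
    because z^4 is close to the positive half-line far out on both arms of the cross.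

    The functional is extended to all of L^1, and not just to H^1, because the bound on w is
    obtained by evaluating it at Poisson kernels, which have L^1 norm 1. Its values on the
    characters are square summable because the L^2 norm dominates the L^1 norm. *)

Notation nc := Normc.normc.
Notation Re := complex.Re.
Notation Im := complex.Im.
Notation cj := conjc.

Section complex_modulus.
Variable R : realType.
Implicit Types (x y z : R[i]) (r : R).

Lemma normcE z : `|z| = (nc z)%:C.
Proof. by rewrite normc_def; case: z. Qed.

Lemma normc_ltE z r : (`|z| < r%:C) = (nc z < r).
Proof. by rewrite normcE ltcR. Qed.

Lemma normc_lt1 z : (`|z| < 1) = (nc z < 1).
Proof. exact: (normc_ltE z 1). Qed.

Lemma ncE z : nc z = Num.sqrt (Re z ^+ 2 + Im z ^+ 2).
Proof. by case: z. Qed.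

Lemma nc_ge0 z : 0 <= nc z.
Proof. by case: z => a b; exact: sqrtr_ge0. Qed.
Hint Resolve nc_ge0 : core.

Lemma ncD x y : nc (x + y) <= nc x + nc y. Proof. exact: le_normcD. Qed.
Lemma ncM x y : nc (x * y) = nc x * nc y. Proof. exact: Normc.normcM. Qed.
Lemma ncN x : nc (- x) = nc x. Proof. exact: normcN. Qed.
Lemma ncV x : nc x^-1 = (nc x)^-1. Proof. exact: Normc.normcV. Qed.
Lemma nc0 : nc (0 : R[i]) = 0. Proof. exact: Normc.normc0. Qed.
Lemma nc1 : nc (1 : R[i]) = 1. Proof. exact: Normc.normc1. Qed.

Lemma ncBC x y : nc (x - y) = nc (y - x).
Proof. by rewrite -ncN opprB. Qed.

Lemma ncB x y : nc (x - y) <= nc x + nc y.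
Proof. by rewrite (le_trans (ncD _ _))// ncN. Qed.

Lemma ncB_ge x y : nc x - nc y <= nc (x - y).
Proof. by rewrite lerBlDr -{1}(subrK y x) ncD. Qed.

Lemma ncBB x y : `|nc x - nc y| <= nc (x - y).
Proof. by rewrite ler_norml ncB_ge andbT lerNl opprB ncBC ncB_ge. Qed.

Lemma nc_eq0 z : (nc z == 0) = (z == 0).
Proof. by apply/eqP/eqP => [/Normc.eq0_normc|->]; rewrite ?nc0. Qed.

Lemma nc_gt0 z : (0 < nc z) = (z != 0).
Proof. by rewrite lt_neqAle nc_ge0 andbT eq_sym nc_eq0. Qed.

Lemma ncX z n : nc (z ^+ n) = nc z ^+ n.
Proof. by elim: n => [|n IH]; rewrite ?expr0 ?nc1// !exprS ncM IH. Qed.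

Lemma ncJ z : nc (cj z) = nc z.
Proof. by case: z => a b /=; rewrite sqrrN. Qed.

Lemma ncR r : nc r%:C = `|r|.
Proof. by rewrite /= expr0n addr0 sqrtr_sqr. Qed.

Lemma nc_i : nc ('i : R[i]) = 1.
Proof. by rewrite /= expr0n expr1n add0r sqrtr1. Qed.

Lemma sqr_nc z : nc z ^+ 2 = Re z ^+ 2 + Im z ^+ 2.
Proof. by rewrite ncE sqr_sqrtr// addr_ge0// sqr_ge0. Qed.

Lemma mulcJ z : z * (cj z) = (nc z ^+ 2)%:C.
Proof. by rewrite sqr_nc; case: z => a b; simpc; congr (_ +i* _); ring. Qed.

Lemma Re_le_nc z : `|Re z| <= nc z.
Proof. by rewrite ncE -sqrtr_sqr ler_sqrt ?addr_ge0 ?sqr_ge0// lerDl sqr_ge0. Qed.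

Lemma Im_le_nc z : `|Im z| <= nc z.
Proof. by rewrite ncE -sqrtr_sqr ler_sqrt ?addr_ge0 ?sqr_ge0// lerDr sqr_ge0. Qed.

Lemma nc_le_ReIm z : nc z <= `|Re z| + `|Im z|.
Proof.
rewrite {1}(complexE z) (le_trans (ncD _ _))// lerD//; first by rewrite ncR.
by rewrite ncM nc_i mul1r ncR.
Qed.

Lemma ReD x y : Re (x + y) = Re x + Re y. Proof. by case: x y => a b []. Qed.
Lemma ImD x y : Im (x + y) = Im x + Im y. Proof. by case: x y => a b []. Qed.
Lemma ReN x : Re (- x) = - Re x. Proof. by case: x. Qed.
Lemma ImN x : Im (- x) = - Im x. Proof. by case: x. Qed.
Lemma ReB x y : Re (x - y) = Re x - Re y. Proof. by rewrite ReD ReN. Qed.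
Lemma ImB x y : Im (x - y) = Im x - Im y. Proof. by rewrite ImD ImN. Qed.
Lemma ReM x y : Re (x * y) = Re x * Re y - Im x * Im y.
Proof. by case: x y => a b []. Qed.
Lemma ImM x y : Im (x * y) = Re x * Im y + Im x * Re y.
Proof. by case: x y => a b []. Qed.
Lemma ReJ x : Re (cj x) = Re x. Proof. by case: x. Qed.
Lemma ImJ x : Im (cj x) = - Im x. Proof. by case: x. Qed.
Lemma conjcD x y : (cj (x + y)) = (cj x) + (cj y). Proof. exact: rmorphD. Qed.
Lemma conjcB x y : (cj (x - y)) = (cj x) - (cj y). Proof. exact: rmorphB. Qed.
Lemma conjcN x : (cj (- x)) = - (cj x). Proof. exact: rmorphN. Qed.
Lemma conjcM x y : (cj (x * y)) = (cj x) * (cj y). Proof. exact: rmorphM. Qed.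
Lemma conjcX x n : (cj (x ^+ n)) = (cj x) ^+ n. Proof. exact: rmorphXn. Qed.
Lemma conjcR r : (cj (r%:C)) = r%:C. Proof. exact: conjc_real. Qed.

Lemma eqcP x y : Re x = Re y -> Im x = Im y -> x = y.
Proof. by case: x y => a b [c d] /= -> ->. Qed.

Lemma rcM (a b : R) : (a * b)%:C = a%:C * b%:C. Proof. exact: rmorphM. Qed.
Lemma rcD (a b : R) : (a + b)%:C = a%:C + b%:C. Proof. exact: rmorphD. Qed.
Lemma rcB (a b : R) : (a - b)%:C = a%:C - b%:C. Proof. exact: rmorphB. Qed.
Lemma rcN (a : R) : (- a)%:C = - a%:C. Proof. exact: rmorphN. Qed.
Lemma rcX (a : R) n : (a ^+ n)%:C = a%:C ^+ n. Proof. exact: rmorphXn. Qed.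
Lemma rcV (a : R) : (a^-1)%:C = (a%:C)^-1. Proof. exact: fmorphV. Qed.

(** Multiplication by such a [c] turns a modulus into a real part, which is how real inequalities
    are carried over to complex integrals and functionals. Asking only for [nc c <= 1] allows
    [c = 0] at [z = 0]. *)
Lemma phaseP z : exists2 c : R[i], nc c <= 1 & c * z = (nc z)%:C.
Proof.
have [->|z0] := eqVneq z 0; first by exists 0; rewrite ?nc0 ?mulr0//.
have n0 : nc z != 0 by rewrite nc_eq0.
exists ((cj z) * ((nc z)^-1)%:C).
  by rewrite ncM ncJ ncR ger0_norm ?invr_ge0// divff.
by rewrite mulrAC [_ * z]mulrC mulcJ -rcM expr2 mulfK.
Qed.

End complex_modulus.
#[export] Hint Extern 0 (is_true (0 <= Normc.normc _)) => exact: nc_ge0 : core.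

Section cvg_complex.
Variable R : realType.
Local Notation C := R[i].

(** The norm of [C^o] takes values in [R[i]], so the epsilons of its topology are elements of
    [R[i]]. Positive ones are real, and from here on all limits are handled with real epsilons. *)
Lemma cvgc_nc (X : Type) (F : set_system X) (FF : Filter F) (f : X -> C^o) (l : C^o) :
  f @ F --> l <-> (fun x => nc (f x - l)) @ F --> (0 : R).
Proof.
split=> [/cvgrPdist_lt fl|/cvgrPdist_lt fl].
  apply/cvgrPdist_lt => e e0.
  have e0' : (0 : C) < e%:C by rewrite ltcR.
  apply: filterS (fl _ e0') => x; rewrite normcE ltcR ncBC => h.
  by rewrite sub0r normrN ger0_norm.
apply/cvgrPdist_lt => e e0.
have [er e1] : e = (Re e)%:C /\ 0 < Re e.
  by move: e0; rewrite ltcE /=; case: e => a b /= /andP[/eqP -> ?].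
apply: filterS (fl _ e1) => x; rewrite sub0r normrN ger0_norm// => h.
by rewrite normcE er ltcR ncBC.
Qed.

End cvg_complex.

(** * Integration of complex-valued functions *)

Section cint.
Context d (T : measurableType d) (R : realType).
Variable mu : {measure set T -> \bar R}.
Implicit Types (D : set T) (f g : T -> R[i]) (c : R[i]).

(** Measure and domain are left general: on the circle this unfolds to [cintegral], and Goursat's
    theorem needs Lebesgue measure on segments. *)
Definition cint D f : R[i] :=
  Rintegral mu D (fun x => Re (f x)) +i* Rintegral mu D (fun x => Im (f x)).

Definition cmeas D f :=
  measurable_fun D (fun x => Re (f x)) /\ measurable_fun D (fun x => Im (f x)).

Definition cintble D f :=
  mu.-integrable D (fun x => (Re (f x))%:E) /\
  mu.-integrable D (fun x => (Im (f x))%:E).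

Variable D : set T.
Hypothesis mD : measurable D.

Lemma cmeas_cst c : cmeas D (fun=> c).
Proof. by split; exact: measurable_cst. Qed.

Lemma cmeasR (u : T -> R) : measurable_fun D u -> cmeas D (fun x => (u x)%:C).
Proof. by move=> mu'; split => //; exact: measurable_cst. Qed.

Lemma cmeasD f g : cmeas D f -> cmeas D g -> cmeas D (fun x => f x + g x).
Proof.
move=> [f1 f2] [g1 g2]; split.
  under eq_fun do rewrite ReD; exact: measurable_funD.
under eq_fun do rewrite ImD; exact: measurable_funD.
Qed.

Lemma cmeasN f : cmeas D f -> cmeas D (fun x => - f x).
Proof.
move=> [f1 f2]; split.
  under eq_fun do rewrite ReN; exact: measurableT_comp.
under eq_fun do rewrite ImN; exact: measurableT_comp.
Qed.

Lemma cmeasB f g : cmeas D f -> cmeas D g -> cmeas D (fun x => f x - g x).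
Proof. by move=> mf /cmeasN mg; exact: cmeasD. Qed.

Lemma cmeasM f g : cmeas D f -> cmeas D g -> cmeas D (fun x => f x * g x).
Proof.
move=> [f1 f2] [g1 g2]; split.
  under eq_fun do rewrite ReM; apply: measurable_funB; exact: measurable_funM.
under eq_fun do rewrite ImM; apply: measurable_funD; exact: measurable_funM.
Qed.

Lemma cmeasX f n : cmeas D f -> cmeas D (fun x => f x ^+ n).
Proof.
move=> mf; elim: n => [|n IH].
  by under eq_fun do rewrite expr0; exact: cmeas_cst.
by under eq_fun do rewrite exprS; exact: cmeasM.
Qed.

Lemma cmeasJ f : cmeas D f -> cmeas D (fun x => (cj (f x))).
Proof.
move=> [f1 f2]; split.
  by under eq_fun do rewrite ReJ.
by under eq_fun do rewrite ImJ; exact: measurableT_comp.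
Qed.

Lemma meas_nc f : cmeas D f -> measurable_fun D (fun x => nc (f x)).
Proof.
move=> [f1 f2]; under eq_fun do rewrite ncE.
have ms : measurable_fun [set: R] (@Num.sqrt R).
  by apply: continuous_measurable_fun => x; exact: sqrt_continuous.
apply: (measurableT_comp ms).
by apply: measurable_funD; apply: measurable_funX.
Qed.

Lemma cintble_meas f : cintble D f -> cmeas D f.
Proof.
by move=> [/measurable_int/measurable_EFinP ? /measurable_int/measurable_EFinP ?].
Qed.

Lemma cintble_nc f : cintble D f -> mu.-integrable D (fun x => (nc (f x))%:E).
Proof.
move=> fi; have [f1 f2] := fi.
apply: (@le_integrable _ _ _ mu _ mD _
  (fun x => (`|Re (f x)|%:E + `|Im (f x)|%:E)%E)).
- by apply/measurable_EFinP/meas_nc/cintble_meas.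
- move=> x _; rewrite -EFinD !abse_EFin lee_fin [leLHS]ger0_norm// [leRHS]ger0_norm ?addr_ge0//.
  exact: nc_le_ReIm.
- by apply: integrableD => //; exact: integrable_norm.
Qed.

Lemma cintble_le f (g : T -> R) : cmeas D f ->
  (forall x, D x -> nc (f x) <= g x) -> mu.-integrable D (EFin \o g) -> cintble D f.
Proof.
move=> [m1 m2] fg gi; split; apply: (le_integrable mD _ _ gi);
  do ?exact/measurable_EFinP; move=> x Dx /=; rewrite lee_fin.
- rewrite (le_trans (Re_le_nc _))// (le_trans (fg _ Dx))// ler_norm//.
- rewrite (le_trans (Im_le_nc _))// (le_trans (fg _ Dx))// ler_norm//.
Qed.

Lemma cintbleP f : cmeas D f -> mu.-integrable D (fun x => (nc (f x))%:E) ->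
  cintble D f.
Proof. by move=> mf fi; exact: (cintble_le mf _ fi). Qed.

Lemma cintbleD f g : cintble D f -> cintble D g -> cintble D (fun x => f x + g x).
Proof.
move=> [f1 f2] [g1 g2]; split.
  by under eq_fun do rewrite ReD EFinD; exact: integrableD.
by under eq_fun do rewrite ImD EFinD; exact: integrableD.
Qed.

Lemma cintbleZ c f : cintble D f -> cintble D (fun x => c * f x).
Proof.
move=> fi; apply: (@cintble_le _ (fun x => nc c * nc (f x))).
- apply: cmeasM; [exact: cmeas_cst|exact: cintble_meas].
- by move=> x _; rewrite ncM.
- rewrite [X in integrable _ _ X](_ : _ = fun x => ((nc c)%:E * (nc (f x))%:E)%E)//.
  exact/integrableZl/cintble_nc.
Qed.

Lemma cintbleN f : cintble D f -> cintble D (fun x => - f x).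
Proof.
by move=> /(cintbleZ (-1)); congr cintble; apply/funext => x; rewrite mulN1r.
Qed.

Lemma cintbleB f g : cintble D f -> cintble D g -> cintble D (fun x => f x - g x).
Proof. by move=> ? /cintbleN ?; exact: cintbleD. Qed.

Lemma cintbleJ f : cintble D f -> cintble D (fun x => (cj (f x))).
Proof.
move=> fi; apply: (@cintble_le _ (fun x => nc (f x))).
- exact/cmeasJ/cintble_meas.
- by move=> x _; rewrite ncJ.
- exact: cintble_nc.
Qed.

Lemma cintbleM f g (M : R) : cintble D f -> cmeas D g ->
  (forall x, D x -> nc (g x) <= M) -> cintble D (fun x => f x * g x).
Proof.
move=> fi mg gM; apply: (@cintble_le _ (fun x => M * nc (f x))).
- by apply: cmeasM => //; exact: cintble_meas.
- by move=> x Dx; rewrite ncM mulrC ler_wpM2r// gM.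
- rewrite [X in integrable _ _ X](_ : _ = fun x => (M%:E * (nc (f x))%:E)%E)//.
  exact/integrableZl/cintble_nc.
Qed.

Lemma cintbleR (u : T -> R) : mu.-integrable D (EFin \o u) ->
  cintble D (fun x => (u x)%:C).
Proof. by move=> iu; split => //; exact: integrable0. Qed.

Lemma cintD f g : cintble D f -> cintble D g ->
  cint D (fun x => f x + g x) = cint D f + cint D g.
Proof.
move=> [f1 f2] [g1 g2]; apply: eqcP => /=.
  by rewrite -RintegralD//; congr Rintegral; apply/funext => x; exact: ReD.
by rewrite -RintegralD//; congr Rintegral; apply/funext => x; exact: ImD.
Qed.

Lemma cintZ c f : cintble D f -> cint D (fun x => c * f x) = c * cint D f.
Proof.
move=> fi; have [f1 f2] := fi; apply: eqcP => /=.
  rewrite ReM /= -!RintegralZl// -RintegralB//.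
  + by congr Rintegral; apply/funext => x; exact: ReM.
  + exact: (integrableZl mD (Re c) f1).
  + exact: (integrableZl mD (Im c) f2).
rewrite ImM /= -!RintegralZl// -RintegralD//.
+ by congr Rintegral; apply/funext => x; exact: ImM.
+ exact: (integrableZl mD (Re c) f2).
+ exact: (integrableZl mD (Im c) f1).
Qed.

Lemma cintZr c f : cintble D f -> cint D (fun x => f x * c) = cint D f * c.
Proof.
move=> fi; rewrite mulrC -cintZ//; congr cint; apply/funext => x.
by rewrite mulrC.
Qed.

Lemma cintN f : cintble D f -> cint D (fun x => - f x) = - cint D f.
Proof.
move=> fi; rewrite -mulN1r -cintZ//; congr cint; apply/funext => x.
by rewrite mulN1r.
Qed.

Lemma cintB f g : cintble D f -> cintble D g ->
  cint D (fun x => f x - g x) = cint D f - cint D g.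
Proof. by move=> fi gi; rewrite cintD ?cintN//; exact: cintbleN. Qed.

Lemma cintJ f : cintble D f -> cint D (fun x => (cj (f x))) = (cj (cint D f)).
Proof.
move=> [f1 f2]; apply: eqcP => /=.
  by congr Rintegral; apply/funext => x; rewrite ReJ.
rewrite -mulN1r -RintegralZl//; congr Rintegral; apply/funext => x.
by rewrite ImJ mulN1r.
Qed.

Lemma eq_cint f g : (forall x, D x -> f x = g x) -> cint D f = cint D g.
Proof.
move=> fg; apply: eqcP => /=; apply: eq_Rintegral => x /[!inE] Dx /=;
  by rewrite fg.
Qed.

Lemma cintR (u : T -> R) : cint D (fun x => (u x)%:C) = (Rintegral mu D u)%:C.
Proof. by apply: eqcP => //=; rewrite Rintegral_cst// mul0r. Qed.

Lemma cint0 : cint D (fun=> 0) = 0.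
Proof. by apply: eqcP => /=; rewrite Rintegral_cst// mul0r. Qed.

(** Rotate by the phase of the integral: its modulus is then the integral of a real part, which is
    at most the modulus pointwise. *)
Lemma nc_cint f : cintble D f ->
  nc (cint D f) <= Rintegral mu D (fun x => nc (f x)).
Proof.
move=> fi; have [c c1 cE] := phaseP (cint D f).
have [i1 i2] := cintbleZ c fi.
have := cintZ c fi; rewrite cE => /(congr1 (@complex.Re R)) /= <-.
apply: le_Rintegral => //; first exact: cintble_nc.
move=> x _; rewrite (le_trans (ler_norm _))// (le_trans (Re_le_nc _))//.
by rewrite ncM ler_piMl.
Qed.

Lemma cint_sum (I : Type) (s : seq I) (F : I -> T -> R[i]) :
  (forall i, cintble D (F i)) ->
  cintble D (fun x => \sum_(i <- s) F i x) /\
  cint D (fun x => \sum_(i <- s) F i x) = \sum_(i <- s) cint D (F i).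
Proof.
move=> Fi; elim: s => [|i s [IH1 IH2]].
  under eq_fun do rewrite big_nil; rewrite big_nil cint0; split => //.
  by split; exact: integrable0.
under eq_fun do rewrite big_cons; rewrite big_cons; split.
  exact: cintbleD.
by rewrite cintD// IH2.
Qed.

End cint.

Section cint_ae.
Context d (T : measurableType d) (R : realType).
Variable mu : {measure set T -> \bar R}.
Implicit Types (f g : T -> R[i]).

Lemma ae_eq_cint f g : cmeas setT f -> cmeas setT g ->
  (\forall x \ae mu, f x = g x) -> cint mu setT f = cint mu setT g.
Proof.
move=> [f1 f2] [g1 g2] fg; rewrite /cint /Rintegral; congr (fine _ +i* fine _).
- apply: ae_eq_integral => //; do ?exact/measurable_EFinP.
  by apply: filterS fg => x + _ => ->.
- apply: ae_eq_integral => //; do ?exact/measurable_EFinP.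
  by apply: filterS fg => x + _ => ->.
Qed.

Lemma ae_eq_Rint (f g : T -> R) : measurable_fun setT f -> measurable_fun setT g ->
  (\forall x \ae mu, f x = g x) -> Rintegral mu setT f = Rintegral mu setT g.
Proof.
move=> f1 g1 fg; rewrite /Rintegral; congr fine.
apply: ae_eq_integral => //; do ?exact/measurable_EFinP.
by apply: filterS fg => x + _ => ->.
Qed.

Lemma ae_le_Rint (f g : T -> R) : mu.-integrable setT (EFin \o f) ->
  mu.-integrable setT (EFin \o g) ->
  (\forall x \ae mu, f x <= g x) -> Rintegral mu setT f <= Rintegral mu setT g.
Proof.
move=> fi gi fg.
have mf : measurable_fun setT f by apply/measurable_EFinP; exact: measurable_int fi.
have mg : measurable_fun setT g by apply/measurable_EFinP; exact: measurable_int gi.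
have mM : measurable_fun setT (f \min g) by exact: measurable_minr.
(* [le_Rintegral] compares functions everywhere; [f \min g] agrees with [f] almost everywhere and
   lies below [g] at every point. *)
rewrite (@ae_eq_Rint f (f \min g))//; last first.
  by apply: filterS fg => x; rewrite /= minElt; case: ltP => // ? ?; apply/le_anti/andP; split.
apply: le_Rintegral => //; last by move=> x _ /=; rewrite ge_min lexx orbT.
apply: (@le_integrable _ _ _ mu _ measurableT _ (fun x => `|f x|%:E + `|g x|%:E)%E).
- exact/measurable_EFinP.
- move=> x _; rewrite -EFinD !abse_EFin lee_fin [leRHS]ger0_norm ?addr_ge0//.
  by rewrite /= minElt; case: ifP => _; rewrite ?lerDl ?lerDr.
- by apply: integrableD => //; exact: integrable_norm.
Qed.

Lemma ae_integrable_le (f g : T -> R) : measurable_fun setT f ->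
  mu.-integrable setT (EFin \o g) -> (\forall x \ae mu, `|f x| <= g x) ->
  mu.-integrable setT (EFin \o f).
Proof.
move=> mf /integrableP[mg ig] fg; apply/integrableP; split; first exact/measurable_EFinP.
apply: le_lt_trans ig; apply: ae_ge0_le_integral => //.
- by do 2 apply: measurableT_comp => //.
- by apply: measurableT_comp.
- by apply: filterS fg => x h _ /=; rewrite lee_fin (le_trans h)// ler_norm.
Qed.

Lemma cintble_ae_le f (g : T -> R) : cmeas setT f ->
  mu.-integrable setT (EFin \o g) -> (\forall x \ae mu, nc (f x) <= g x) ->
  cintble mu setT f.
Proof.
move=> mf ig fg; apply: cintbleP => //.
apply: ae_integrable_le ig _; first exact: meas_nc.
by apply: filterS fg => x; rewrite ger0_norm.
Qed.

End cint_ae.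

(** * Holomorphic functions and Goursat's theorem *)

Section holomorphic.
Variable R : realType.
Local Notation C := R[i].
Implicit Types (F G : C -> C) (z w c h : C).

Definition holo F z := derivable (F : C^o -> C^o) z 1.

Lemma holoP F z : holo F z <-> differentiable (F : C^o -> C^o) (z : C^o).
Proof. exact: derivable1_diffP. Qed.

Lemma holo_cst c z : holo (fun=> c) z.
Proof. exact: derivable_cst. Qed.

Lemma holo_id z : holo id z.
Proof. exact: derivable_id. Qed.

Lemma holoD F G z : holo F z -> holo G z -> holo (fun x => F x + G x) z.
Proof. exact: derivableD. Qed.

Lemma holoN F z : holo F z -> holo (fun x => - F x) z.
Proof. exact: derivableN. Qed.

Lemma holoB F G z : holo F z -> holo G z -> holo (fun x => F x - G x) z.
Proof. exact: derivableB. Qed.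

Lemma holoM F G z : holo F z -> holo G z -> holo (fun x => F x * G x) z.
Proof. exact: derivableM. Qed.

Lemma holoV F z : F z != 0 -> holo F z -> holo (fun x => (F x)^-1) z.
Proof. exact: derivableV. Qed.

Lemma holoX F n z : holo F z -> holo (fun x => F x ^+ n) z.
Proof.
move=> h; elim: n => [|n IH].
  by under eq_fun do rewrite expr0; exact: holo_cst.
by under eq_fun do rewrite exprS; exact: holoM.
Qed.

Lemma holo_comp F G z : holo F z -> holo G (F z) -> holo (fun x => G (F x)) z.
Proof.
move=> /holoP hF /holoP hG; apply/holoP.
exact: (@differentiable_comp _ (C^o) (C^o) (C^o) F G z hF hG).
Qed.

Lemma holo_cvg F z : holo F z -> (fun x => nc (F x - F z)) @ (z : C^o) --> (0 : R).
Proof.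
move=> /holoP /differentiable_continuous h.
exact: (@cvgc_nc R (C^o) (nbhs (z : C^o)) _ F (F z)).1 h.
Qed.

Lemma nbhs_nc z (P : set C) :
  (\forall x \near (z : C^o), P x) <->
  exists2 d : R, 0 < d & forall x, nc (x - z) < d -> P x.
Proof.
split.
  move=> /nbhs_ballP[e /= e0 eP].
  have [er e1] : e = (Re e)%:C /\ 0 < Re e.
    by move: e0; rewrite ltcE /=; case: e {eP} => a b /= /andP[/eqP -> ?].
  exists (Re e) => // x xz; apply: eP.
  by rewrite /ball/= er normcE ltcR ncBC.
move=> [d d0 dP]; apply/nbhs_ballP; exists d%:C => /=; first by rewrite ltcR.
by move=> x; rewrite /ball /= normcE ltcR ncBC; exact: dP.
Qed.

(** First-order expansion with real epsilons and without quotients, the form needed for Goursat's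
    estimate and, conversely in [diff_holo], for differentiating under an integral. *)
Lemma holo_diff F z : holo F z -> exists c, forall e : R, 0 < e ->
  exists2 d : R, 0 < d & forall x, nc (x - z) < d ->
    nc (F x - F z - c * (x - z)) <= e * nc (x - z).
Proof.
move=> /cvg_ex[c /= hc]; exists c => e e0.
move: hc => /cvgrPdist_lt /(_ e%:C).
rewrite ltcR => /(_ e0); rewrite near_withinE => /nbhs_nc[d d0 dP].
exists d => // x xz.
have [->|xz0] := eqVneq x z.
  by rewrite !subrr mulr0 subrr nc0 mulr0.
have h0 : x - z != 0 by rewrite subr_eq0.
have := dP (x - z); rewrite subr0 => /(_ xz h0).
rewrite normcE ltcR => /ltW.
have -> : (x - z) *: (1 : C^o) + z = x by rewrite /GRing.scale /= mulr1 subrK.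
move=> hle.
have -> : F x - F z - c * (x - z) =
  - ((c - (x - z)^-1 *: (F x - F z : C^o)) * (x - z)).
  rewrite mulrBl opprB; congr (_ - _).
  by rewrite /GRing.scale /= mulrAC mulVf// mul1r.
by rewrite ncN ncM ler_wpM2r.
Qed.

Lemma diff_holo F z c : (forall e : R, 0 < e ->
  exists2 d : R, 0 < d & forall x, nc (x - z) < d ->
    nc (F x - F z - c * (x - z)) <= e * nc (x - z)) -> holo F z.
Proof.
move=> hc; apply/cvg_ex; exists (c : C^o) => /=.
apply/cvgrPdist_lt => e e0.
have [er e1] : e = (Re e)%:C /\ 0 < Re e.
  by move: e0; rewrite ltcE /=; case: e => a b /= /andP[/eqP -> ?].
rewrite near_withinE; apply/nbhs_nc.
have [d d0 dP] := hc (Re e / 2) (divr_gt0 e1 (ltr0Sn R 1)).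
exists d => // h; rewrite subr0 => hd h0.
have := dP (z + h); rewrite addrAC subrr add0r => /(_ hd) hle.
rewrite er normcE ltcR /GRing.scale /= mulr1 [h + z]addrC.
have -> : c - h^-1 * (F (z + h) - F z) = - ((F (z + h) - F z - c * h) * h^-1).
  by rewrite mulrBl opprB mulrK ?unitfE// [_^-1 * _]mulrC.
have n0 : 0 < nc h by rewrite nc_gt0.
rewrite ncN ncM ncV ltr_pdivrMr// (le_lt_trans hle)// ltr_pM2r//.
by rewrite ltr_pdivrMr// ltr_pMr// ltr1n.
Qed.

(** It serves twice: it wraps rectangles onto annuli, and it produces zero-free holomorphic
    functions of prescribed modulus, since by [nc_cexp] the modulus depends on the real part
    only. *)
Definition cexp z : C := (expR (Re z))%:C * (cos (Im z) +i* sin (Im z)).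

Lemma cexpD z w : cexp (z + w) = cexp z * cexp w.
Proof.
rewrite /cexp ReD ImD expRD rcM mulrACA; congr (_ * _).
by rewrite sinD cosD; simpc; congr (_ +i* _); ring.
Qed.

Lemma cexp0 : cexp 0 = 1.
Proof. by rewrite /cexp /= expR0 cos0 sin0 mul1r. Qed.

Lemma nc_cexp z : nc (cexp z) = expR (Re z).
Proof. by rewrite /cexp ncM ncR /= cos2Dsin2 sqrtr1 mulr1 ger0_norm ?expR_ge0. Qed.

Lemma real_lin_approx (f : R -> R) (l : R) (x : R) : is_derive x 1 f l ->
  forall e : R, 0 < e -> exists2 d : R, 0 < d & forall y, `|y - x| < d ->
    `|f y - f x - l * (y - x)| <= e * `|y - x|.
Proof.
move=> [df dl] e e0.
have := df; rewrite /derivable => /cvg_ex[l' /= hl'].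
have ll' : l' = l by rewrite -dl /derive; apply/esym/cvg_lim.
move: hl'; rewrite ll' => /cvgrPdist_lt /(_ e e0).
rewrite near_withinE => /nbhs_ballP[d /= d0 dP]; exists d => // y yx.
have [->|yx0] := eqVneq y x; first by rewrite !subrr mulr0 subrr normr0 mulr0.
have h0 : y - x != 0 by rewrite subr_eq0.
have := dP (y - x); rewrite /ball /= sub0r normrN => /(_ yx h0) /ltW.
have -> : (y - x) *: (1 : R^o) + x = y by rewrite /GRing.scale /= mulr1 subrK.
move=> hle.
have -> : f y - f x - l * (y - x) = - ((l - (y - x)^-1 *: (f y - f x : R^o)) * (y - x)).
  rewrite mulrBl opprB; congr (_ - _).
  by rewrite /GRing.scale /= mulrAC mulVf// mul1r.
by rewrite normrN normrM ler_wpM2r.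
Qed.

Lemma holo_cexp0 : holo cexp 0.
Proof.
apply: (@diff_holo _ _ 1) => e e0.
(* The four terms of [zE] contribute 1, 2, 4 and 1 times [e' * n], hence the 8. *)
pose e' := Num.min 1 (e / 8).
have e'0 : 0 < e' by rewrite lt_min ltr01 divr_gt0.
have [d1 d10 h1] := real_lin_approx (is_derive_expR (0 : R)) e'0.
have [d2 d20 h2] := real_lin_approx (is_derive_cos (0 : R)) e'0.
have [d3 d30 h3] := real_lin_approx (is_derive_sin (0 : R)) e'0.
exists (Num.min e' (Num.min d1 (Num.min d2 d3))).
  by rewrite lt_min e'0/= lt_min d10/= lt_min d20 d30.
move=> z; rewrite !subr0 mul1r cexp0.
rewrite lt_min => /andP[ze]; rewrite lt_min => /andP[z1]; rewrite lt_min => /andP[z2 z3].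
have := h1 (Re z); rewrite subr0 expR0 mul1r => /(_ (le_lt_trans (Re_le_nc z) z1)).
have := h2 (Im z); rewrite subr0 cos0 sin0 oppr0 mul0r subr0
  => /(_ (le_lt_trans (Im_le_nc z) z2)).
have := h3 (Im z); rewrite subr0 cos0 sin0 mul1r subr0
  => /(_ (le_lt_trans (Im_le_nc z) z3)).
have := Re_le_nc z; have := Im_le_nc z.
set x := Re z; set y := Im z; set n := nc z => yn xn hs hc he.
have e1 : e' <= 1 by rewrite ge_min lexx.
have e8 : e' <= e / 8 by rewrite ge_min lexx orbT.
have zE : cexp z - 1 - z =
  ((expR x - 1 - x) * cos y + (1 + x) * (cos y - 1))
   +i* ((expR x - 1) * sin y + (sin y - y)).
  rewrite /cexp -/x -/y; case: (z) @x @y {xn yn hs hc he} => a b /=; simpc.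
  by congr (_ +i* _); ring.
rewrite zE (le_trans (nc_le_ReIm _))//=.
have n0 : 0 <= n by exact: nc_ge0.
have {}ze : n < e' by exact: ze.
have cos1 : `|cos y| <= 1 by rewrite ler_norml cos_geN1 cos_le1.
have b1 : `|(expR x - 1 - x) * cos y| <= e' * n.
  rewrite normrM -[leRHS]mulr1 ler_pM// (le_trans he)// ler_wpM2l// ltW//.
have b2 : `|(1 + x) * (cos y - 1)| <= 2 * (e' * n).
  rewrite normrM ler_pM//.
    by have := ler_normD 1 x; rewrite normr1; move: ze xn e1; lra.
  by rewrite (le_trans hc)// ler_wpM2l// ltW.
have b3 : `|sin y| <= 2 * n.
  rewrite -(subrK y (sin y)) (le_trans (ler_normD _ _))//.
  have : e' * `|y| <= 1 * n by rewrite ler_pM// ltW.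
  by move: hs yn; lra.
have b4 : `|expR x - 1| <= 2 * e'.
  rewrite -(subrK x (expR x - 1)) (le_trans (ler_normD _ _))//.
  have : e' * `|x| <= 1 * n by rewrite ler_pM// ltW.
  by move: he xn ze; lra.
have b5 : `|(expR x - 1) * sin y| <= (2 * e') * (2 * n) by rewrite normrM ler_pM.
have b6 : `|sin y - y| <= e' * n.
  by rewrite (le_trans hs)// ler_wpM2l// ltW.
rewrite (le_trans (lerD (ler_normD _ _) (ler_normD _ _)))//.
have : e' * n <= e / 8 * n by rewrite ler_wpM2r.
move: b1 b2 b5 b6.
set p := e' * n; have -> : 2 * e' * (2 * n) = 4 * p by rewrite /p; ring.
by rewrite (_ : e * n = 8 * (e / 8 * n)); [lra|field].
Qed.

Lemma holo_cexp z : holo cexp z.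
Proof.
have -> : cexp = (fun w => cexp z * cexp (w - z)).
  by apply/funext => w; rewrite -cexpD addrCA subrr addr0.
apply: holoM; first exact: holo_cst.
apply: (@holo_comp (fun w => w - z)).
  by apply: holoB; [exact: holo_id|exact: holo_cst].
by rewrite subrr; exact: holo_cexp0.
Qed.

End holomorphic.

(** The pigeonhole principle of the bisection: what three quarters fail to carry is left to the
    fourth. *)
Lemma quarter_ineq (R : realFieldType) (n n1 n2 n3 n4 n12 n123 : R) :
  4 * n1 < n -> 4 * n2 < n -> 4 * n3 < n ->
  n12 <= n1 + n2 -> n123 <= n12 + n3 -> n <= n123 + n4 -> n <= 4 * n4.
Proof. by lra. Qed.

(** * Goursat's theorem on rectangles in a half-plane *)

Section goursat.
Variable R : realType.
Local Notation C := R[i].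
Local Notation leb := (@lebesgue_measure R).

Definition ccont (g : R -> C) x := forall e : R, 0 < e ->
  exists2 d : R, 0 < d & forall y, `|y - x| < d -> nc (g y - g x) < e.

Lemma ccont_cintble (g : R -> C) (a b : R) : (forall x, a <= x <= b -> ccont g x) ->
  cintble leb `[a, b]%classic g.
Proof.
move=> cg; split; (apply: continuous_compact_integrable;
  first exact: segment_compact);
  apply: continuous_in_subspaceT => x /[!inE]/=; rewrite in_itv/= => /cg cgx;
  apply/cvgrPdist_lt => e /cgx[d d0 dP]; apply/nbhs_ballP; exists d => //= y;
  rewrite /ball/= distrC => /dP yx; rewrite (le_lt_trans _ yx)// distrC.
- by rewrite -ReB Re_le_nc.
- by rewrite -ImB Im_le_nc.
Qed.

Lemma cint_itvD (g : R -> C) (a b c : R) : a <= b <= c ->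
  cintble leb `[a, c]%classic g ->
  cint leb `[a, c]%classic g = cint leb `[a, b]%classic g + cint leb `[b, c]%classic g.
Proof.
move=> /andP[ab bc].
have aux (f : R -> R) : leb.-integrable `[a, c]%classic (EFin \o f) ->
    Rintegral leb `[a, c]%classic f =
    Rintegral leb `[a, b]%classic f + Rintegral leb `[b, c]%classic f.
  move=> fi; have := @Rintegral_itvB R f (BLeft a) (BRight c) b fi.
  have h1 : (BLeft a <= BRight b)%O by rewrite bnd_simp.
  have h2 : (BRight b <= BRight c)%O by rewrite bnd_simp.
  move=> /(_ h1 h2); rewrite Rintegral_itv_obnd_cbnd; first by move=> <-; rewrite subrKC.
  apply: integrableS fi => //.
  by apply: subset_itvr; rewrite bnd_simp.
move=> [g1 g2]; apply: eqcP => /=.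
  exact: (aux (fun x => Re (g x))).
exact: (aux (fun x => Im (g x))).
Qed.

Lemma cint_itv_cst (a b : R) c : a <= b ->
  cint leb `[a, b]%classic (fun=> c) = c * (b - a)%:C.
Proof.
move=> ab; rewrite /cint !Rintegral_cst//= lebesgue_measure_itv/= lte_fin.
have -> : fine (if a < b then (b%:E - a%:E)%E else 0%E) = b - a.
  by move: ab; rewrite le_eqVlt => /predU1P[->|->]//; rewrite ltxx subrr.
by case: c => x y /=; simpc.
Qed.

Lemma nc_cint_itv (g : R -> C) (a b M : R) : a <= b ->
  cintble leb `[a, b]%classic g -> (forall x, a <= x <= b -> nc (g x) <= M) ->
  nc (cint leb `[a, b]%classic g) <= M * (b - a).
Proof.
move=> ab gi gM; rewrite (le_trans (nc_cint _ gi))//.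
rewrite (@le_trans _ _ (Rintegral leb `[a, b]%classic (fun=> M)))//.
  apply: le_Rintegral => //.
  - exact: cintble_nc.
  - apply/(@continuous_compact_integrable R (fun=> M)); first exact: segment_compact.
    by apply: continuous_subspaceT => x; exact: cvg_cst.
rewrite Rintegral_cst//= lebesgue_measure_itv/= lte_fin.
by move: ab; rewrite le_eqVlt => /predU1P[->|->]//; rewrite ltxx subrr.
Qed.

Variables (Phi : C -> C) (S : R).
Hypothesis hPhi : forall w, Re w < S -> holo Phi w.

Let hor (c a b : R) := cint leb `[a, b]%classic (fun s => Phi (s +i* c)).
Let ver (s c d : R) := cint leb `[c, d]%classic (fun t => Phi (s +i* t)).

Let Phi_cont w : Re w < S -> forall e : R, 0 < e ->
  exists2 d : R, 0 < d & forall y, nc (y - w) < d -> nc (Phi y - Phi w) < e.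
Proof.
move=> wS e e0; have /cvgrPdist_lt/(_ e e0)/nbhs_nc[d d0 dP] := holo_cvg (hPhi wS).
by exists d => // y /dP; rewrite sub0r normrN ger0_norm.
Qed.

Lemma ccont_hor c x : x < S -> ccont (fun s => Phi (s +i* c)) x.
Proof.
move=> xS e e0; have [d d0 dP] := @Phi_cont (x +i* c) xS e e0.
exists d => // y yx; apply: dP; simpc.
by rewrite complexr0 ncR.
Qed.

Lemma ccont_ver s x : s < S -> ccont (fun t => Phi (s +i* t)) x.
Proof.
move=> sS e e0; have [d d0 dP] := @Phi_cont (s +i* x) sS e e0.
exists d => // y yx; apply: dP; simpc.
by rewrite /= expr0n add0r sqrtr_sqr.
Qed.

(** The counterclockwise boundary integral: bottom minus top, plus 'i times right minus left. The
    half-plane [Re w < S] is what a punctured disc becomes in logarithmic coordinates. *)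
Definition rect_int (a b c d : R) : C :=
  (hor c a b - hor d a b) + 'i * (ver b c d - ver a c d).

Lemma rect_intD a p b c q d : a <= p <= b -> c <= q <= d -> b < S ->
  rect_int a b c d = rect_int a p c q + rect_int p b c q +
                     rect_int a p q d + rect_int p b q d.
Proof.
move=> apb cqd bS.
have pS : p < S by case/andP: apb => _ /le_lt_trans; exact.
have aS : a < S by case/andP: apb => /le_lt_trans/(_ pS).
have H (y : R) : hor y a b = hor y a p + hor y p b.
  apply: cint_itvD => //; apply: ccont_cintble => x /andP[_ xb].
  by apply: ccont_hor; exact: le_lt_trans xb _.
have V s : s < S -> ver s c d = ver s c q + ver s q d.
  by move=> sS; apply: cint_itvD => //; apply: ccont_cintble => x _; exact: ccont_ver.
by rewrite /rect_int !H (V b)// (V a)//; ring.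
Qed.

(** Opposite sides are compared pointwise. For the affine part their difference is constant, namely
    [be * ('i * (c - d)%:C)] and [be * (b - a)%:C], and the two contributions cancel; each side then
    costs at most [e] times its length. *)
Lemma rect_int_small a b c d (w0 : C) (al be : C) (e : R) :
  a <= b -> c <= d -> b < S ->
  (forall w, a <= Re w <= b -> c <= Im w <= d -> nc (Phi w - al - be * (w - w0)) <= e) ->
  nc (rect_int a b c d) <= 2 * e * ((b - a) + (d - c)).
Proof.
move=> ab cd bS hw.
have ci y : cintble leb `[a, b]%classic (fun s => Phi (s +i* y)).
  apply: ccont_cintble => x /andP[_ xb].
  by apply: ccont_hor; exact: le_lt_trans xb _.
have vi s : a <= s <= b -> cintble leb `[c, d]%classic (fun t => Phi (s +i* t)).
  move=> /andP[_ sb]; apply: ccont_cintble => x _.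
  by apply: ccont_ver; exact: le_lt_trans sb _.
have cst_i (x y : R) (k : C) : cintble leb `[x, y]%classic (fun=> k).
  by apply: ccont_cintble => z _ e' e'0; exists 1 => // t _; rewrite subrr nc0.
have Hab : hor c a b - hor d a b - be * ('i * (c - d)%:C) * (b - a)%:C =
    cint leb `[a, b]%classic (fun s => (Phi (s +i* c) - Phi (s +i* d)) - be * ('i * (c - d)%:C)).
  rewrite cintB//; last by apply: cintbleB.
  by rewrite cintB// cint_itv_cst.
have Hcd : ver b c d - ver a c d - be * (b - a)%:C * (d - c)%:C =
    cint leb `[c, d]%classic (fun t => (Phi (b +i* t) - Phi (a +i* t)) - be * (b - a)%:C).
  have [va vb] : cintble leb `[c, d]%classic (fun t => Phi (a +i* t)) /\
      cintble leb `[c, d]%classic (fun t => Phi (b +i* t)).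
    by split; apply: vi; rewrite lexx ?ab.
  by rewrite cintB//; [rewrite cintB// cint_itv_cst|exact: cintbleB].
have -> : rect_int a b c d =
    (hor c a b - hor d a b - be * ('i * (c - d)%:C) * (b - a)%:C) +
    'i * (ver b c d - ver a c d - be * (b - a)%:C * (d - c)%:C).
  by rewrite /rect_int !rcB; ring.
rewrite (le_trans (ncD _ _))// ncM nc_i mul1r mulrDr Hab Hcd lerD//.
- apply: nc_cint_itv => //; first by apply: cintbleB => //; exact: cintbleB.
  move=> s sab.
  have -> : Phi (s +i* c) - Phi (s +i* d) - be * ('i * (c - d)%:C) =
      (Phi (s +i* c) - al - be * ((s +i* c) - w0)) -
      (Phi (s +i* d) - al - be * ((s +i* d) - w0)).
    have -> : 'i * (c - d)%:C = (s +i* c) - (s +i* d) :> C.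
      by simpc.
    by ring.
  rewrite (le_trans (ncB _ _))// mulr_natl mulr2n lerD// hw//= ?lexx ?cd//.
- apply: nc_cint_itv => //; first by apply: cintbleB => //; apply: cintbleB => //; apply: vi;
    rewrite lexx ?ab.
  move=> t tcd.
  have -> : Phi (b +i* t) - Phi (a +i* t) - be * (b - a)%:C =
      (Phi (b +i* t) - al - be * ((b +i* t) - w0)) -
      (Phi (a +i* t) - al - be * ((a +i* t) - w0)).
    have -> : (b - a)%:C = (b +i* t) - (a +i* t) :> C.
      by simpc.
    by ring.
  rewrite (le_trans (ncB _ _))// mulr_natl mulr2n lerD// hw//= ?lexx ?ab//.
Qed.

Let quad := (R * R * R * R)%type.
Let J (r : quad) := let: (a, b, c, d) := r in rect_int a b c d.

Let step (r : quad) : quad := let: (a, b, c, d) := r in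
  let p := (a + b) / 2 in let q := (c + d) / 2 in
  if nc (J r) <= 4 * nc (J (a, p, c, q)) then (a, p, c, q) else
  if nc (J r) <= 4 * nc (J (p, b, c, q)) then (p, b, c, q) else
  if nc (J r) <= 4 * nc (J (a, p, q, d)) then (a, p, q, d) else (p, b, q, d).

Let stepP a b c d : a <= b -> c <= d -> b < S ->
  let: (a', b', c', d') := step (a, b, c, d) in
  [/\ a <= a', a' <= b', b' <= b & b' - a' = (b - a) / 2] /\
  [/\ c <= c', c' <= d', d' <= d & d' - c' = (d - c) / 2] /\
  nc (J (a, b, c, d)) <= 4 * nc (J (step (a, b, c, d))).
Proof.
move=> ab cd bS; rewrite /step.
set p := (a + b) / 2; set q := (c + d) / 2.
have [ap pb] : a <= p /\ p <= b by rewrite /p; split; lra.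
have [cq qd] : c <= q /\ q <= d by rewrite /q; split; lra.
have pE1 : p - a = (b - a) / 2 by rewrite /p; field.
have pE2 : b - p = (b - a) / 2 by rewrite /p; field.
have qE1 : q - c = (d - c) / 2 by rewrite /q; field.
have qE2 : d - q = (d - c) / 2 by rewrite /q; field.
case: ifPn => [h|]; first by split; [split|split; [split|]].
rewrite -ltNge => h1.
case: ifPn => [h|]; first by split; [split|split; [split|]].
rewrite -ltNge => h2.
case: ifPn => [h|]; first by split; [split|split; [split|]].
rewrite -ltNge => h3.
split; [by split|split; [by split|]].
move: h1 h2 h3; rewrite /J.
rewrite (@rect_intD a p b c q d) ?ap ?cq//.
move=> h1 h2 h3; exact: (quarter_ineq h1 h2 h3 (ncD _ _) (ncD _ _) (ncD _ _)).
Qed.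

(** Bisection: the chosen quarters shrink to a point, where the first-order expansion makes the
    integral small compared with the square of the size. Four-fold growth of the integral and
    halving of the sides balance exactly. *)
Theorem goursat_rect a b c d : a <= b -> c <= d -> b < S -> rect_int a b c d = 0.
Proof.
move=> ab cd bS; pose r n := iter n step (a, b, c, d).
pose an n := (r n).1.1.1; pose bn n := (r n).1.1.2.
pose cn n := (r n).1.2; pose dn n := (r n).2.
have rE n : r n = (an n, bn n, cn n, dn n).
  by rewrite /an /bn /cn /dn; case: (r n) => [[[]]].
have inv n : [/\ an n <= bn n, cn n <= dn n, bn n < S,
    (bn n - an n) + (dn n - cn n) = ((b - a) + (d - c)) / 2 ^+ n &
    nc (rect_int a b c d) <= 4 ^+ n * nc (J (r n))] /\
    [/\ an n <= an n.+1, bn n.+1 <= bn n, cn n <= cn n.+1 & dn n.+1 <= dn n].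
  have main m : [/\ an m <= bn m, cn m <= dn m, bn m < S,
    (bn m - an m) + (dn m - cn m) = ((b - a) + (d - c)) / 2 ^+ m &
    nc (rect_int a b c d) <= 4 ^+ m * nc (J (r m))].
    elim: m => [|m [i1 i2 i3 i4 i5]]; first by split => //; rewrite expr0 ?divr1 ?mul1r.
    have := stepP i1 i2 i3.
    have -> : step (an m, bn m, cn m, dn m) = r m.+1 by rewrite -rE.
    rewrite (rE m.+1) -(rE m) => -[[h1 h2 h3 h4] [[h5 h6 h7 h8] h9]]; split => //.
    + exact: le_lt_trans h3 i3.
    + by rewrite h4 h8 -mulrDl i4 exprSr invfM mulrA.
    + rewrite (le_trans i5)// exprSr -mulrA ler_wpM2l// exprn_ge0//.
  split; first exact: main.
  have [i1 i2 i3 i4 i5] := main n; have := stepP i1 i2 i3.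
  have -> : step (an n, bn n, cn n, dn n) = r n.+1 by rewrite -rE.
  by rewrite (rE n.+1) -(rE n) => -[[h1 h2 h3 h4] [[h5 h6 h7 h8] h9]].
have andm m n : (m <= n)%N -> an m <= an n.
  by apply: (@homo_leq _ an (fun x y => x <= y)) => //; [move=> ? ? ?; exact: le_trans|move=> k; case: (inv k) => _ []].
have bndm m n : (m <= n)%N -> bn n <= bn m.
  apply: (@homo_leq _ bn (fun x y => y <= x)) => //; last by move=> k; case: (inv k) => _ [].
  by move=> ? ? ? h1 h2; exact: le_trans h2 h1.
have cndm m n : (m <= n)%N -> cn m <= cn n.
  by apply: (@homo_leq _ cn (fun x y => x <= y)) => //; [move=> ? ? ?; exact: le_trans|move=> k; case: (inv k) => _ []].
have dndm m n : (m <= n)%N -> dn n <= dn m.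
  apply: (@homo_leq _ dn (fun x y => y <= x)) => //; last by move=> k; case: (inv k) => _ [].
  by move=> ? ? ? h1 h2; exact: le_trans h2 h1.
(* Nested intervals: the supremum of the left ends is a common point. *)
have ub (u v : nat -> R) : (forall m n, (m <= n)%N -> u m <= u n) ->
    (forall m n, (m <= n)%N -> v n <= v m) -> (forall n, u n <= v n) ->
    exists x, forall n, u n <= x <= v n.
  move=> um vm uv; exists (sup (range u)) => n.
  have uvmn k : u k <= v n.
    have [kn|/ltnW nk] := leqP k n; first by rewrite (le_trans (um _ _ kn)).
    by rewrite (le_trans (uv k))// vm.
  apply/andP; split.
    apply: sup_upper_bound; last by exists n.
    by split; [exists (u 0%N), 0%N|exists (v n) => _ [k _ <-]].
  by apply: ge_sup; [exists (u 0%N), 0%N|move=> _ [k _ <-]].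
have [s0 hs0] := ub an bn andm bndm (fun n => let: conj (And5 h _ _ _ _) _ := inv n in h).
have [t0 ht0] := ub cn dn cndm dndm (fun n => let: conj (And5 _ h _ _ _) _ := inv n in h).
have s0S : s0 < S by case/andP: (hs0 0%N) => _ /le_lt_trans; exact.
have [be hbe] := holo_diff (@hPhi (s0 +i* t0) s0S).
pose L := (b - a) + (d - c).
have L0 : 0 <= L by rewrite /L addr_ge0// subr_ge0.
(* Here [L] is half the perimeter; the bound holds for every [e], so the integral vanishes. The
   [+ 1] below only avoids division by zero. *)
suff H e : 0 < e -> nc (rect_int a b c d) <= 2 * e * L ^+ 2.
  apply/eqP; rewrite -nc_eq0 eq_le nc_ge0 andbT; apply/ler_addgt0Pr => e e0.
  rewrite add0r; have L1 : 0 < 2 * (L ^+ 2 + 1) by rewrite mulr_gt0// ltr_wpDl// sqr_ge0.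
  rewrite (le_trans (H (e / (2 * (L ^+ 2 + 1))) _))//; first by rewrite divr_gt0.
  have K0 : 0 < L ^+ 2 + 1 by rewrite ltr_wpDl// sqr_ge0.
  have -> : 2 * (e / (2 * (L ^+ 2 + 1))) * L ^+ 2 = e * (L ^+ 2 / (L ^+ 2 + 1)).
    by field; rewrite gt_eqF.
  by rewrite ler_piMr ?(ltW e0)// ler_pdivrMr// mul1r lerDl.
move=> e0; have [de de0 deP] := hbe e e0.
have [n hn] : exists n, L / 2 ^+ n < de.
  have [n hn] : exists n : nat, L / de < n%:R.
    by exists (Num.bound (L / de)); apply: archi_boundP; rewrite divr_ge0// ltW.
  exists n; rewrite ltr_pdivrMr ?exprn_gt0// -ltr_pdivrMl// mulrC (lt_le_trans hn)//.
  by rewrite -natrX ler_nat ltnW// ltn_expl.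
have [[i1 i2 i3 i4 i5] _] := inv n.
rewrite (le_trans i5)// rE /J.
pose Ln := L / 2 ^+ n.
have hsm : nc (rect_int (an n) (bn n) (cn n) (dn n)) <= 2 * (e * Ln) * Ln.
  rewrite /Ln -i4; apply: (@rect_int_small _ _ _ _ (s0 +i* t0) (Phi (s0 +i* t0)) be) => //.
  move=> w wab wcd.
  have wL : nc (w - (s0 +i* t0)) <= Ln.
    rewrite (le_trans (nc_le_ReIm _))// ReB ImB /= /Ln -i4.
    have := hs0 n; have := ht0 n; move: wab wcd.
    move=> /andP[? ?] /andP[? ?] /andP[? ?] /andP[? ?].
    by apply: lerD; rewrite ler_norml; apply/andP; split; lra.
  rewrite (le_trans (deP _ (le_lt_trans wL hn)))// i4 ler_wpM2l// ltW//.
rewrite (le_trans (ler_wpM2l _ hsm)) ?exprn_ge0//.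
have n2 : (2 ^+ n : R) != 0 by rewrite expf_neq0.
rewrite /Ln (_ : 4 = 2 ^+ 2 :> R) ?natrX//; last by rewrite -natrX.
rewrite -exprM mulnC exprM le_eqVlt; apply/orP; left; apply/eqP; by field.
Qed.

End goursat.

(** * Cauchy and Poisson kernels on the circle *)

Lemma pmule_lty (R : realType) (c : R) (y : \bar R) : 0 < c ->
  ((c%:E * y < +oo) = (y < +oo))%E.
Proof.
by case: y => [y| |] c0; rewrite -?EFinM ?ltry// ?gt0_muley ?gt0_muleNy.
Qed.

Section circle_integral.
Variable R : realType.
Local Notation C := R[i].
Local Notation T := (circle R).
Local Notation m := (@circle_leb R).
Local Notation leb := (@lebesgue_measure R).
Local Notation I2 := (`[0, 2 * pi]%classic : set R).

Definition zeta (x : T) : C := val x.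

Lemma nc_val (x : T) : nc (zeta x) = 1.
Proof. by rewrite /zeta; case: x => z /=; rewrite normcE => /eqP [/eqP]; rewrite /= => /eqP. Qed.

Lemma valJ (x : T) : (cj (zeta x)) = (zeta x)^-1.
Proof.
have v0 : zeta x != 0 by rewrite -nc_eq0 nc_val oner_eq0.
by apply: (mulfI v0); rewrite mulcJ nc_val expr1n divff.
Qed.

Lemma expi_cexp (t : R) : zeta (expi t) = cexp (0 +i* t).
Proof. by rewrite /cexp /= expR0 mul1r. Qed.

(** Immediate in both directions, because the sigma-algebra of the circle is coinduced by [expi]. *)
Lemma meas_circleP (g : T -> R) :
  measurable_fun setT g <-> measurable_fun [set: measurableTypeR R] (fun t => g (expi t)).
Proof.
split=> [mg|mg]; first exact: (measurableT_comp mg (@measurable_expi R)).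
by move=> _ A mA; rewrite setTI; have := mg measurableT A mA; rewrite setTI.
Qed.

Lemma cmeas_circleP (g : T -> C) :
  cmeas setT g <-> cmeas [set: measurableTypeR R] (fun t => g (expi t)).
Proof.
by split=> -[h1 h2]; split; exact/(meas_circleP (fun x => _ (g x))).
Qed.

Lemma ge0_int_circle (g : T -> \bar R) : measurable_fun setT g ->
  (forall x, 0 <= g x)%E ->
  (\int[m]_x g x = ((2 * pi)^-1)%:E * \int[leb]_(t in I2) g (expi t))%E.
Proof.
move=> mg g0.
rewrite (ge0_integral_pushforward (@measurable_expi R) _ measurableT mg)//.
rewrite preimage_setT integral_uniform; first by rewrite subr0.
  exact: (measurableT_comp mg (@measurable_expi R)).
by move=> x; exact: g0.
Qed.

Lemma integrable_circleP (g : T -> R) :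
  measurable_fun setT g -> (m.-integrable setT (EFin \o g) <->
  leb.-integrable I2 (fun t => (g (expi t))%:E)).
Proof.
move=> mg; have mg' := (meas_circleP _).1 mg.
have eq : (\int[m]_x `|(g x)%:E| =
    ((2 * pi)^-1)%:E * \int[leb]_(t in I2) `|(g (expi t))%:E|)%E.
  by rewrite ge0_int_circle//; do 2 apply: measurableT_comp => //.
have pi0 : 0 < (2 * pi)^-1 :> R by rewrite invr_gt0 pi2_gt0.
split=> /integrableP[_ h]; apply/integrableP; split.
- by apply: measurable_funTS; apply/measurable_EFinP.
- by move: h; rewrite eq pmule_lty.
- exact/measurable_EFinP.
- by rewrite eq pmule_lty.
Qed.

Lemma Rint_circle (g : T -> R) : m.-integrable setT (EFin \o g) ->
  Rintegral m setT g = (2 * pi)^-1 * Rintegral leb I2 (fun t => g (expi t)).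
Proof.
move=> ig.
have mg : measurable_fun setT g by apply/measurable_EFinP; exact: measurable_int ig.
have ig' := (integrable_circleP mg).1 ig.
rewrite /Rintegral integralE [in RHS]integralE.
have mp : measurable_fun setT (EFin \o g)^\+%E by apply/measurable_funepos/measurable_EFinP.
have mn : measurable_fun setT (EFin \o g)^\-%E by apply/measurable_funeneg/measurable_EFinP.
rewrite (ge0_int_circle mp)// (ge0_int_circle mn)//.
have fp : (\int[leb]_(t in I2) (fun t => (g (expi t))%:E)^\+ t)%E \is a fin_num.
  by apply: integrable_fin_num => //; exact: integrable_funepos.
have fn : (\int[leb]_(t in I2) (fun t => (g (expi t))%:E)^\- t)%E \is a fin_num.
  by apply: integrable_fin_num => //; exact: integrable_funeneg.
have aux (a b : \bar R) (c : R) : a \is a fin_num -> b \is a fin_num ->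
    fine (c%:E * a - c%:E * b)%E = c * fine (a - b)%E.
  by move=> /fineK <- /fineK <-; rewrite -!EFinM -!EFinB /= mulrBr.
have e1 : (\int[leb]_(t in I2) (EFin \o g)^\+ (expi t) =
  \int[leb]_(t in I2) (fun t => (g (expi t))%:E)^\+ t)%E.
  by apply: eq_integral => t _; rewrite !funeposE.
have e2 : (\int[leb]_(t in I2) (EFin \o g)^\- (expi t) =
  \int[leb]_(t in I2) (fun t => (g (expi t))%:E)^\- t)%E.
  by apply: eq_integral => t _; rewrite !funenegE.
by rewrite e1 e2 aux.
Qed.

Lemma cintble_circleP (g : T -> C) : cmeas setT g ->
  (cintble m setT g <-> cintble leb I2 (fun t => g (expi t))).
Proof.
move=> [m1 m2]; split=> -[i1 i2]; split.
- exact/(integrable_circleP m1).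
- exact/(integrable_circleP m2).
- exact/(integrable_circleP m1).
- exact/(integrable_circleP m2).
Qed.

Lemma cint_circle (g : T -> C) : cintble m setT g ->
  cint m setT g = ((2 * pi)^-1)%:C * cint leb I2 (fun t => g (expi t)).
Proof.
move=> [i1 i2]; apply: eqcP => /=; first by rewrite mul0r subr0 Rint_circle.
by rewrite mul0r addr0 Rint_circle.
Qed.

Lemma ccont_cmeas (g : R -> C) : (forall x, ccont g x) -> cmeas [set: measurableTypeR R] g.
Proof.
move=> cg; split; apply: continuous_measurable_fun => x;
  apply/cvgrPdist_lt => e /(cg x)[d d0 dP]; apply/nbhs_ballP; exists d => //= y;
  rewrite /ball/= distrC => /dP yx; rewrite (le_lt_trans _ yx)// distrC.
- by rewrite -ReB Re_le_nc.
- by rewrite -ImB Im_le_nc.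
Qed.

Lemma ccont_circle (g : T -> C) : (forall t, ccont (fun t => g (expi t)) t) ->
  cmeas setT g /\ cintble m setT g.
Proof.
move=> cg; have mg : cmeas setT g by apply/cmeas_circleP; exact: ccont_cmeas.
by split => //; apply/cintble_circleP => //; exact: ccont_cintble.
Qed.

Lemma integrable_cst_circle (k : R) : m.-integrable setT (EFin \o (fun=> k)).
Proof. exact: finite_measure_integrable_cst. Qed.

Lemma Rint_cst_circle (k : R) : Rintegral m setT (fun=> k) = k.
Proof. by rewrite Rintegral_cst//= probability_setT mulr1. Qed.

Lemma cint_cst_circle (k : C) : cint m setT (fun=> k) = k.
Proof. by rewrite /cint !Rint_cst_circle; case: k. Qed.

Lemma cintble_cst_circle (k : C) : cintble m setT (fun=> k).
Proof. by split; exact: integrable_cst_circle. Qed.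

Lemma cintble_bd (g : T -> C) (M : R) : cmeas setT g ->
  (\forall x \ae m, nc (g x) <= M) -> cintble m setT g.
Proof. by move=> mg gM; apply: (cintble_ae_le mg (integrable_cst_circle M)). Qed.

Lemma dilate_holo (F : C -> C) (R0 r : R) : (forall z, nc z < R0 -> holo F z) ->
  0 <= r < R0 ->
  (forall t, ccont (fun t => F (r%:C * zeta (expi t))) t).
Proof.
move=> hF /andP[r0 rR] t e e0.
have hz : nc (r%:C * zeta (expi t)) < R0 by rewrite ncM nc_val mulr1 ncR ger0_norm.
have /cvgrPdist_lt/(_ e e0)/nbhs_nc[d d0 dP] := holo_cvg (hF _ hz).
have d' : 0 < d / (r + 1) by rewrite divr_gt0// ltr_wpDl.
have /cvgrPdist_lt/(_ _ d')/nbhs_nc[d1 d10 d1P] := holo_cvg (@holo_cexp R (0 +i* t)).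
exists d1 => // y yt.
have := dP (r%:C * zeta (expi y)); rewrite sub0r normrN ger0_norm//; apply.
rewrite -mulrBr ncM ncR ger0_norm//.
have := d1P (0 +i* y); rewrite sub0r normrN ger0_norm// -!expi_cexp.
have -> : nc (0 +i* y - 0 +i* t) = `|y - t|.
  by simpc; rewrite /= expr0n add0r sqrtr_sqr.
move=> /(_ yt); rewrite ltr_pdivlMr ?ltr_wpDl// => h; apply: le_lt_trans h.
by rewrite mulrC ler_wpM2l// lerDl.
Qed.

Lemma cintble_dilate (F : C -> C) (R0 r : R) : (forall z, nc z < R0 -> holo F z) ->
  0 <= r < R0 -> cintble m setT (fun x => F (r%:C * zeta x)).
Proof. by move=> hF rR; have [] := @ccont_circle (fun x => F (r%:C * zeta x)) (dilate_holo hF rR). Qed.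

Lemma cmeas_val : cmeas setT (fun x : T => zeta x).
Proof.
have [//|h _] := @ccont_circle (fun x => zeta x).
  move=> t e e0; have := @dilate_holo id 2 1 (fun z _ => @holo_id R z).
  rewrite ler01 ltr1n => /(_ isT t e e0)[d d0 dP].
  by exists d => // y /dP; rewrite -mulrBr ncM ncR normr1 mul1r.
exact: h.
Qed.

Lemma cmeas_valJ : cmeas setT (fun x : T => (cj (zeta x))).
Proof. exact/cmeasJ/cmeas_val. Qed.

(** Apply Goursat's theorem to [Psi] composed with [cexp] on the rectangle with sides [ln r, ln r']
    and [0, 2 pi]. The horizontal sides cancel by periodicity, and the vertical sides are the two
    circle means. All the Cauchy theory used later is derived from this invariance. *)
Lemma mean_annulus (Psi : C -> C) (R0 r r' : R) :
  (forall z, 0 < nc z < R0 -> holo Psi z) -> 0 < r < R0 -> 0 < r' < R0 ->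
  cint m setT (fun x => Psi (r%:C * zeta x)) = cint m setT (fun x => Psi (r'%:C * zeta x)).
Proof.
move=> hP; wlog rr' : r r' / r <= r'.
  move=> H hr hr'; have [rr'|/ltW r'r] := leP r r'; first exact: H.
  by apply/esym; apply: H.
move=> /andP[r0 rR] /andP[r'0 r'R].
have R00 : 0 < R0 by apply: lt_trans rR.
have hPhi w : Re w < ln R0 -> holo (fun w => Psi (cexp w)) w.
  move=> wR; apply: holo_comp; first exact: holo_cexp.
  by apply: hP; rewrite nc_cexp expR_gt0 -ltr_ln ?posrE ?expR_gt0// expRK.
have lr : ln r <= ln r' by rewrite ler_ln ?posrE.
have lr'R : ln r' < ln R0 by rewrite ltr_ln ?posrE.
have per s : cexp (s +i* (2 * pi)) = cexp (s +i* 0).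
  by rewrite /cexp /= mulr_natl cos2pi sin2pi cos0 sin0.
have := goursat_rect hPhi lr (ltW (pi2_gt0 R)) lr'R.
rewrite /rect_int; set h0 := cint _ _ _; set h1 := cint _ _ _.
have -> : h0 = h1 by apply: eq_cint => s _; rewrite per.
rewrite subrr add0r => /eqP; rewrite mulf_eq0 => /orP[|].
  by rewrite -nc_eq0 nc_i oner_eq0.
rewrite subr_eq0 => /eqP H.
have E (s : R) : 0 < s -> forall t, s%:C * zeta (expi t) = cexp (ln s +i* t).
  by move=> s0 t; rewrite /cexp /= lnK.
have I (s : R) : 0 < s < R0 -> cint m setT (fun x => Psi (s%:C * zeta x)) =
   ((2 * pi)^-1)%:C * cint leb I2 (fun t => Psi (cexp (ln s +i* t))).
  move=> /andP[s0 sR]; have c t : ccont (fun t => Psi (s%:C * zeta (expi t))) t.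
    have -> : (fun t => Psi (s%:C * zeta (expi t))) = (fun t => Psi (cexp (ln s +i* t))).
      by apply/funext => u; rewrite E.
    by apply: (ccont_ver hPhi); rewrite ltr_ln ?posrE.
  rewrite cint_circle; last by case: (@ccont_circle (fun x => Psi (s%:C * zeta x)) c).
  by congr (_ * _); apply: eq_cint => t _; rewrite E.
have hr : 0 < r < R0 by rewrite r0.
have hr' : 0 < r' < R0 by rewrite r'0.
by rewrite (I _ hr) (I _ hr') H.
Qed.

End circle_integral.

(** * Fourier coefficients, Cauchy and Poisson integrals *)

Section kernels.
Variable R : realType.
Local Notation C := R[i].
Local Notation T := (circle R).
Local Notation m := (@circle_leb R).
Local Notation cintm := (cint m setT).
Local Notation L1 := (cintble m setT).

Definition N1 (g : T -> C) : R := Rintegral m setT (fun x => nc (g x)).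

Lemma N1_ge0 g : 0 <= N1 g.
Proof. by apply: Rintegral_ge0 => x _. Qed.

Lemma nc_cintm g : L1 g -> nc (cintm g) <= N1 g.
Proof. by move=> ig; exact: nc_cint. Qed.

Lemma L1M g h M : L1 g -> cmeas setT h -> (forall x, nc (h x) <= M) ->
  L1 (fun x => g x * h x).
Proof. by move=> ig mh hM; exact: (cintbleM measurableT ig mh (fun x _ => hM x)). Qed.

Lemma val_neq0 (x : T) : zeta x != 0.
Proof. by rewrite -nc_eq0 nc_val oner_eq0. Qed.

Lemma val_valJ (x : T) : zeta x * (cj (zeta x)) = 1.
Proof. by rewrite valJ divff ?val_neq0. Qed.

Lemma nc_valJ (x : T) : nc (cj (zeta x)) = 1. Proof. by rewrite ncJ nc_val. Qed.

Lemma nc_valX (x : T) k : nc (zeta x ^+ k) = 1.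
Proof. by rewrite ncX nc_val expr1n. Qed.

Lemma nc_valJX (x : T) k : nc ((cj (zeta x)) ^+ k) = 1.
Proof. by rewrite ncX nc_valJ expr1n. Qed.

(* The Fourier coefficients of index k and -k. *)
Definition fc (g : T -> C) (k : nat) : C := cintm (fun x => g x * (cj (zeta x)) ^+ k).
Definition fn (g : T -> C) (k : nat) : C := cintm (fun x => g x * zeta x ^+ k).

Lemma L1_valX g k : L1 g -> L1 (fun x => g x * zeta x ^+ k).
Proof.
move=> ig; apply: (@L1M _ _ 1 ig).
  exact/cmeasX/cmeas_val.
by move=> x; rewrite nc_valX.
Qed.

Lemma L1_valJX g k : L1 g -> L1 (fun x => g x * (cj (zeta x)) ^+ k).
Proof.
move=> ig; apply: (@L1M _ _ 1 ig).
  exact/cmeasX/cmeas_valJ.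
by move=> x; rewrite nc_valJX.
Qed.

(** The mean of z^k over the circle of radius r is r^k times this integral and does not depend on r;
    compare r = 1 with r = 1/2. *)
Lemma cint_char k : (0 < k)%N -> cintm (fun x => zeta x ^+ k) = 0.
Proof.
move=> k0.
have h1 : 0 < (1 : R) < 2 by apply/andP; split; [exact: ltr01|rewrite ltr1n].
have h2 : 0 < (2^-1 : R) < 2 by apply/andP; split; lra.
have hol : forall z : C, 0 < nc z < 2 -> holo (fun z => z ^+ k) z.
  by move=> z _; apply/holoX/holo_id.
have Lk : L1 (fun x => zeta x ^+ k).
  have := @L1_valX (fun=> 1) k (cintble_cst_circle 1).
  by congr cintble; apply/funext => x; rewrite mul1r.
have := mean_annulus hol h1 h2.
have e r : cintm (fun x => (r%:C * zeta x) ^+ k) = (r ^+ k)%:C * cintm (fun x => zeta x ^+ k).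
  by rewrite -cintZ//; congr cint; apply/funext => x; rewrite exprMn rcX.
rewrite !e expr1n => /eqP; rewrite -subr_eq0 -mulrBl mulf_eq0 => /orP[|/eqP//].
rewrite -rcB -nc_eq0 ncR normr_eq0 subr_eq0 => /eqP h.
suff : (2^-1 : R) ^+ k < 1 by rewrite -h ltxx.
by rewrite exprn_ilt1// ?invr_ge0// -?lt0n// invf_lt1// ltr1n.
Qed.

(* The Cauchy and the Poisson kernel; Cau g and Poi g are the corresponding
   integrals of g. *)
Definition cz (z : C) (x : T) : C := (1 - z * (cj (zeta x)))^-1.
Definition pz (z : C) (x : T) : R := (1 - nc z ^+ 2) / nc (1 - z * (cj (zeta x))) ^+ 2.
Definition Cau (g : T -> C) (z : C) : C := cintm (fun x => g x * cz z x).
Definition Poi (g : T -> C) (z : C) : C := cintm (fun x => g x * (pz z x)%:C).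

Lemma nc_den z (x : T) : 1 - nc z <= nc (1 - z * (cj (zeta x))).
Proof. by have := ncB_ge 1 (z * (cj (zeta x))); rewrite nc1 ncM nc_valJ mulr1. Qed.

Lemma den_neq0 z (x : T) : nc z < 1 -> 1 - z * (cj (zeta x)) != 0.
Proof.
by move=> z1; rewrite -nc_gt0 (lt_le_trans _ (nc_den z x))// subr_gt0.
Qed.

Lemma nc_cz z x : nc z < 1 -> nc (cz z x) <= (1 - nc z)^-1.
Proof.
move=> z1; rewrite /cz ncV lef_pV2 ?nc_den// posrE ?subr_gt0//.
by rewrite nc_gt0 den_neq0.
Qed.

Lemma pz_ge0 z x : nc z < 1 -> 0 <= pz z x.
Proof.
by move=> z1; rewrite divr_ge0 ?exprn_ge0// subr_ge0 expr_le1// ltW.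
Qed.

(** The splitting into an analytic and an anti-analytic part: [cj (cz z x) - 1] expands in the
    powers of [zeta x] of index at least 1, so that against [g] it only sees the coefficients
    [fn g k] with [0 < k]. *)
Lemma pzE z x : nc z < 1 -> (pz z x)%:C = cz z x + (cj (cz z x)) - 1.
Proof.
move=> z1; rewrite /pz /cz.
have d0 := den_neq0 x z1.
set w := z * (cj (zeta x)) in d0 *.
have -> : nc z = nc w by rewrite /w ncM nc_valJ mulr1.
rewrite rcM rcV rcB -!mulcJ [cj (_^-1)]fmorphV.
have d0' : (cj (1 - w)) != 0 by rewrite -nc_eq0 ncJ nc_eq0.
rewrite conjcB conjc1 in d0' *.
field; by rewrite d0 d0'.
Qed.

Lemma pz_le z x : nc z < 1 -> pz z x <= 2 / (1 - nc z).
Proof.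
move=> z1; rewrite /pz; have d0 : 0 < 1 - nc z by rewrite subr_gt0.
rewrite (_ : 1 - nc z ^+ 2 = (1 + nc z) * (1 - nc z)); last by ring.
rewrite expr2 invfM mulrA ler_pM//.
- by apply: divr_ge0 => //; apply: mulr_ge0; [exact: addr_ge0|exact: ltW].
- by rewrite invr_ge0.
- rewrite ler_pdivrMr ?(lt_le_trans d0 (nc_den _ _))// mulrC.
  rewrite [leRHS]mulrC; apply: ler_pM; [exact: ltW|exact: addr_ge0|exact: nc_den|].
  by rewrite [leRHS]mulr2n lerD// ltW.
- by rewrite lef_pV2 ?nc_den// posrE// (lt_le_trans d0 (nc_den _ _)).
Qed.

Lemma cmeas_cz z : nc z < 1 -> cmeas setT (cz z).
Proof.
move=> z1; have [//|h _] := @ccont_circle R (cz z); last exact: h.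
move=> t e e0.
have hF (w : C) : nc w < 2 -> holo (fun w => w) w by move=> _; exact: holo_id.
pose K := (1 - nc z)^-1 ^+ 2.
have K0 : 0 < K by rewrite exprn_gt0// invr_gt0 subr_gt0.
have e' : 0 < e / K by rewrite divr_gt0.
have h1 : 0 <= (1 : R) < 2 by apply/andP; split; [exact: ler01|rewrite ltr1n].
have [d d0 dP] := dilate_holo hF h1 t e'.
exists d => // y /dP; rewrite -mulrBr ncM ncR normr1 mul1r => h.
have -> : cz z (expi y) - cz z (expi t) =
  z * (cj (zeta (expi y) - zeta (expi t))) * cz z (expi y) * cz z (expi t).
  by rewrite conjcB /cz; field; rewrite !den_neq0.
rewrite !ncM ncJ (@le_lt_trans _ _ (nc (zeta (expi y) - zeta (expi t)) * K))//.
  rewrite -mulrA /K expr2 ler_pM ?mulr_ge0//.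
    by rewrite ler_piMl// ltW.
  by rewrite ler_pM// nc_cz.
by rewrite -ltr_pdivlMr.
Qed.

Lemma L1_cz g z : L1 g -> nc z < 1 -> L1 (fun x => g x * cz z x).
Proof.
move=> ig z1; apply: (@L1M _ _ (1 - nc z)^-1 ig).
  exact: cmeas_cz.
by move=> x; exact: nc_cz.
Qed.

Lemma cmeas_pz z : nc z < 1 -> cmeas setT (fun x => (pz z x)%:C).
Proof.
move=> z1; rewrite (_ : (fun x => _) = (fun x => cz z x + (cj (cz z x)) - 1)); last first.
  by apply/funext => x; rewrite pzE.
apply: cmeasB; last exact: cmeas_cst.
by apply: cmeasD; [exact: cmeas_cz|exact/cmeasJ/cmeas_cz].
Qed.

Lemma meas_pz z : nc z < 1 -> measurable_fun setT (pz z).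
Proof. by move=> /cmeas_pz []. Qed.

Lemma L1_pz g z : L1 g -> nc z < 1 -> L1 (fun x => g x * (pz z x)%:C).
Proof.
move=> ig z1; apply: (@L1M _ _ (2 / (1 - nc z)) ig).
  exact: cmeas_pz.
by move=> x; rewrite ncR ger0_norm ?pz_ge0// pz_le.
Qed.

Lemma L1_conj_cz g z : L1 g -> nc z < 1 -> L1 (fun x => g x * ((cj (cz z x)) - 1)).
Proof.
move=> ig z1; apply: (@L1M _ _ ((1 - nc z)^-1 + 1) ig).
  by apply: cmeasB; [exact/cmeasJ/cmeas_cz|exact: cmeas_cst].
by move=> x; rewrite (le_trans (ncB _ _))// nc1 ncJ lerD2r nc_cz.
Qed.

Lemma geom_cz (w : C) n : 1 - w != 0 ->
  (1 - w)^-1 = \sum_(k < n) w ^+ k + w ^+ n * (1 - w)^-1.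
Proof.
move=> w1; apply: (mulfI w1); rewrite divff// mulrDr mulrCA divff// mulr1.
by rewrite -opprB mulNr -subrX1 opprB subrK.
Qed.

(** Finite geometric series with explicit remainder, so that no sum has to be exchanged with the
    integral. The geometric rate makes all later identifications of coefficients elementary. *)
Lemma Cau_partial g z n : L1 g -> nc z < 1 ->
  nc (Cau g z - \sum_(k < n) z ^+ k * fc g k) <= nc z ^+ n * (1 - nc z)^-1 * N1 g.
Proof.
move=> ig z1.
have h x : g x * cz z x - \sum_(k < n) z ^+ k * (g x * (cj (zeta x)) ^+ k) =
           g x * cz z x * (z * (cj (zeta x))) ^+ n.
  rewrite {1}/cz (geom_cz n (den_neq0 x z1)) mulrDr mulr_sumr addrAC.
  rewrite (eq_bigr (fun k : 'I_n => z ^+ k * (g x * (cj (zeta x)) ^+ k))); last first.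
    by move=> k _; rewrite exprMn mulrCA.
  by rewrite subrr add0r /cz mulrCA mulrC.
have i0 (k : 'I_n) : L1 (fun x => z ^+ k * (g x * (cj (zeta x)) ^+ k)).
  by apply: cintbleZ => //; exact: L1_valJX.
have [i1 E1] := cint_sum (mu := m) measurableT (index_enum _) i0.
have -> : \sum_(k < n) z ^+ k * fc g k =
    cintm (fun x => \sum_(k < n) z ^+ k * (g x * (cj (zeta x)) ^+ k)).
  by rewrite E1; apply: eq_bigr => k _; rewrite cintZ//; exact: L1_valJX.
rewrite /Cau -cintB//; last exact: L1_cz.
have i2 := cintbleB measurableT (L1_cz ig z1) i1.
rewrite (le_trans (nc_cintm i2))// /N1.
rewrite -RintegralZl//; last exact: cintble_nc.
apply: le_Rintegral => //.
- exact: cintble_nc.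
- rewrite [X in integrable _ _ X](_ : _ = fun x => ((nc z ^+ n * (1 - nc z)^-1)%:E * (nc (g x))%:E)%E)//.
  exact/integrableZl/cintble_nc.
- move=> x _; rewrite h !ncM ncX ncM nc_valJ mulr1 -mulrA mulrC ler_wpM2r//.
  by rewrite [leRHS]mulrC ler_wpM2r ?exprn_ge0// nc_cz.
Qed.

Lemma geom_small (a K e : R) : 0 <= a < 1 -> 0 < e -> exists n : nat, a ^+ n * K < e.
Proof.
move=> /andP[a0 a1] e0.
have /cvgrPdist_lt : (fun n => K * a ^+ n) @ \oo --> K * 0.
  by apply: cvgM; [exact: cvg_cst|apply: cvg_expr; rewrite ger0_norm].
rewrite mulr0 => /(_ e e0)[n _ /(_ n)]; rewrite /= leqnn sub0r normrN => /(_ isT).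
by exists n; rewrite mulrC (le_lt_trans (ler_norm _)).
Qed.

Lemma nc_small_eq (z w : C) : (forall e : R, 0 < e -> nc (z - w) <= e) -> z = w.
Proof.
move=> h; apply/eqP; rewrite -subr_eq0 -nc_eq0 eq_le nc_ge0 andbT.
by apply/ler_addgt0Pr => e e0; rewrite add0r h.
Qed.

Lemma conj_cz_partial g z : L1 g -> nc z < 1 -> (forall k, (0 < k)%N -> fn g k = 0) ->
  cintm (fun x => g x * ((cj (cz z x)) - 1)) = 0.
Proof.
move=> ig z1 g0.
have igJ := cintbleJ measurableT ig.
apply: nc_small_eq => e e0; rewrite subr0.
have [n hn] : exists n, nc z ^+ n * ((1 - nc z)^-1 * N1 g) < e.
  by apply: geom_small; rewrite ?nc_ge0.
have fcJ k : fc (fun x => (cj (g x))) k = (cj (fn g k)).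
  rewrite /fc /fn -cintJ//; last exact: L1_valX.
  by congr cint; apply/funext => x; rewrite conjcM conjcX.
have -> : cintm (fun x => g x * ((cj (cz z x)) - 1)) = (cj (Cau (fun x => (cj (g x))) z - fc (fun x => (cj (g x))) 0)).
  rewrite /Cau /fc -cintB//; [|exact: L1_cz|exact: L1_valJX].
  rewrite -cintJ//; last by apply: cintbleB => //; [exact: L1_cz|exact: L1_valJX].
  congr cint; apply/funext => x; rewrite conjcB !conjcM conjcK expr0 conjc1 mulr1.
  by rewrite mulrBr mulr1.
rewrite ncJ; apply/ltW/le_lt_trans/hn.
(* Length [n.+1], since the term of index 0 has to be split off: it is the one subtracted above, and
   all others vanish. *)
have := Cau_partial n.+1 igJ z1; rewrite big_ord_recl expr0 mul1r big1 ?addr0; last first.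
  by move=> k _; rewrite fcJ g0// conjc0 mulr0.
have -> : N1 (fun x => (cj (g x))) = N1 g.
  by congr Rintegral; apply/funext => x; rewrite ncJ.
move=> /le_trans; apply; rewrite -mulrA ler_wpM2r//.
  by rewrite mulr_ge0 ?N1_ge0// invr_ge0 subr_ge0 ltW.
by rewrite exprS ler_piMl ?exprn_ge0// ltW.
Qed.

(** When the coefficients of negative index vanish, the anti-analytic part of the kernel contributes
    nothing; this makes the Poisson extension holomorphic. *)
Lemma Poi_Cau g z : L1 g -> nc z < 1 -> (forall k, (0 < k)%N -> fn g k = 0) ->
  Poi g z = Cau g z.
Proof.
move=> ig z1 g0.
transitivity (cintm (fun x => g x * cz z x + g x * ((cj (cz z x)) - 1))).
  by congr cint; apply/funext => x; rewrite pzE// -addrA mulrDr.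
by rewrite cintD ?conj_cz_partial ?addr0//; [exact: L1_cz|exact: L1_conj_cz].
Qed.

Lemma Poi1 z : nc z < 1 -> Rintegral m setT (pz z) = 1.
Proof.
move=> z1; have i1 := @cintble_cst_circle R 1.
have h0 k : (0 < k)%N -> fn (fun=> 1) k = 0.
  by move=> k0; rewrite /fn -[RHS](cint_char k0); congr cint; apply/funext => x; rewrite mul1r.
have : Poi (fun=> 1) z = 1.
  rewrite Poi_Cau//; apply: nc_small_eq => e e0.
  have [n hn] : exists n, nc z ^+ n * ((1 - nc z)^-1 * N1 (fun=> 1)) < e.
    by apply: geom_small; rewrite ?nc_ge0.
  have := Cau_partial n.+1 i1 z1; rewrite big_ord_recl expr0 mul1r big1 ?addr0; last first.
    move=> k _; suff -> : fc (fun=> 1) (lift ord0 k) = 0 by rewrite mulr0.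
    transitivity ((cj (fn (fun=> 1) (lift ord0 k)))); last by rewrite h0// conjc0.
    rewrite /fc /fn -cintJ//; last exact: L1_valX.
    by congr cint; apply/funext => x; rewrite conjcM conjcX conjc1.
  have -> : fc (fun=> 1) 0 = 1.
    rewrite /fc -[RHS](@cint_cst_circle R 1); congr cint; apply/funext => x.
    by rewrite expr0 mulr1.
  move=> /le_trans; apply; apply/ltW/le_lt_trans/hn; rewrite -mulrA ler_wpM2r//.
    by rewrite mulr_ge0 ?N1_ge0// invr_ge0 subr_ge0 ltW.
  by rewrite exprS ler_piMl ?exprn_ge0// ltW.
move=> /(congr1 (@complex.Re R)) /= <-.
by congr Rintegral; apply/funext => x; rewrite mul1r mul0r subr0.
Qed.

Lemma integrable_pz z : nc z < 1 -> m.-integrable setT (EFin \o pz z).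
Proof.
move=> z1; have [+ _] := L1_pz (cintble_cst_circle 1) z1; congr integrable.
by apply/funext => x; rewrite mul1r.
Qed.

Lemma Cau_holo g z : L1 g -> nc z < 1 -> holo (Cau g) z.
Proof.
(* Points within [q] of [z] keep distance [q] from the circle, so all kernels below are at most
   [q^-1]. The remainder of second order is exactly (w - z)^2 times a product of three bounded
   kernels. *)
move=> ig z1; set q := (1 - nc z) / 2.
have q0 : 0 < q by rewrite divr_gt0// subr_gt0.
pose Q := q^-1 ^+ 3 * (N1 g + 1).
have Q0 : 0 < Q by rewrite mulr_gt0 ?exprn_gt0 ?invr_gt0// ltr_wpDl ?N1_ge0.
apply: (@diff_holo _ _ _ (cintm (fun x => g x * ((cj (zeta x)) * cz z x ^+ 2)))) => e e0.
exists (Num.min q (e / Q)) => [|w]; first by rewrite lt_min q0 divr_gt0.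
rewrite lt_min => /andP[wq wQ].
have w1 : nc w <= 1 - q.
  by have := ncD (w - z) z; rewrite subrK /q; move: wq; rewrite /q; lra.
have w1' : nc w < 1 by rewrite (le_lt_trans w1)// gtrBl.
have i3 : L1 (fun x => g x * ((cj (zeta x)) * cz z x ^+ 2)).
  apply: (@L1M _ _ ((1 - nc z)^-1 ^+ 2) ig).
    by apply: cmeasM; [exact: cmeas_valJ|exact/cmeasX/cmeas_cz].
  by move=> x; rewrite ncM nc_valJ mul1r ncX lerXn2r ?nnegrE ?nc_ge0 ?nc_cz// invr_ge0 subr_ge0 ltW.
have -> : Cau g w - Cau g z - cintm (fun x => g x * ((cj (zeta x)) * cz z x ^+ 2)) * (w - z) =
  cintm (fun x => (w - z) ^+ 2 * (g x * ((cj (zeta x)) ^+ 2 * cz w x * cz z x ^+ 2))).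
  rewrite /Cau -cintB//; [|exact: L1_cz|exact: L1_cz].
  rewrite -cintZr// -cintB//; [|by apply: cintbleB => //; exact: L1_cz|].
    congr cint; apply/funext => x; rewrite /cz; field.
    by rewrite !den_neq0.
  rewrite (_ : (fun x => _ * (w - z)) = (fun x => (w - z) * (g x * ((cj (zeta x)) * cz z x ^+ 2)))).
    exact: cintbleZ.
  by apply/funext => x; rewrite mulrC.
have bq x : nc ((cj (zeta x)) ^+ 2 * cz w x * cz z x ^+ 2) <= q^-1 ^+ 3.
  rewrite ncM [nc (_ * cz w x)]ncM nc_valJX mul1r ncX [q^-1 ^+ 3]exprS ler_pM ?exprn_ge0//.
    rewrite (le_trans (nc_cz x w1'))// lef_pV2 ?posrE ?subr_gt0//.
    by move: w1; lra.
  rewrite lerXn2r ?nnegrE ?invr_ge0 ?(ltW q0)//.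
  rewrite (le_trans (nc_cz x z1))// lef_pV2 ?posrE ?subr_gt0//.
  by rewrite /q; move: q0; rewrite /q; lra.
have i4 : L1 (fun x => g x * ((cj (zeta x)) ^+ 2 * cz w x * cz z x ^+ 2)).
  apply: (@L1M _ _ (q^-1 ^+ 3) ig).
    apply: cmeasM; last exact/cmeasX/cmeas_cz.
    by apply: cmeasM; [exact/cmeasX/cmeas_valJ|exact: cmeas_cz].
  exact: bq.
rewrite cintZ// ncM ncX expr2 -mulrA mulrC ler_wpM2r//.
rewrite (@le_trans _ _ (nc (w - z) * Q))//.
  rewrite ler_wpM2l// (le_trans (nc_cintm i4))// /N1.
  rewrite (@le_trans _ _ (q^-1 ^+ 3 * N1 g))//; last first.
    by rewrite ler_wpM2l ?exprn_ge0 ?invr_ge0 ?(ltW q0)// lerDl.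
  rewrite /N1 -RintegralZl//; last exact: cintble_nc.
  apply: le_Rintegral => //; first exact: cintble_nc.
    rewrite [X in integrable _ _ X](_ : _ = fun x => ((q^-1 ^+ 3)%:E * (nc (g x))%:E)%E)//.
    exact/integrableZl/cintble_nc.
  by move=> x _; rewrite ncM mulrC ler_wpM2r.
by rewrite -ler_pdivlMr// ltW.
Qed.

End kernels.

(** * Radial limits of Poisson integrals *)

Section dyadic.
Variable R : realType.
Local Notation leb := (@lebesgue_measure R).

(* Dyadic decomposition: on the shell of radius 2^k y the kernel is at most a
   constant times 2^-(2k) / y, whereas the integral of psi is at most 2^(k+1) y e. *)
Lemma dyadic_kernel (psi K : R -> R) (t0 y d e : R) :
  measurable_fun [set: R] psi -> measurable_fun [set: R] K ->
  (forall t, 0 <= psi t) -> (forall t, 0 <= K t) -> 0 < y -> y < d -> 0 <= e ->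
  (forall h, 0 < h -> h <= d ->
    (\int[leb]_(t in ball t0 h) (psi t)%:E <= (2 * h * e)%:E)%E) ->
  (forall t, `|t - t0| < d -> K t <= 2 / y) ->
  (forall t, `|t - t0| < d -> K t * (t - t0) ^+ 2 <= 16 * y) ->
  (\int[leb]_(t in ball t0 d) (psi t * K t)%:E <= (136 * e)%:E)%E.
Proof.
move=> mpsi mK psi0 K0 y0 yd e0 hpsi K1 K2.
have mball h : measurable (ball t0 h : set (measurableTypeR R)) by exact: measurable_ball.
have mE (f : R -> R) (A : set (measurableTypeR R)) : measurable_fun [set: R] f ->
    measurable_fun A (fun t => (f t)%:E).
  by move=> mf; apply/measurable_EFinP/measurable_funTS.
have mpK : measurable_fun [set: R] (fun t => psi t * K t) by exact: measurable_funM.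
have scal (A : set (measurableTypeR R)) (c h : R) : measurable A -> 0 <= c -> 0 < h -> h <= d ->
    A `<=` ball t0 h -> (forall t, A t -> K t <= c) ->
    (\int[leb]_(t in A) (psi t * K t)%:E <= (c * (2 * h * e))%:E)%E.
  move=> mA c0 h0 hd Ah Kc.
  apply: (@le_trans _ _ (\int[leb]_(t in A) (c%:E * (psi t)%:E))%E).
    apply: ge0_le_integral => //.
    - by move=> t _; rewrite lee_fin mulr_ge0.
    - exact: mE.
    - by apply: mE; apply: measurable_funM => //; exact: measurable_cst.
    - by move=> t At; rewrite -EFinM lee_fin mulrC ler_wpM2r// Kc.
  rewrite ge0_integralZl//; [|exact: mE|by move=> t _; rewrite lee_fin].
  rewrite EFinM lee_wpmul2l ?lee_fin//; apply: le_trans (hpsi _ h0 hd).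
  apply: ge0_subset_integral => //; first exact: mE.
  by move=> t _; rewrite lee_fin.
(* The innermost radius d / 2^n lies between y and 2 y: small enough for the bound [2 / y] on the
   kernel to be efficient, and no smaller than needed. *)
have [n hn hmin] : exists2 n, d / 2 ^+ n < 2 * y & y <= d / 2 ^+ n.
  have ex : exists n, d / 2 ^+ n < 2 * y.
    have [n hn] := @geom_small R 2^-1 d (2 * y) (ltac:(apply/andP; split; lra)) (ltac:(lra)).
    by exists n; rewrite mulrC -exprVn.
  case: (ex_minnP ex) => -[|n] hn hmin; [exists 0%N => //|exists n.+1 => //].
  - by rewrite expr0 divr1 ltW.
  - rewrite leNgt; apply/negP => h; suff /hmin : d / 2 ^+ n < 2 * y by rewrite ltnn.
    move: h; rewrite exprSr invfM mulrA => h.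
    by move: h; set x := d / 2 ^+ n; lra.
pose h k := d / 2 ^+ n * 2 ^+ k.
have d0 : 0 < d by exact: lt_trans yd.
have h0 k : 0 < h k by rewrite mulr_gt0 ?divr_gt0 ?exprn_gt0.
have yh k : y <= h k by rewrite (le_trans hmin)// ler_peMr ?exprn_ege1 ?ler1n// ltW// divr_gt0 ?exprn_gt0.
have hn_d : h n = d by rewrite /h divfK// expf_neq0.
(* The sum over the shells is built into the induction hypothesis. A shell adds 64 (y / h k), which
   is half of 128 (y / h k), the drop caused by doubling the radius; the innermost ball costs at
   most 8 = 136 - 128. *)
suff H : forall k, (k <= n)%N ->
    (\int[leb]_(t in ball t0 (h k)) (psi t * K t)%:E <= (e * (136 - 128 * (y / h k)))%:E)%E.
  rewrite -{1}hn_d (le_trans (H n _))// lee_fin mulrC ler_wpM2r// gerBl.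
  by rewrite mulr_ge0// divr_ge0// ltW.
have hd k : (k <= n)%N -> h k <= d.
  move=> kn; rewrite -hn_d /h ler_wpM2l ?divr_ge0 ?exprn_ge0 ?(ltW d0)//.
  by rewrite ler_eXn2l// ltr1n.
elim=> [|k IH] kn.
  rewrite (le_trans (@scal _ (2 / y) (h 0%N) _ _ _ _ _ _))//.
  - by rewrite divr_ge0// ltW.
  - exact: hd.
  - by move=> t; rewrite /ball /= distrC => th; apply: K1; rewrite (lt_le_trans th)// hd.
  rewrite lee_fin.
  have a1 : y / h 0%N <= 1 by rewrite ler_pdivrMr// mul1r.
  have a2 : h 0%N / y <= 2 by rewrite ler_pdivrMr// /h expr0 mulr1 ltW.
  have -> : 2 / y * (2 * h 0%N * e) = e * (4 * (h 0%N / y)) by field; rewrite gt_eqF.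
  by rewrite ler_wpM2l//; lra.
have hS : h k.+1 = 2 * h k by rewrite /h exprS; ring.
have mA : measurable (ball t0 (h k.+1) `\` ball t0 (h k) : set (measurableTypeR R)).
  exact: measurableD.
have -> : ball t0 (h k.+1) = ball t0 (h k) `|` (ball t0 (h k.+1) `\` ball t0 (h k)) :> set (measurableTypeR R).
  by rewrite setDUK// hS => t; rewrite /ball /= => /lt_trans; apply; rewrite ltr_pMl ?ltr1n.
rewrite ge0_integral_setU//; first last.
- by apply/disj_setPS => t [? []].
- by move=> t _; rewrite lee_fin mulr_ge0.
- exact: mE.
have kn' := ltnW kn.
have b2 : (\int[leb]_(t in ball t0 (h k.+1) `\` ball t0 (h k)) (psi t * K t)%:E <=
    (16 * y / h k ^+ 2 * (2 * h k.+1 * e))%:E)%E.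
  apply: scal => //.
  - by rewrite divr_ge0 ?exprn_ge0 ?mulr_ge0// ltW.
  - exact: hd.
  - move=> t [] /=; rewrite /ball /= distrC => t1 /negP; rewrite -leNgt => t2.
    rewrite ler_pdivlMr ?exprn_gt0//.
    apply: le_trans (K2 _ (lt_le_trans t1 (hd _ kn))).
    rewrite ler_wpM2l// -[leRHS]real_normK ?num_real//.
    by rewrite lerXn2r ?nnegrE// ltW.
apply: (le_trans (leeD (IH kn') b2)).
rewrite -EFinD lee_fin hS.
have -> : 16 * y / h k ^+ 2 * (2 * (2 * h k) * e) = e * (64 * (y / h k)).
  by field; rewrite gt_eqF.
rewrite -mulrDr ler_wpM2l//.
have -> : y / (2 * h k) = (y / h k) / 2 by field; rewrite gt_eqF.
lra.
Qed.

End dyadic.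

Lemma subr_half_itv (R : realFieldType) (p t : R) : p < t -> t < 2 * p -> 0 < t - p < p.
Proof. by move=> h1 h2; apply/andP; split; lra. Qed.

Lemma reflect_half_itv (R : realFieldType) (p t : R) : p < t -> t < 2 * p -> 0 <= 2 * p - t <= p.
Proof. by move=> h1 h2; apply/andP; split; lra. Qed.

Lemma half_itv_arcs (R : realFieldType) (p a : R) : 0 < p -> 0 < a -> a <= p ->
  0 < 2 * p - a < 2 * p /\ 0 < a < 2 * p.
Proof. by move=> h1 h2 h3; split; apply/andP; split; lra. Qed.

(** * Null sets on the circle and on the line *)

Section circle_ae.
Variable R : realType.
Local Notation C := R[i].
Local Notation T := (circle R).
Local Notation m := (@circle_leb R).
Local Notation leb := (@lebesgue_measure R).
Local Notation I2 := (`[0, 2 * pi]%classic : set R).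

Lemma circle_ReIm (x : T) : Re (zeta x) ^+ 2 + Im (zeta x) ^+ 2 = 1.
Proof. by rewrite -sqr_nc nc_val expr1n. Qed.

Lemma circle_eq (x y : T) : Re (zeta x) = Re (zeta y) -> Im (zeta x) = Im (zeta y) -> x = y.
Proof. by move=> h1 h2; apply/val_inj/eqcP. Qed.

Lemma circle_Re_itv (x : T) : -1 <= Re (zeta x) <= 1.
Proof. by have := Re_le_nc (zeta x); rewrite nc_val ler_norml. Qed.

Lemma sin_acos_circle (x : T) : sin (acos (Re (zeta x))) = `|Im (zeta x)|.
Proof.
rewrite sin_acos ?circle_Re_itv// -sqrtr_sqr; congr Num.sqrt.
by rewrite -(circle_ReIm x) addrAC subrr add0r.
Qed.

Lemma expi_acos (x : T) : 0 <= Im (zeta x) -> expi (acos (Re (zeta x))) = x.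
Proof.
move=> h; apply: circle_eq; rewrite /zeta /=.
  by rewrite acosK// in_itv/= circle_Re_itv.
by rewrite sin_acos_circle ger0_norm.
Qed.

Lemma expi_2pi_acos (x : T) : Im (zeta x) <= 0 -> expi (2 * pi - acos (Re (zeta x))) = x.
Proof.
move=> h; apply: circle_eq; rewrite /zeta /=.
  by rewrite mulr_natl cosB cos2pi sin2pi mul1r mul0r addr0 acosK// in_itv/= circle_Re_itv.
by rewrite mulr_natl sinB cos2pi sin2pi mul0r mul1r sub0r sin_acos_circle ler0_norm// opprK.
Qed.

Lemma expi_surj (x : T) : exists2 t, 0 <= t <= 2 * pi & expi t = x.
Proof.
have /andP[a0 api] := (acos_def (circle_Re_itv x)).1.
have p0 := pi_gt0 R.
have /orP[h|h] := le_total 0 (Im (zeta x)).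
  exists (acos (Re (zeta x))); last exact: expi_acos.
  by rewrite a0 (le_trans api)// ler_peMl ?ler1n// ltW.
exists (2 * pi - acos (Re (zeta x))); last exact/expi_2pi_acos.
by rewrite subr_ge0 gerBl a0 andbT (le_trans api)// ler_peMl ?ler1n// ltW.
Qed.

Lemma meas_Re_val : measurable_fun setT (fun x : T => Re (zeta x)).
Proof. by have [] := @cmeas_val R. Qed.

Lemma meas_Im_val : measurable_fun setT (fun x : T => Im (zeta x)).
Proof. by have [] := @cmeas_val R. Qed.

Lemma meas_acos : measurable_fun (`]-1, 1[%classic : set (measurableTypeR R)) (@acos R).
Proof.
apply: open_continuous_measurable_fun; first exact: interval_open.
by move=> x /[!inE]/=; rewrite in_itv/= => /continuous_acos.
Qed.

(** The image of a null set of the line must be covered by a measurable null set of the circle. On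
    each open half-circle [expi] is inverted by an arccosine, which is measurable there, so the
    image is a preimage; the two points with zero imaginary part are thrown in. *)
Lemma ae_circle (Q : T -> Prop) :
  (\forall t \ae leb, 0 < t < 2 * pi -> Q (expi t)) -> \forall x \ae m, Q x.
Proof.
move=> [N [mN N0 NQ]].
pose U1 := [set x : T | 0 < Im (zeta x)]; pose U2 := [set x : T | Im (zeta x) < 0].
pose U0 := [set x : T | Im (zeta x) = 0].
have mU1 : measurable U1.
  have := meas_Im_val measurableT (measurable_itv `]0, +oo[); rewrite setTI.
  by congr measurable; apply/seteqP; split => x /=; rewrite in_itv/= andbT.
have mU2 : measurable U2.
  have := meas_Im_val measurableT (measurable_itv `]-oo, 0[); rewrite setTI.
  by congr measurable; apply/seteqP; split => x /=; rewrite in_itv.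
have mU0 : measurable U0.
  by have := meas_Im_val measurableT (measurable_set1 0); rewrite setTI.
have maux (U : set T) : measurable U -> (forall x, U x -> Im (zeta x) != 0) ->
    measurable_fun U (fun x => acos (Re (zeta x))).
  move=> mU hU; apply: (@measurable_comp _ _ _ _ _ _ (`]-1, 1[%classic : set (measurableTypeR R)) (@acos R)).
  - exact: measurable_itv.
  - move=> _ [x Ux <-] /=; rewrite in_itv/= -ltr_norml.
    rewrite -(nc_val x) -(@ltr_pXn2r _ 2)// ?nnegrE// sqr_nc real_normK ?num_real//.
    by rewrite ltrDl lt_neqAle sqr_ge0 andbT eq_sym sqrf_eq0 hU.
  - exact: meas_acos.
  - by apply: measurable_funTS; exact: meas_Re_val.
pose B1 := U1 `&` (fun x : T => acos (Re (zeta x))) @^-1` N.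
pose B2 := U2 `&` (fun x : T => 2 * pi - acos (Re (zeta x))) @^-1` N.
have mB1 : measurable B1.
  by apply: (maux U1) => // x /= h; rewrite gt_eqF.
have mB2 : measurable B2.
  have h : measurable_fun U2 (fun x : T => 2 * pi - acos (Re (zeta x))).
    by apply: measurable_funB => //; apply: maux => // x /= h; rewrite lt_eqF.
  exact: h.
pose A := B1 `|` B2 `|` U0.
have mA : measurable A by apply: measurableU => //; exact: measurableU.
exists A; split => //.
- apply/eqP; rewrite eq_le measure_ge0 andbT.
  have -> : m A = (\int[m]_x (\1_A x)%:E)%E by rewrite integral_indic// setIT.
  rewrite ge0_int_circle; last 2 first.
    exact/measurable_EFinP/measurable_indic.
    by move=> x; rewrite lee_fin.
  (* The parameters 0, pi and 2 pi are those sent to the two points of [U0]. *)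
  pose Z := N `|` [set 0] `|` [set pi] `|` [set (2 * pi)%R] : set (measurableTypeR R).
  have mZ : measurable Z.
    by do ![apply: measurableU; last exact: measurable_set1].
  have Z0 : leb Z = 0%E.
    have aux (A' : set (measurableTypeR R)) (c : R) : measurable A' -> leb A' = 0%E ->
        measurable (A' `|` [set c]) /\ leb (A' `|` [set c]) = 0%E.
      move=> mA' A'0; split; first by apply: measurableU => //; exact: measurable_set1.
      rewrite measureU0//; exact: lebesgue_measure_set1.
    have [m1 z1] := aux _ 0 mN N0; have [m2 z2] := aux _ pi m1 z1.
    by have [] := aux _ (2 * pi) m2 z2.
  rewrite (@le_trans _ _ (((2 * pi)^-1)%:E * \int[leb]_(t in I2) (\1_Z t)%:E)%E)//; last first.
    rewrite integral_indic// (@subset_measure0 _ _ _ leb _ Z) ?mule0//.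
    exact: measurableI.
  rewrite lee_wpmul2l ?lee_fin ?invr_ge0 ?(ltW (pi2_gt0 R))//.
  apply: ge0_le_integral => //.
  + apply/measurable_EFinP/measurable_funTS.
    by apply/(meas_circleP (\1_A)); exact: measurable_indic.
  + exact/measurable_EFinP/measurable_funTS/measurable_indic.
  move=> t; rewrite /= in_itv/= => /andP[t0 t2].
  rewrite lee_fin !indicE.
  have [|_] := boolP (expi t \in A); last by rewrite ler0n.
  rewrite inE => At; suff -> : t \in Z by [].
  rewrite inE /Z /=.
  have p0 := pi_gt0 R.
  have [t00|t00] := eqVneq t 0; first by left; left; right.
  have [t01|t01] := eqVneq t pi; first by left; right.
  have [t02|t02] := eqVneq t (2 * pi); first by right.
  left; left; left.
  have t0' : 0 < t by rewrite lt_neqAle eq_sym t00.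
  have t2' : t < 2 * pi by rewrite lt_neqAle t02.
  have [tp|tp] := ltP t pi.
    have s0 : 0 < sin t by apply: sin_gt0_pi; rewrite t0' tp.
    case: At => [[[_ /=]|[/= h _]]|/= h].
    - by rewrite cosK// in_itv/= t0 ltW.
    - by have := lt_trans s0 h; rewrite ltxx.
    - by move: s0; rewrite (h : sin t = 0) ltxx.
  have tp' : pi < t by rewrite lt_neqAle eq_sym t01.
  have s0 : sin t < 0.
    have -> : t = pi + (t - pi) by ring.
    rewrite addrC sinDpi oppr_lt0; exact/sin_gt0_pi/subr_half_itv.
  have cE : cos t = cos (2 * pi - t).
    by rewrite mulr_natl cosB cos2pi sin2pi mul1r mul0r addr0.
  case: At => [[[/= h _]|[_ /=]]|/= h].
  - by have := lt_trans s0 h; rewrite ltxx.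
  - by rewrite cE cosK ?subKr// in_itv/=; exact: reflect_half_itv.
  - by move: s0; rewrite (h : sin t = 0) ltxx.
- move=> x /= nQ.
  have [h|] := eqVneq (Im (zeta x)) 0; first by right.
  rewrite neq_lt => /orP[h|h]; [left; right|left; left].
    split => //=; apply: NQ => /=; apply/not_implyP; rewrite (expi_2pi_acos (ltW h)); split => //.
    have /andP[a0 api] := (acos_def (circle_Re_itv x)).1.
    have p0 := pi_gt0 R.
    suff h' : 0 < acos (Re (zeta x)) by case: (half_itv_arcs p0 h' api).
    rewrite lt_neqAle a0 andbT; apply/eqP => a00.
    by have := sin_acos_circle x; rewrite -a00 sin0 => /esym/eqP; rewrite normr_eq0 lt_eqF.
  split => //=; apply: NQ => /=; apply/not_implyP; rewrite (expi_acos (ltW h)); split => //.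
  have /andP[a0 api] := (acos_def (circle_Re_itv x)).1.
  have p0 := pi_gt0 R.
  suff h' : 0 < acos (Re (zeta x)) by case: (half_itv_arcs p0 h' api).
  rewrite lt_neqAle a0 andbT; apply/eqP => a00.
  by have := sin_acos_circle x; rewrite -a00 sin0 => /esym/eqP; rewrite normr_eq0 gt_eqF.
Qed.

End circle_ae.

Lemma ball_itv (R : realFieldType) (p t t0 d : R) : `|t0 - t| < d -> d < t0 ->
  d < 2 * p - t0 -> 0 <= t <= 2 * p.
Proof. by rewrite ltr_norml => /andP[? ?] ? ?; apply/andP; split; lra. Qed.

Lemma far_itv (R : realFieldType) (p t t0 d : R) : 0 <= t <= 2 * p -> d < t0 ->
  d < 2 * p - t0 -> `|t - t0| <= 2 * p - d.
Proof. by move=> /andP[? ?] ? ?; rewrite ler_norml; apply/andP; split; lra. Qed.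

(** * Boundary behaviour of Poisson integrals *)

Section poisson_limit.
Variable R : realType.
Local Notation C := R[i].
Local Notation T := (circle R).
Local Notation m := (@circle_leb R).
Local Notation leb := (@lebesgue_measure R).
Local Notation I2 := (`[0, 2 * pi]%classic : set (measurableTypeR R)).
Local Notation L1 := (cintble m setT).
Local Notation RL1 u := (m.-integrable setT (fun x => (u x)%:E)).

Definition Pr (u : T -> R) (z : C) : R := Rintegral m setT (fun x => u x * pz z x).

Lemma RL1_meas (u : T -> R) : RL1 u -> measurable_fun setT u.
Proof. by move=> /measurable_int/measurable_EFinP. Qed.

Lemma RL1_pz (u : T -> R) z : RL1 u -> nc z < 1 -> RL1 (fun x => u x * pz z x).
Proof.
move=> /cintbleR iu z1; have [+ _] := L1_pz iu z1.
by congr integrable; apply/funext => x /=; rewrite mul0r subr0.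
Qed.

Lemma RL1_cst (k : R) : RL1 (fun=> k).
Proof. exact: integrable_cst_circle. Qed.

Lemma RL1_norm (u : T -> R) : RL1 u -> RL1 (fun x => `|u x|).
Proof. by move=> iu; exact: (integrable_norm iu). Qed.

Lemma RL1B (u v : T -> R) : RL1 u -> RL1 v -> RL1 (fun x => u x - v x).
Proof. by move=> iu iv; under eq_fun do rewrite EFinB; exact: integrableB. Qed.

Lemma RL1D (u v : T -> R) : RL1 u -> RL1 v -> RL1 (fun x => u x + v x).
Proof. by move=> iu iv; under eq_fun do rewrite EFinD; exact: integrableD. Qed.

Lemma RL1Z k (u : T -> R) : RL1 u -> RL1 (fun x => k * u x).
Proof. by move=> iu; under eq_fun do rewrite EFinM; exact: integrableZl. Qed.

Lemma PrB (u v : T -> R) z : RL1 u -> RL1 v -> nc z < 1 ->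
  Pr (fun x => u x - v x) z = Pr u z - Pr v z.
Proof.
move=> iu iv z1; rewrite /Pr -RintegralB//; [|exact: RL1_pz|exact: RL1_pz].
by congr Rintegral; apply/funext => x; rewrite mulrBl.
Qed.

Lemma PrD (u v : T -> R) z : RL1 u -> RL1 v -> nc z < 1 ->
  Pr (fun x => u x + v x) z = Pr u z + Pr v z.
Proof.
move=> iu iv z1; rewrite /Pr -RintegralD//; [|exact: RL1_pz|exact: RL1_pz].
by congr Rintegral; apply/funext => x; rewrite mulrDl.
Qed.

Lemma Pr_cst k z : nc z < 1 -> Pr (fun=> k) z = k.
Proof.
move=> z1; rewrite /Pr RintegralZl//; last exact: integrable_pz.
by rewrite Poi1// mulr1.
Qed.

Lemma le_Pr (u v : T -> R) z : RL1 u -> RL1 v -> nc z < 1 ->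
  (\forall x \ae m, u x <= v x) -> Pr u z <= Pr v z.
Proof.
move=> iu iv z1 uv; apply: ae_le_Rint; [exact: RL1_pz|exact: RL1_pz|].
by apply: filterS uv => x uv; rewrite ler_wpM2r// pz_ge0.
Qed.

Lemma Pr_ge0 (u : T -> R) z : nc z < 1 -> (forall x, 0 <= u x) -> 0 <= Pr u z.
Proof. by move=> z1 u0; apply: Rintegral_ge0 => x _; rewrite mulr_ge0// pz_ge0. Qed.

Lemma normr_Pr (u : T -> R) z : RL1 u -> nc z < 1 -> `|Pr u z| <= Pr (fun x => `|u x|) z.
Proof.
move=> iu z1; rewrite (le_trans (le_normr_Rintegral _ (RL1_pz iu z1)))// /Pr.
rewrite le_eqVlt; apply/orP; left; apply/eqP; congr Rintegral; apply/funext => x.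
by rewrite normrM (ger0_norm (pz_ge0 x z1)).
Qed.

Lemma nc_dil (s : R) (x : T) : nc (s%:C * zeta x) = `|s|.
Proof. by rewrite ncM nc_val mulr1 ncR. Qed.

Lemma nc_dil_lt1 (s : R) (x : T) : 0 <= s -> s < 1 -> nc (s%:C * zeta x) < 1.
Proof. by move=> s0 s1; rewrite nc_dil ger0_norm. Qed.

(** The law of cosines puts the kernel in terms of the chord between [x] and [y]; this form gives
    both the decay away from [x] and the majorant near it. *)
Lemma pz_dil (s : R) (x y : T) : 0 <= s ->
  pz (s%:C * zeta x) y = (1 - s ^+ 2) / ((1 - s) ^+ 2 + s * nc (zeta y - zeta x) ^+ 2).
Proof.
move=> s0; rewrite /pz nc_dil ger0_norm//; congr (_ / _).
rewrite !sqr_nc; have := circle_ReIm x; have := circle_ReIm y.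
case: (zeta x) => a b; case: (zeta y) => c d /=; set q1 := _ + _ => h1 h2.
transitivity (1 - 2 * s * (a * c + b * d) + s ^+ 2 * ((a ^+ 2 + b ^+ 2) * (c ^+ 2 + d ^+ 2))).
  by ring.
rewrite h2 -/q1 h1.
transitivity (1 - s * 2 * (a * c + b * d) + s ^+ 2 + s * (q1 - 1) + s * ((a ^+ 2 + b ^+ 2) - 1)).
  by rewrite h1 h2; ring.
by rewrite /q1; ring.
Qed.

Lemma pz_dil_far (s d : R) (x y : T) : 2^-1 <= s -> s < 1 -> 0 < d ->
  d <= nc (zeta y - zeta x) ^+ 2 -> pz (s%:C * zeta x) y <= 4 / d * (1 - s).
Proof.
move=> s2 s1 d0 dy; have s0 : 0 <= s by rewrite (le_trans _ s2)// invr_ge0.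
rewrite pz_dil//.
have h1 : 2^-1 * d <= (1 - s) ^+ 2 + s * nc (zeta y - zeta x) ^+ 2.
  rewrite -[leLHS]add0r lerD ?sqr_ge0// ler_pM// ?invr_ge0// ltW//.
have h2 : 1 - s ^+ 2 <= 2 * (1 - s).
  by rewrite -subr_ge0 (_ : _ - _ = (1 - s) ^+ 2) ?sqr_ge0//; ring.
have h3 : 0 < 2^-1 * d by rewrite mulr_gt0// invr_gt0.
rewrite (@le_trans _ _ (2 * (1 - s) / (2^-1 * d)))//.
  apply: ler_pM => //.
  - by rewrite subr_ge0 expr_le1// ltW.
  - by rewrite invr_ge0 (le_trans _ h1)// ltW.
  - by rewrite lef_pV2 ?posrE// (lt_le_trans h3).
by rewrite le_eqVlt; apply/orP; left; apply/eqP; field; rewrite gt_eqF.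
Qed.

Definition radial_lim (F : C -> R) (x : T) (l : R) := forall e : R, 0 < e ->
  exists2 d : R, 0 < d & forall s : R, 0 <= s -> s < 1 -> 1 - d < s ->
    `|F (s%:C * zeta x) - l| <= e.

Lemma Pr_center (u : T -> R) (c : R) z : RL1 u -> nc z < 1 ->
  `|Pr u z - c| <= Pr (fun y => `|u y - c|) z.
Proof.
move=> iu z1; rewrite -{1}(Pr_cst c z1) -PrB//; last exact: RL1_cst.
by apply: normr_Pr => //; apply: RL1B => //; exact: RL1_cst.
Qed.

(** Approximate identity: near [x] the oscillation is at most e / 2, and far from [x] the kernel is
    at most a multiple of 1 - s, which is integrated against [|u y - u x|]. *)
Lemma Pr_continuity (u : T -> R) (x : T) : RL1 u ->
  (forall e : R, 0 < e -> exists2 d : R, 0 < d & forall y : T,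
     nc (zeta y - zeta x) < d -> `|u y - u x| <= e) ->
  radial_lim (Pr u) x (u x).
Proof.
move=> iu cu e e0; have e2 : 0 < e / 2 by rewrite divr_gt0.
have [d d0 dP] := cu _ e2.
have iv : RL1 (fun y => `|u y - u x|).
  by apply: RL1_norm; apply: RL1B => //; exact: RL1_cst.
set K := Rintegral m setT (fun y => `|u y - u x|).
have K0 : 0 <= K by apply: Rintegral_ge0.
have q0 : 0 < e / 2 * d ^+ 2 / (4 * (K + 1)).
  by rewrite divr_gt0// ?mulr_gt0 ?exprn_gt0// ltr_wpDl.
exists (Num.min 2^-1 (e / 2 * d ^+ 2 / (4 * (K + 1)))); first by rewrite lt_min q0 invr_gt0 ltr0n.
move=> s s0 s1; rewrite ltrBlDr -ltrBlDl lt_min => /andP[sd1 sd2].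
have s2 : 2^-1 <= s by lra.
have z1 := nc_dil_lt1 x s0 s1.
rewrite (le_trans (Pr_center _ iu z1))//.
pose b := 4 / d ^+ 2 * (1 - s).
have b0 : 0 <= b by rewrite mulr_ge0 ?divr_ge0 ?exprn_ge0 ?subr_ge0// ltW.
apply: (@le_trans _ _ (Rintegral m setT (fun y => e / 2 * pz (s%:C * zeta x) y + b * `|u y - u x|))).
  apply: le_Rintegral => //; first exact: RL1_pz.
    by apply: RL1D; apply: RL1Z => //; exact: integrable_pz.
  move=> y _; have p0 := pz_ge0 y z1.
  have [yd|] := boolP (nc (zeta y - zeta x) < d).
    apply: (@le_trans _ _ (e / 2 * pz (s%:C * zeta x) y)).
      by rewrite ler_wpM2r// dP.
    by rewrite lerDl mulr_ge0.
  rewrite -leNgt => yd; apply: (@le_trans _ _ (b * `|u y - u x|)); last first.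
    by rewrite lerDr mulr_ge0// ltW.
  rewrite mulrC ler_wpM2r//.
  apply: pz_dil_far => //; first by rewrite exprn_gt0.
  by rewrite lerXn2r ?nnegrE// ltW.
rewrite RintegralD//; [|by apply: RL1Z; exact: integrable_pz|exact: RL1Z].
rewrite -[X in X + _]/(Pr (fun=> e / 2) (s%:C * zeta x)) Pr_cst//.
rewrite RintegralZl// [leRHS]splitr lerD2l -/K.
have K1 : 0 < K + 1 by rewrite ltr_wpDl.
have -> : e / 2 = 4 / d ^+ 2 * (e / 2 * d ^+ 2 / (4 * (K + 1))) * (K + 1).
  by field; rewrite !gt_eqF.
rewrite /b; apply: ler_pM => //; last by rewrite lerDl.
by rewrite ler_wpM2l ?divr_ge0 ?exprn_ge0 ?(ltW d0)// ltW.
Qed.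

(** Half-angle formula, together with |sin (t / 2)| >= |t / 2| / 2 for small t from the derivative
    of the sine at 0. *)
Lemma one_sub_cos_ge : exists2 eta : R, 0 < eta & forall t, `|t| < eta -> t ^+ 2 / 8 <= 1 - cos t.
Proof.
have h : 0 < 2^-1 :> R by rewrite invr_gt0.
have [d d0 dP] := real_lin_approx (is_derive_sin (0 : R)) h.
exists d => // t td.
have t2 : `|t / 2| < d.
  by rewrite normrM (@ger0_norm _ 2^-1) ?invr_ge0// (le_lt_trans _ td)// ler_piMr// invf_le1// ler1n.
have := dP (t / 2); rewrite subr0 sin0 cos0 mul1r subr0 => /(_ t2) hs.
have hs2 : `|t / 2| / 2 <= `|sin (t / 2)|.
  have := ler_normB (sin (t / 2)) (sin (t / 2) - t / 2).
  by rewrite opprB addrCA subrr addr0; lra.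
have -> : 1 - cos t = 2 * sin (t / 2) ^+ 2.
  have -> : cos t = cos (t / 2) ^+ 2 *+ 2 - 1 by rewrite -cos_mulr2n -[(t / 2) *+ 2]mulr_natr divfK ?pnatr_eq0.
  by rewrite sin2cos2 -mulr_natl; ring.
have -> : t ^+ 2 / 8 = 2 * (`|t / 2| / 2) ^+ 2.
  by rewrite exprMn real_normK ?num_real//; field.
by rewrite ler_wpM2l// -(real_normK (num_real (sin _))) lerXn2r ?nnegrE ?divr_ge0.
Qed.

Lemma cos_far (d t : R) : 0 < d -> d < pi -> d <= `|t| -> `|t| <= 2 * pi - d -> cos t <= cos d.
Proof.
move=> d0 dpi dt td.
have -> : cos t = cos `|t|.
  by have /orP[h|h] := le_total 0 t; [rewrite ger0_norm|rewrite ler0_norm// cosN].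
move: (`|t|) dt td => {}t dt td; have p0 := pi_gt0 R.
have mono r : d < r -> r <= pi -> cos r <= cos d.
  move=> dr rp; have r0 := lt_trans d0 dr.
  by apply/ltW; rewrite ltr_cos// in_itv/= ?rp ?(ltW d0) ?(ltW dpi) ?(ltW r0).
have /orP[tp|tp] := le_total t pi.
  by move: dt; rewrite le_eqVlt => /predU1P[<-//|dt]; exact: mono.
have -> : cos t = cos (2 * pi - t) by rewrite mulr_natl cosB cos2pi sin2pi mul1r mul0r addr0.
have tE : d <= 2 * pi - t by lra.
have tE2 : 2 * pi - t <= pi by lra.
move: (2 * pi - t) tE tE2 => r; rewrite le_eqVlt => /predU1P[<-//|dr] rp.
exact: mono.
Qed.

Lemma chord_expi (t t0 : R) : nc (zeta (expi t) - zeta (expi t0)) ^+ 2 = 2 * (1 - cos (t - t0)).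
Proof.
rewrite sqr_nc /= cosB; have := cos2Dsin2 t; have := cos2Dsin2 t0.
set a := cos t; set b := sin t; set c := cos t0; set d := sin t0 => h1 h2.
transitivity ((a ^+ 2 + b ^+ 2) + (c ^+ 2 + d ^+ 2) - 2 * (a * c + b * d)); first by ring.
by rewrite h1 h2; ring.
Qed.

(** As at a point of continuity, except that the near part is controlled only in the mean; there the
    dyadic decomposition replaces the pointwise bound. *)
Lemma Pr_lebesgue_pt (u : T -> R) (t0 : R) : RL1 u -> 0 < t0 < 2 * pi ->
  lebesgue_pt ((fun t => u (expi t)) \_ I2) t0 ->
  radial_lim (Pr u) (expi t0) (u (expi t0)).
Proof.
move=> iu /andP[t00 t02]; set f := (_ \_ _) => hf e e0.
have mu' := RL1_meas iu.
have ft0 : f t0 = u (expi t0) by rewrite /f patchE mem_set//= in_itv/= !ltW.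
(* Calibrated so that the near part, at most 136 [ep], becomes e / 2 after division by 2 pi. *)
pose ep := 2 * pi * e / 2 / 136.
have ep0 : 0 < ep by rewrite !divr_gt0// !mulr_gt0// pi_gt0.
have mE : measurable_fun [set: measurableTypeR R] (fun t => u (expi t)).
  exact/meas_circleP.
pose psi t := `|u (expi t) - u (expi t0)|.
have mpsi : measurable_fun [set: measurableTypeR R] psi.
  by apply: measurableT_comp => //; apply: measurable_funB.
have [d1 d10 hd1] : exists2 d1, 0 < d1 & forall h, 0 < h -> h <= d1 -> h < t0 -> h < 2 * pi - t0 ->
    (\int[leb]_(t in ball t0 h) (psi t)%:E <= (2 * h * ep)%:E)%E.
  move: hf; rewrite /lebesgue_pt => /fine_cvgP[+ /cvgrPdist_lt/(_ ep ep0)].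
  rewrite !near_withinE => /nbhs_ballP[r1 /= r10 r1P] /nbhs_ballP[r2 /= r20 r2P].
  exists (Num.min r1 r2 / 2) => [|h h0]; first by rewrite divr_gt0// lt_min r10.
  move=> hr ht0 htp.
  have hmin : h < Num.min r1 r2.
    have : 0 < Num.min r1 r2 by rewrite lt_min r10.
    by move: hr; lra.
  move: hmin; rewrite lt_min => /andP[hr1 hr2].
  have bh1 : ball 0 r1 h by rewrite /ball /= sub0r normrN gtr0_norm.
  have bh2 : ball 0 r2 h by rewrite /ball /= sub0r normrN gtr0_norm.
  have fin := r1P _ bh1 h0.
  have := r2P _ bh2 h0; rewrite /= sub0r normrN ger0_norm ?fine_ge0 ?davg_ge0//.
  rewrite -lte_fin fineK// /davg /iavg lebesgue_measure_ball; last exact: ltW.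
  move=> H.
  have eqI : (\int[leb]_(y in ball t0 h) `|((center (f t0) \o f) y)%:E| =
      \int[leb]_(t in ball t0 h) (psi t)%:E)%E.
    apply: eq_integral => t; rewrite inE /ball /= => tb.
    rewrite ft0 /psi /f patchE mem_set//= in_itv/=.
    exact: ball_itv tb ht0 htp.
  move: H; rewrite eqI => H.
  have h2 : (h *+ 2)%:E = (2 * h)%:E by rewrite mulr_natl.
  have hne : (2 * h)%R != 0 by rewrite mulf_neq0// ?pnatr_eq0// gt_eqF.
  move: H; rewrite h2 inver (negbTE hne) => /ltW H.
  have := lee_wpmul2l (_ : 0%E <= (2 * h)%:E)%E H.
  rewrite lee_fin mulr_ge0 ?(ltW h0)// => /(_ isT).
  by rewrite muleA -EFinM divff// mul1e -EFinM.
have [eta eta0 etaP] := one_sub_cos_ge.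
(* Half the distances from [t0] to 0 and to 2 pi keep the ball inside the parameter interval, so
   that no wrapping around the circle occurs; [eta] is for the quadratic bound on the cosine. *)
pose d := Num.min (Num.min d1 eta) (Num.min (t0 / 2) ((2 * pi - t0) / 2)).
have p0 := pi_gt0 R.
have q0 : 0 < 2 * pi - t0 by rewrite subr_gt0.
have d0 : 0 < d by rewrite !lt_min d10 eta0 !divr_gt0.
have dd1 : d <= d1 by rewrite !ge_min lexx.
have deta : d <= eta by rewrite !ge_min lexx orbT.
have dt0 : d <= t0 / 2 by rewrite !ge_min lexx !orbT.
have dt2 : d <= (2 * pi - t0) / 2 by rewrite !ge_min lexx !orbT.
have dt0' : d < t0 by lra.
have dt2' : d < 2 * pi - t0 by lra.
have dpi : d < pi by lra.
clear dt0 dt2; clearbody d.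
have cd : 0 < 1 - cos d by rewrite subr_gt0 -cos0 ltr_cos// in_itv/= ?lexx ?ltW.
pose D := 2 * (1 - cos d).
have D0 : 0 < D by rewrite mulr_gt0.
pose M := Rintegral leb I2 psi.
have ipsi : leb.-integrable I2 (fun t => (psi t)%:E).
  have iv : RL1 (fun y => `|u y - u (expi t0)|).
    by apply: RL1_norm; apply: RL1B => //; exact: RL1_cst.
  exact: ((integrable_circleP (RL1_meas iv)).1 iv).
have M0 : 0 <= M by apply: Rintegral_ge0.
have M1 : 0 < M + 1 by rewrite ltr_wpDl.
(* For 1 - s below this threshold the far part is at most 2 pi e / 2. *)
pose y1 := 2 * pi * e / 2 * D / (4 * (M + 1)).
have y10 : 0 < y1 by rewrite !(mulr_gt0, divr_gt0)// invr_gt0 mulr_gt0.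
exists (Num.min (Num.min 2^-1 d) y1); first by rewrite !lt_min invr_gt0 ltr0n d0 y10.
move=> s s0 s1; rewrite ltrBlDr -ltrBlDl !lt_min => /andP[/andP[sd1 sd2] sd3].
have s2 : 2^-1 <= s by lra.
have z1 := nc_dil_lt1 (expi t0) s0 s1.
rewrite (le_trans (Pr_center _ iu z1))//.
pose K t := pz (s%:C * zeta (expi t0)) (expi t).
have K0 t : 0 <= K t by exact: pz_ge0.
have mK : measurable_fun [set: measurableTypeR R] K by apply/meas_circleP; exact: meas_pz.
have mpK : measurable_fun [set: measurableTypeR R] (fun t => psi t * K t).
  exact: measurable_funM.
have psi0 t : 0 <= psi t by exact: normr_ge0.
have y0 : 0 < 1 - s by rewrite subr_gt0.
(* With y = 1 - s this majorant yields both kernel bounds of [dyadic_kernel]: dropping the cosine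
   term gives 2 / y, and 1 - cos t >= t^2 / 8 gives 16 y. *)
have KE t : K t <= 2 * (1 - s) / ((1 - s) ^+ 2 + (1 - cos (t - t0))).
  rewrite /K pz_dil// chord_expi.
  have c1 : 0 <= 1 - cos (t - t0) by rewrite subr_ge0 cos_le1.
  apply: ler_pM => //.
  - by rewrite subr_ge0 expr_le1// ltW.
  - by rewrite invr_ge0 addr_ge0 ?sqr_ge0// !mulr_ge0.
  - by rewrite -subr_ge0 (_ : _ - _ = (1 - s) ^+ 2) ?sqr_ge0//; ring.
  - rewrite lef_pV2 ?posrE ?ltr_pwDl ?exprn_gt0// ?mulr_ge0//.
    by rewrite lerD2l mulrA ler_peMl//; move: s2; clear; lra.
have nearb : (\int[leb]_(t in ball t0 d) (psi t * K t)%:E <= (136 * ep)%:E)%E.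
  apply: (dyadic_kernel mpsi mK psi0 K0 y0 sd2 (ltW ep0)).
  - move=> h h0 hd; apply: hd1 => //; first exact: le_trans hd dd1.
      exact: le_lt_trans hd dt0'.
    exact: le_lt_trans hd dt2'.
  - move=> t _; rewrite (le_trans (KE t))// ler_pdivrMr ?ltr_pwDl ?exprn_gt0 ?subr_ge0 ?cos_le1//.
    rewrite mulrAC ler_pdivlMr// -mulrA -expr2 ler_wpM2l// lerDl subr_ge0 cos_le1//.
  - move=> t td; rewrite (le_trans (ler_wpM2r (sqr_ge0 _) (KE t)))//.
    have := etaP _ (lt_le_trans td deta) => h8.
    have c1 : 0 <= 1 - cos (t - t0) by rewrite subr_ge0 cos_le1.
    rewrite mulrAC ler_pdivrMr ?ltr_pwDl ?exprn_gt0//.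
    rewrite (_ : 16 * (1 - s) * _ = 2 * (1 - s) * (8 * ((1 - s) ^+ 2 + (1 - cos (t - t0))))); last by ring.
    rewrite ler_wpM2l ?mulr_ge0 ?(ltW y0)//.
    have := sqr_ge0 (1 - s); move: h8; clear; lra.
have bI : ball t0 d `<=` I2.
  move=> t; rewrite /ball /= in_itv/= => tb; exact: ball_itv tb dt0' dt2'.
pose b := 4 / D * (1 - s).
have b0 : 0 <= b by rewrite mulr_ge0 ?divr_ge0 ?ltW.
have farb : (\int[leb]_(t in I2 `\` ball t0 d) (psi t * K t)%:E <= (b * M)%:E)%E.
  rewrite (@le_trans _ _ (\int[leb]_(t in I2 `\` ball t0 d) (b%:E * (psi t)%:E))%E)//.
    apply: ge0_le_integral => //.
    - by apply: measurableD => //; exact: measurable_ball.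
    - by move=> t _; rewrite lee_fin mulr_ge0.
    - exact/measurable_EFinP/measurable_funTS.
    - by apply/measurable_EFinP/measurable_funTS/measurable_funM => //; exact: measurable_cst.
    - move=> t [/=]; rewrite in_itv/= => /andP[? ?]; rewrite /ball /= => /negP; rewrite -leNgt => tb.
      rewrite -EFinM lee_fin mulrC ler_wpM2r// /K; apply: pz_dil_far => //.
      rewrite chord_expi /D ler_wpM2l// lerD2l lerN2 cos_far//; first by rewrite distrC.
      by apply: far_itv => //; apply/andP; split.
  rewrite ge0_integralZl//; last 3 first.
    - by apply: measurableD => //; exact: measurable_ball.
    - exact/measurable_EFinP/measurable_funTS.
    - by move=> t _; rewrite lee_fin.
  rewrite [(b * M)%:E]EFinM; apply: lee_wpmul2l; first by rewrite lee_fin.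
  rewrite /M /Rintegral fineK; last exact: integrable_fin_num.
  apply: ge0_subset_integral => //.
  - by apply: measurableD => //; exact: measurable_ball.
  - exact/measurable_EFinP/measurable_funTS.
  - by move=> t _; rewrite lee_fin.
have split_ : (\int[leb]_(t in I2) (psi t * K t)%:E <= (136 * ep + b * M)%:E)%E.
  rewrite -(setDUK bI) ge0_integral_setU//.
  - exact: (leeD nearb farb).
  - exact: measurable_ball.
  - by apply: measurableD => //; exact: measurable_ball.
  - exact/measurable_EFinP/measurable_funTS.
  - by move=> t _; rewrite lee_fin mulr_ge0.
  - by apply/disj_setPS => t [? []].
have iv : RL1 (fun y => `|u y - u (expi t0)|).
  by apply: RL1_norm; apply: RL1B => //; exact: RL1_cst.
rewrite /Pr Rint_circle; last exact: RL1_pz.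
have ii := (integrable_circleP (RL1_meas (RL1_pz iv z1))).1 (RL1_pz iv z1).
have fin : (\int[leb]_(t in I2) (psi t * K t)%:E)%E \is a fin_num.
  rewrite ge0_fin_numE; first exact: (le_lt_trans split_ (ltry _)).
  by apply: integral_ge0 => t _; rewrite lee_fin mulr_ge0.
rewrite -ler_pdivlMl ?invr_gt0 ?mulr_gt0// invrK -lee_fin /Rintegral fineK//.
apply: (le_trans split_); rewrite lee_fin /ep.
have -> : 136 * (2 * pi * e / 2 / 136) = 2 * pi * e / 2 by field.
have : b * M <= 2 * pi * e / 2.
  have -> : 2 * pi * e / 2 = 4 / D * y1 * (M + 1) by rewrite /y1; field; rewrite !gt_eqF.
  rewrite /b; apply: ler_pM => //; last by rewrite lerDl.
  by rewrite ler_wpM2l ?divr_ge0 ?(ltW D0)// ltW.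
by move=> h; rewrite [leRHS]splitr lerD2l.
Qed.

(** Fatou's theorem along radii: by Lebesgue differentiation almost every parameter is a Lebesgue
    point. *)
Theorem fatou_radial (u : T -> R) : RL1 u -> \forall x \ae m, radial_lim (Pr u) x (u x).
Proof.
move=> iu; apply: ae_circle.
have li : locally_integrable [set: R] ((fun t => u (expi t)) \_ I2).
  apply: integrable_locally_restrict => //.
  exact: ((integrable_circleP (RL1_meas iu)).1 iu).
have := lebesgue_differentiation li.
apply: (@filterS _ (almost_everywhere leb)) => t ht tp.
exact: Pr_lebesgue_pt.
Qed.

End poisson_limit.

(** * The theorem of F. Riesz and the Hardy spaces *)

Section poisson_representation.
Variable R : realType.
Local Notation C := R[i].
Local Notation T := (circle R).
Local Notation m := (@circle_leb R).
Local Notation L1 := (cintble m setT).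
Local Notation RL1 u := (m.-integrable setT (fun x => (u x)%:E)).

(** Radii tending to 1, which turn radial limits into limits of sequences as dominated convergence
    requires. Since [rs 0 = 0], arguments that need a positive radius start from index 1. *)
Definition rs (n : nat) : R := 1 - n.+1%:R^-1.

Lemma rs_ge0 n : 0 <= rs n.
Proof. by rewrite subr_ge0 invf_le1 ?ler1n// ltr0n. Qed.

Lemma rs_lt1 n : rs n < 1.
Proof. by rewrite gtrBl invr_gt0 ltr0n. Qed.

Lemma rs_cvg (d : R) : 0 < d -> exists N, forall n, (N <= n)%N -> 1 - d < rs n.
Proof.
move=> d0; exists (Num.bound d^-1) => n hn; rewrite /rs ltrD2l ltrN2.
rewrite invf_plt ?posrE ?ltr0n// (@lt_trans _ _ (Num.bound d^-1)%:R)//.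
  by apply: archi_boundP; rewrite invr_ge0 ltW.
by rewrite ltr_nat ltnS.
Qed.

Definition cradial (F : C -> C) (x : T) (l : C) := forall e : R, 0 < e ->
  exists2 d : R, 0 < d & forall s : R, 0 <= s -> s < 1 -> 1 - d < s ->
    nc (F (s%:C * zeta x) - l) <= e.

Lemma radial_seq (F : C -> R) x l : radial_lim F x l ->
  (fun n => F ((rs n)%:C * zeta x)) @ \oo --> l.
Proof.
move=> h; apply/cvgrPdist_le => e /h[d d0 dP]; have [N NP] := rs_cvg d0.
exists N => // n /= Nn; rewrite distrC; apply: dP; rewrite ?rs_ge0 ?rs_lt1 ?NP//.
Qed.

Lemma cradial_seq (F : C -> C) x l : cradial F x l ->
  (fun n => nc (F ((rs n)%:C * zeta x) - l)) @ \oo --> (0 : R).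
Proof.
move=> h; apply/cvgrPdist_le => e /h[d d0 dP]; have [N NP] := rs_cvg d0.
exists N => // n /= Nn; rewrite sub0r normrN ger0_norm//.
by apply: dP; rewrite ?rs_ge0 ?rs_lt1 ?NP.
Qed.

Lemma cradialP (F : C -> C) x l :
  (dilate F r x : C^o) @[r --> (1 : R)^'-] --> (l : C^o) <-> cradial F x l.
Proof.
rewrite cvgc_nc; split.
  move=> /cvgrPdist_le h e e0; have := h e e0; rewrite near_withinE => /nbhs_ballP[d /= d0 dP].
  exists d => // s s0 s1 sd; have := dP s; rewrite /ball /= sub0r normrN => H.
  rewrite -(ger0_norm (nc_ge0 (F _ - _))); apply: H => //.
  by rewrite ger0_norm ?subr_ge0 ?(ltW s1)// ltrBlDr -ltrBlDl.
move=> h; apply/cvgrPdist_le => e /h[d d0 dP].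
rewrite near_withinE; apply/nbhs_ballP; exists (Num.min 1 d) => /=.
  by rewrite lt_min ltr01.
move=> s; rewrite /ball /= lt_min => /andP[s1 sd] s2.
have h1 : 0 <= 1 - s by rewrite subr_ge0 ltW.
move: s1 sd; rewrite ger0_norm// => s1 sd.
rewrite sub0r normrN ger0_norm//; apply: dP => //.
  by move: s1; rewrite ltrBlDr ltrDl => /ltW.
by rewrite ltrBlDr -ltrBlDl.
Qed.

Lemma radial_cradial (F G : C -> R) x a b : radial_lim F x a -> radial_lim G x b ->
  cradial (fun z => F z +i* G z) x (a +i* b).
Proof.
move=> hF hG e e0; have e2 : 0 < e / 2 by rewrite divr_gt0.
have [d1 d10 h1] := hF _ e2; have [d2 d20 h2] := hG _ e2.
exists (Num.min d1 d2) => [|s s0 s1]; first by rewrite lt_min d10.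
rewrite ltrBlDr -ltrBlDl lt_min => /andP[sd1 sd2].
rewrite (le_trans (nc_le_ReIm _))// [leRHS]splitr lerD//=.
  by apply: h1 => //; rewrite ltrBlDr -ltrBlDl.
by apply: h2 => //; rewrite ltrBlDr -ltrBlDl.
Qed.

Lemma PoiE g z : L1 g -> nc z < 1 ->
  Poi g z = Pr (fun x => Re (g x)) z +i* Pr (fun x => Im (g x)) z.
Proof.
move=> ig z1; apply: eqcP => /=; congr Rintegral; apply/funext => x.
  by rewrite ReM /= mulr0 subr0.
by rewrite ImM /= mulr0 add0r.
Qed.

Lemma nc_Poi g z : L1 g -> nc z < 1 -> nc (Poi g z) <= Pr (fun x => nc (g x)) z.
Proof.
move=> ig z1; rewrite (le_trans (nc_cintm (L1_pz ig z1)))// /N1 /Pr.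
rewrite le_eqVlt; apply/orP; left; apply/eqP; congr Rintegral; apply/funext => x.
by rewrite ncM ncR (ger0_norm (pz_ge0 x z1)).
Qed.

Lemma L1_RL1 g : L1 g -> RL1 (fun x => nc (g x)).
Proof. by move=> ig; exact: cintble_nc. Qed.

Lemma fatou_cradial g : L1 g -> \forall x \ae m, cradial (Poi g) x (g x).
Proof.
move=> ig; have [i1 i2] := ig.
have h1 := fatou_radial i1; have h2 := fatou_radial i2.
apply: filterS2 h1 h2 => x x1 x2 e e0.
have [d d0 dP] := radial_cradial x1 x2 e0; exists d => // s s0 s1 sd.
rewrite PoiE// ?nc_dil_lt1//.
by have := dP s s0 s1 sd; rewrite -[X in _ - X](_ : g x = _)//; case: (g x).
Qed.

Lemma Rint_dct (f_ : nat -> T -> R) (f g : T -> R) :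
  (forall n, measurable_fun setT (f_ n)) -> measurable_fun setT f -> RL1 g ->
  (\forall x \ae m, (fun n => f_ n x) @ \oo --> f x) ->
  (forall n, \forall x \ae m, `|f_ n x| <= g x) ->
  [/\ RL1 f, (fun n => Rintegral m setT (fun x => `|f_ n x - f x|)) @ \oo --> (0 : R) &
   (fun n => Rintegral m setT (f_ n)) @ \oo --> Rintegral m setT f].
Proof.
move=> mf_ mf ig hcvg hdom.
have [|||||h1 h2 h3] := @dominated_convergence _ _ _ m setT measurableT
  (fun n x => (f_ n x)%:E) (fun x => (f x)%:E) (fun x => (g x)%:E).
- by move=> n; exact/measurable_EFinP.
- exact/measurable_EFinP.
- apply: filterS hcvg => x h _; apply/fine_cvgP; split; first exact: nearW.
  exact: h.
- exact: ig.
- have : \forall x \ae m, forall n, `|f_ n x| <= g x by exact/ae_foralln.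
  by apply: filterS => x h n _; rewrite abse_EFin lee_fin.
split=> //.
- by have /fine_cvgP[_] := h2; apply: cvg_trans; apply: near_eq_cvg; exact: nearW.
- have fin : (\int[m]_x (f x)%:E)%E \is a fin_num by exact: integrable_fin_num.
  move: h3; rewrite -(fineK fin) => /fine_cvgP[_].
  by apply: cvg_trans; apply: near_eq_cvg; exact: nearW.
Qed.

(** Both sides are limits of their partial sums, by [Cau_partial], and these partial sums coincide.
    Two points [z] and [w] are allowed in order to compare dilates of one function on different
    circles. *)
Lemma Cau_eq g h z w : L1 g -> L1 h -> nc z < 1 -> nc w < 1 ->
  (forall k, z ^+ k * fc g k = w ^+ k * fc h k) -> Cau g z = Cau h w.
Proof.
move=> ig ih z1 w1 gh; apply: nc_small_eq => e e0.
have e2 : 0 < e / 2 by rewrite divr_gt0.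
pose r := Num.max (nc z) (nc w).
have r1 : 0 <= r < 1 by rewrite /r le_max nc_ge0 gt_max z1.
pose K := (1 - nc z)^-1 * N1 g + (1 - nc w)^-1 * N1 h.
have [n hn] := geom_small K r1 e0.
have a1 := Cau_partial n ig z1; have a2 := Cau_partial n ih w1.
rewrite (eq_bigr (fun k : 'I_n => w ^+ k * fc h k)) in a1; last by move=> k _; rewrite gh.
move: a1 a2; set S := \sum_(k < n) _ => a1 a2.
have -> : Cau g z - Cau h w = (Cau g z - S) - (Cau h w - S) by ring.
rewrite (le_trans (ncB _ _))// (le_trans (lerD a1 a2))// (le_trans _ (ltW hn))//.
rewrite /K mulrDr -!mulrA lerD// ler_wpM2r ?mulr_ge0 ?N1_ge0 ?invr_ge0 ?subr_ge0 ?(ltW z1) ?(ltW w1)//;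
  by rewrite lerXn2r ?nnegrE ?(andP r1).1// /r le_max lexx ?orbT.
Qed.

Section holo_coefficients.
Variables (F : C -> C) (R0 : R).
Hypothesis hF : forall z, nc z < R0 -> holo F z.

Lemma L1_holo r : 0 <= r < R0 -> L1 (fun x => F (r%:C * zeta x)).
Proof. exact: cintble_dilate hF. Qed.

(** By [mean_annulus] for F z^k, r^k times the coefficient at radius r is the same for all r; as F
    is bounded near 0, letting the radius shrink gives 0. *)
Lemma fn_holo r k : 0 < r < R0 -> (0 < k)%N -> fn (fun x => F (r%:C * zeta x)) k = 0.
Proof.
move=> /andP[r0 rR] k0.
pose Psi z := F z * z ^+ k.
have hP z : 0 < nc z < R0 -> holo Psi z.
  by move=> /andP[_ zR]; apply: holoM; [exact: hF|exact/holoX/holo_id].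
have E s : 0 < s -> s < R0 -> cint m setT (fun x => Psi (s%:C * zeta x)) =
    (s ^+ k)%:C * fn (fun x => F (s%:C * zeta x)) k.
  move=> s0 sR; rewrite /fn -cintZ//; last by apply/L1_valX/L1_holo; rewrite ltW.
  by congr cint; apply/funext => x; rewrite /Psi exprMn rcX; ring.
have R00 : 0 < R0 by exact: lt_trans rR.
have /cvgrPdist_lt/(_ 1 ltr01)/nbhs_nc[d d0 dP] := holo_cvg (@hF 0 (eq_ind_r (fun x => x < R0) R00 (nc0 R))).
pose B := nc (F 0) + 1.
have B0 : 0 < B by rewrite ltr_wpDl.
apply: nc_small_eq => e e0; rewrite subr0.
(* [s] is at most 1, so that s^k <= s, lies below [r], is small enough for F to be bounded by [B] on
   its circle, and satisfies s B <= r^k e. *)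
pose s := Num.min (Num.min 1 (r / 2)) (Num.min (d / 2) (r ^+ k * e / B)).
have s0 : 0 < s.
  by rewrite !lt_min ltr01 !divr_gt0//= mulr_gt0// exprn_gt0.
have s1 : s <= 1 by rewrite !ge_min lexx.
have sr : s <= r / 2 by rewrite !ge_min lexx !orbT.
have sd : s <= d / 2 by rewrite !ge_min lexx !orbT.
have sB : s <= r ^+ k * e / B by rewrite !ge_min lexx !orbT.
clearbody s.
have sr' : s < r by rewrite (le_lt_trans sr)// gtr_pMr// invf_lt1 ?ltr1n.
have sd' : s < d by rewrite (le_lt_trans sd)// gtr_pMr// invf_lt1 ?ltr1n.
have sR : s < R0 by exact: lt_trans rR.
have := mean_annulus hP (_ : 0 < r < R0) (_ : 0 < s < R0).
rewrite r0 rR s0 sR => /(_ isT isT); rewrite !E// => eqn.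
have rk : 0 < r ^+ k by rewrite exprn_gt0.
rewrite -(ler_pM2l rk) -{1}(ger0_norm (ltW rk)) -ncR -ncM eqn ncM ncR ger0_norm ?exprn_ge0 ?(ltW s0)//.
have fB : nc (fn (fun x => F (s%:C * zeta x)) k) <= B.
  have iF : L1 (fun x => F (s%:C * zeta x)) by apply: L1_holo; rewrite ltW.
  rewrite (le_trans (nc_cintm (L1_valX k iF)))// -[leRHS]Rint_cst_circle.
  apply: le_Rintegral => //; [exact/L1_RL1/L1_valX|exact: RL1_cst|].
  move=> x _; rewrite ncM nc_valX mulr1.
  have := dP (s%:C * zeta x); rewrite subr0 nc_dil gtr0_norm// => /(_ sd').
  rewrite sub0r normrN ger0_norm// => /ltW h.
  by rewrite -(subrK (F 0) (F _)) (le_trans (ncD _ _))// addrC lerD2l.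
apply: (@le_trans _ _ (s * B)).
  apply: ler_pM => //; first by rewrite exprn_ge0// ltW.
  by case: k k0 {eqn fB rk sB hP E} @Psi => // k _ _; rewrite exprS ler_piMr ?exprn_ile1// ltW.
by rewrite -ler_pdivlMr.
Qed.

(** This is [mean_annulus] for F z^(-k); the pole at 0 is the reason why only the punctured disc is
    required there. *)
Lemma fc_holo r r' k : 0 < r < R0 -> 0 < r' < R0 ->
  (r' ^+ k)%:C * fc (fun x => F (r%:C * zeta x)) k =
  (r ^+ k)%:C * fc (fun x => F (r'%:C * zeta x)) k.
Proof.
move=> hr hr'; pose Psi z := F z * (z^-1) ^+ k.
have hP z : 0 < nc z < R0 -> holo Psi z.
  move=> /andP[z0 zR]; apply: holoM; first exact: hF.
  by apply/holoX/holoV; [rewrite -nc_gt0|exact: holo_id].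
have E s : 0 < s < R0 -> cint m setT (fun x => Psi (s%:C * zeta x)) =
    (s^-1 ^+ k)%:C * fc (fun x => F (s%:C * zeta x)) k.
  move=> /andP[s0 sR]; rewrite /fc -cintZ//; last by apply/L1_valJX/L1_holo; rewrite ltW.
  by congr cint; apply/funext => x; rewrite /Psi invfM -valJ exprMn rcX rcV; ring.
have := mean_annulus hP hr hr'; rewrite (E r hr) (E r' hr').
case/andP: hr => r0 _; case/andP: hr' => r'0 _ eqn.
have -> : (r' ^+ k)%:C = (r ^+ k)%:C * (r' ^+ k)%:C * (r^-1 ^+ k)%:C.
  by rewrite -!rcM mulrAC -exprMn divff ?gt_eqF// expr1n mul1r.
rewrite -mulrA eqn !mulrA -!rcM -mulrA -[r' ^+ k * _]exprMn divff ?gt_eqF// expr1n mulr1.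
by [].
Qed.

End holo_coefficients.

Lemma circle_polar (z : C) : z != 0 -> exists x : T, z = (nc z)%:C * zeta x.
Proof.
move=> z0; have n0 : nc z != 0 by rewrite nc_eq0.
have h : `|z / (nc z)%:C| == 1.
  by rewrite normcE ncM ncV ncR ger0_norm// divff.
by exists (Circle h); rewrite /= mulrC divfK// -nc_eq0 ncR normr_eq0.
Qed.

(** Cauchy's formula through coefficients. For |w| = r the Poisson integral of F on the circle of
    radius r tends to F w along the radius; by [fn_holo] and [fc_holo] it is the Cauchy integral of
    the values on the unit circle, evaluated at s w, and that is continuous. *)
Theorem holo_Cau (F : C -> C) (R0 : R) z : 1 < R0 -> (forall z, nc z < R0 -> holo F z) ->
  nc z < 1 -> F z = Cau (fun x => F (1%:C * zeta x)) z.
Proof.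
move=> R1 hF z1; set g := fun x => _.
have ig : L1 g by apply: (L1_holo hF); rewrite ler01.
have main w : w != 0 -> nc w < 1 -> F w = Cau g w.
  move=> w0 w1; have [x wx] := circle_polar w0.
  set r := nc w in wx w1; have r0 : 0 < r by rewrite /r nc_gt0.
  have rR : r < R0 by exact: lt_trans R1.
  have ir : L1 (fun x => F (r%:C * zeta x)) by apply: (L1_holo hF); rewrite ltW.
  have rw : nc w = r by [].
  clearbody r; apply: nc_small_eq => e e0.
  have e2 : 0 < e / 2 by rewrite divr_gt0.
  have cont : cradial (Poi (fun x => F (r%:C * zeta x))) x (F (r%:C * zeta x)).
    have [i1 i2] := ir.
    have hc (e' : R) : 0 < e' -> exists2 d : R, 0 < d & forall y : T,
       nc (zeta y - zeta x) < d -> nc (F (r%:C * zeta y) - F (r%:C * zeta x)) <= e'.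
      move=> e'0; have hz : nc (r%:C * zeta x) < R0 by rewrite nc_dil gtr0_norm.
      have /cvgrPdist_lt/(_ _ e'0)/nbhs_nc[d d0 dP] := holo_cvg (hF _ hz).
      exists d => // y yx; have := dP (r%:C * zeta y); rewrite sub0r normrN ger0_norm//.
      move=> H; apply/ltW/H; rewrite -mulrBr ncM ncR gtr0_norm//.
      by rewrite (le_lt_trans _ yx)// ler_piMl// ltW.
    have h1 := @Pr_continuity R (fun x => Re (F (r%:C * zeta x))) x i1.
    have h2 := @Pr_continuity R (fun x => Im (F (r%:C * zeta x))) x i2.
    have {}h1 := h1 (fun e' e'0 => let: ex_intro2 d d0 dP := hc e' e'0 in
      ex_intro2 _ _ d d0 (fun y yx => le_trans (le_trans (eq_ind _ (fun t => `|t| <= _)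
       (Re_le_nc _) _ (ReB _ _)) (lexx _)) (dP y yx))).
    have {}h2 := h2 (fun e' e'0 => let: ex_intro2 d d0 dP := hc e' e'0 in
      ex_intro2 _ _ d d0 (fun y yx => le_trans (le_trans (eq_ind _ (fun t => `|t| <= _)
       (Im_le_nc _) _ (ImB _ _)) (lexx _)) (dP y yx))).
    move=> e' e'0; have [d d0 dP] := radial_cradial h1 h2 e'0.
    exists d => // s s0 s1 sd; rewrite PoiE ?nc_dil_lt1//.
    by have := dP s s0 s1 sd; case: (F (r%:C * zeta x)).
  have [d1 d10 h1] := cont _ e2.
  have w1w : nc w < 1 by rewrite rw.
  have /cvgrPdist_lt/(_ _ e2)/nbhs_nc[d2 d20 h2] := holo_cvg (Cau_holo ig w1w).
  pose d := Num.min 1 (Num.min d1 d2); have d0 : 0 < d by rewrite !lt_min ltr01 d10.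
  pose s := 1 - d / 2.
  have s1 : s < 1 by rewrite gtrBl divr_gt0.
  have dle : d <= 1 by rewrite ge_min lexx.
  have s0 : 0 <= s by rewrite subr_ge0 ler_pdivrMr// (le_trans dle)// mul1r ler1n.
  have ds : 1 - s < d by rewrite /s opprB addrC subrK gtr_pMr// invf_lt1 ?ltr1n.
  have sd1 : 1 - d1 < s.
    by rewrite ltrBlDr -ltrBlDl (lt_le_trans ds)// !ge_min lexx orbT.
  have sd2 : 1 - s < d2 by rewrite (lt_le_trans ds)// !ge_min lexx !orbT.
  clearbody s; have key : Cau (fun x => F (r%:C * zeta x)) (s%:C * zeta x) = Cau g (s%:C * w).
    apply: Cau_eq; [exact: ir|exact: ig|exact: nc_dil_lt1| |].
      rewrite ncM ncR ger0_norm// rw; apply: le_lt_trans w1.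
      by rewrite ler_piMl ?(ltW r0) ?(ltW s1).
    move=> k; have := @fc_holo F R0 hF r 1 k.
    rewrite r0 rR ltr01 R1 => /(_ isT isT); rewrite expr1n mul1r => ->.
    by rewrite wx !exprMn rcX; ring.
  have -> : F w - Cau g w = - (Poi (fun x => F (r%:C * zeta x)) (s%:C * zeta x) - F w) -
      (Cau g w - Cau g (s%:C * w)).
    rewrite Poi_Cau//; [by rewrite key; ring|exact: nc_dil_lt1|].
    by move=> k k0; apply: (fn_holo hF) => //; rewrite r0.
  rewrite (le_trans (ncB _ _))// [leRHS]splitr lerD//.
    by rewrite ncN wx h1.
  have := h2 (s%:C * w); rewrite sub0r normrN ger0_norm// => H.
  rewrite ncBC; apply/ltW/H.
  have -> : s%:C * w - w = - ((1 - s)%:C * w) by rewrite rcB (_ : 1%:C = 1 :> C)//; ring.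
  rewrite ncN ncM ncR rw ger0_norm ?subr_ge0 ?(ltW s1)// (le_lt_trans _ sd2)//.
  by rewrite ler_piMr ?subr_ge0 ?(ltW s1) ?(ltW w1).
(* The origin has no polar form with positive radius; there both sides are compared by
   continuity. *)
have [->|z0] := eqVneq z 0; last exact: main.
have z10 : nc (0 : C) < 1 by rewrite nc0.
apply: nc_small_eq => e e0; have e2 : 0 < e / 2 by rewrite divr_gt0.
have /cvgrPdist_lt/(_ _ e2)/nbhs_nc[d1 d10 h1] := holo_cvg (hF 0 (lt_trans z10 R1)).
have /cvgrPdist_lt/(_ _ e2)/nbhs_nc[d2 d20 h2] := holo_cvg (Cau_holo ig z10).
pose d := Num.min 1 (Num.min d1 d2); have d0 : 0 < d by rewrite !lt_min ltr01 d10.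
pose w : C := (d / 2)%:C.
have dd : d / 2 < d by rewrite gtr_pMr// invf_lt1 ?ltr1n.
have nw : nc w = d / 2 by rewrite ncR ger0_norm// divr_ge0// ltW.
have w0 : w != 0 by rewrite -nc_gt0 nw divr_gt0.
have w1 : nc w < 1 by rewrite nw (lt_le_trans dd)// ge_min lexx.
have wd1 : nc (w - 0) < d1 by rewrite subr0 nw (lt_le_trans dd)// !ge_min lexx orbT.
have wd2 : nc (w - 0) < d2 by rewrite subr0 nw (lt_le_trans dd)// !ge_min lexx !orbT.
have := h1 _ wd1; have := h2 _ wd2; rewrite !sub0r !normrN !(ger0_norm (nc_ge0 _)) => b2 b1.
have -> : F 0 - Cau g 0 = - (F w - F 0) + (Cau g w - Cau g 0) by rewrite (main w w0 w1); ring.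
by rewrite (le_trans (ncD _ _))// ncN [leRHS]splitr lerD// ltW.
Qed.

Lemma holo_Poi (F : C -> C) (R0 : R) z : 1 < R0 -> (forall z, nc z < R0 -> holo F z) ->
  nc z < 1 -> F z = Poi (fun x => F (1%:C * zeta x)) z.
Proof.
move=> R1 hF z1; rewrite (holo_Cau R1 hF z1) Poi_Cau//.
  by apply: (L1_holo hF); rewrite ler01.
by move=> k k0; apply: (fn_holo hF) => //; rewrite ltr01.
Qed.

End poisson_representation.

Lemma half_half (F : realFieldType) : 2^-1 + 2^-1 = 1 :> F.
Proof. by lra. Qed.

(** * Poisson inequalities for log |G| and |G|^(1/2) *)

Section subharmonicity.
Variable R : realType.
Local Notation C := R[i].
Local Notation T := (circle R).
Local Notation m := (@circle_leb R).
Local Notation L1 := (cintble m setT).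
Local Notation RL1 u := (m.-integrable setT (fun x => (u x)%:E)).

Lemma PrZ k (u : T -> R) z : RL1 u -> nc z < 1 -> Pr (fun x => k * u x) z = k * Pr u z.
Proof.
move=> iu z1; rewrite /Pr -RintegralZl//; last exact: RL1_pz.
by congr Rintegral; apply/funext => x; rewrite mulrA.
Qed.

Lemma RL1_bd (u : T -> R) K : measurable_fun setT u -> (forall x, `|u x| <= K) -> RL1 u.
Proof.
move=> mu' uK; apply: (ae_integrable_le mu' (RL1_cst K)).
exact: nearW.
Qed.

(** The tangent of the exponential at the mean lies below its graph, and the Poisson kernel is a
    probability density. *)
Lemma Jensen_exp (u : T -> R) z : RL1 u -> RL1 (fun x => expR (u x)) -> nc z < 1 ->
  expR (Pr u z) <= Pr (fun x => expR (u x)) z.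
Proof.
move=> iu ie z1; set a := Pr u z.
have iv : RL1 (fun x => u x - a + 1) by apply: RL1D; [apply: RL1B|]; [exact: iu|exact: RL1_cst|exact: RL1_cst].
have iw : RL1 (fun x => expR a * (u x - a + 1)) by exact: RL1Z.
have -> : expR a = Pr (fun x => expR a * (u x - a + 1)) z.
  rewrite PrZ// PrD//; last 2 first.
  - by apply: RL1B; [exact: iu|exact: RL1_cst].
  - exact: RL1_cst.
  rewrite PrB//; last exact: RL1_cst.
  by rewrite !Pr_cst// subrr add0r mulr1.
apply: le_Pr => //; apply: nearW => x.
have := expR_ge1Dx (u x - a); rewrite addrC => h.
by rewrite -[leRHS]/(expR (u x)) -(subrK a (u x)) expRD mulrC subrK ler_wpM2r// expR_ge0.
Qed.

(** Jensen's inequality for the square, from the tangent at the mean. *)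
Lemma Pr_sqr (u : T -> R) z : RL1 u -> RL1 (fun x => u x ^+ 2) -> nc z < 1 ->
  Pr u z ^+ 2 <= Pr (fun x => u x ^+ 2) z.
Proof.
move=> iu ie z1; set a := Pr u z.
have -> : a ^+ 2 = Pr (fun x => 2 * a * u x - a ^+ 2) z.
  rewrite PrB//; [|exact: RL1Z|exact: RL1_cst].
  by rewrite PrZ// Pr_cst// -/a; ring.
apply: le_Pr => //; first by apply: RL1B; [exact: RL1Z|exact: RL1_cst].
apply: nearW => x; rewrite -subr_ge0.
by rewrite (_ : _ - _ = (u x - a) ^+ 2) ?sqr_ge0//; ring.
Qed.

Lemma normr_Pr_le (u : T -> R) K z : RL1 u -> (forall x, `|u x| <= K) -> nc z < 1 -> `|Pr u z| <= K.
Proof.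
move=> iu uK z1; rewrite (le_trans (normr_Pr iu z1))// -[leRHS](Pr_cst K z1).
by apply: le_Pr => //; [exact: RL1_norm|exact: RL1_cst|exact: nearW].
Qed.

Lemma bounded_dilate (G : C -> C) rho : (forall z, nc z < 1 -> holo G z) -> 0 <= rho < 1 ->
  exists2 B, 0 <= B & forall x : T, nc (G (rho%:C * zeta x)) <= B.
Proof.
move=> hG r01; have c := dilate_holo hG r01.
have ct : {within `[0, 2 * pi], continuous (fun t => nc (G (rho%:C * zeta (expi t))) : R^o)}.
  apply: continuous_subspaceT => t; apply/cvgrPdist_lt => e /(c t)[d d0 dP].
  apply/nbhs_ballP; exists d => //= s; rewrite /ball /= distrC => /dP h.
  by rewrite (le_lt_trans _ h)// distrC; exact: ncBB.
have [|t _ tP] := @EVT_max R _ 0 (2 * pi) _ ct; first by rewrite mulr_ge0// ltW// pi_gt0.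
exists (nc (G (rho%:C * zeta (expi t)))) => // x.
by have [s s02 <-] := expi_surj x; apply: tP; rewrite in_itv.
Qed.

(* The Herglotz integral, the holomorphic function with real part Pr u. *)
Definition Her (u : T -> R) (z : C) : C :=
  2%:R * Cau (fun x => (u x)%:C) z - (Rintegral m setT u)%:C.

Lemma Her_holo (u : T -> R) z : RL1 u -> nc z < 1 -> holo (Her u) z.
Proof.
move=> iu z1; apply: holoB; last exact: holo_cst.
by apply: holoM; [exact: holo_cst|apply: Cau_holo => //; exact: cintbleR].
Qed.

Lemma Re_Her (u : T -> R) z : RL1 u -> nc z < 1 -> Re (Her u z) = Pr u z.
Proof.
move=> iu z1; have ic := cintbleR iu; have ig := L1_cz ic z1.
have ij : L1 (fun x => (u x)%:C * cj (cz z x)).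
  by move: (cintbleJ measurableT ig); under eq_fun do rewrite conjcM conjcR.
have E : (Pr u z)%:C = Cau (fun x => (u x)%:C) z + cj (Cau (fun x => (u x)%:C) z) - (Rintegral m setT u)%:C.
  have ij' := cintbleJ measurableT ig.
  have := cintD measurableT ig ij'; rewrite (cintJ measurableT ig) -/(Cau _ z) => <-.
  have := cintB measurableT (cintbleD measurableT ig ij') ic.
  rewrite (cintR m measurableT u) => <-; rewrite /Pr -(cintR m measurableT).
  apply: eq_cint => x _; rewrite rcM pzE// conjcM conjcR; ring.
have := congr1 (@complex.Re R) E; rewrite ReB ReD ReJ -[Re (Pr u z)%:C]/(Pr u z) => -> .
by rewrite ReB mulr_natl mulr2n ReD.
Qed.

Lemma dil_sub (s : R) (z : C) : s%:C * z - z = - ((1 - s)%:C * z).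
Proof. by rewrite rcB mulrBl opprB; congr (_ - _); exact/esym/mul1r. Qed.

(** Continuity of the Poisson integral inside the disc, read off from the holomorphic function of
    which it is the real part. *)
Lemma holo_Pr_seq (u : T -> R) z : RL1 u -> nc z < 1 ->
  (fun n => Pr u ((rs R n)%:C * z)) @ \oo --> Pr u z.
Proof.
move=> iu z1; apply/cvgrPdist_le => e e0.
have /cvgrPdist_lt/(_ _ e0)/nbhs_nc[d d0 dP] := holo_cvg (Her_holo iu z1).
have [N NP] := rs_cvg d0; exists N => // n /= Nn.
have s0 := rs_ge0 R n; have s1 := rs_lt1 R n.
have w1 : nc ((rs R n)%:C * z) < 1.
  by rewrite ncM ncR ger0_norm// (le_lt_trans _ z1)// ler_piMl// ltW.
have wz : nc ((rs R n)%:C * z - z) < d.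
  rewrite dil_sub ncN ncM ncR ger0_norm ?subr_ge0 ?(ltW s1)//.
  apply: (@le_lt_trans _ _ (1 - rs R n)); first by rewrite ler_piMr ?subr_ge0 ?(ltW s1) ?(ltW z1).
  by rewrite ltrBlDr -ltrBlDl NP.
have := dP _ wz; rewrite sub0r normrN ger0_norm// => h.
rewrite -(Re_Her iu z1) -(Re_Her iu w1) -ReB; apply: (le_trans (Re_le_nc _)).
by rewrite ncBC; exact: ltW.
Qed.

Section sub_poisson.
Variables (G : C -> C) (rho : R).
Hypothesis hG : forall z, nc z < 1 -> holo G z.
Hypothesis r01 : 0 < rho < 1.

(** Both factors are dilated, by [rho] and by [s]; the product is therefore holomorphic up to radius
    1 / max(rho, s), beyond the unit circle, as Cauchy's formula demands. *)
Lemma holo_dil_Her (u : T -> R) s : RL1 u -> 0 <= s < 1 ->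
  exists2 R0 : R, 1 < R0 & forall z, nc z < R0 ->
    holo (fun z => G (rho%:C * z) * cexp (- Her u (s%:C * z))) z.
Proof.
move=> iu /andP[s0 s1]; have /andP[r0 r1] := r01.
pose q := Num.max rho s; have q0 : 0 < q by rewrite lt_max r0.
have q1 : q < 1 by rewrite gt_max r1.
exists q^-1 => [|z zq]; first by rewrite invf_gt1.
have small t : 0 <= t -> t <= q -> nc (t%:C * z) < 1.
  move=> t0 tq; rewrite ncM ncR ger0_norm// (@le_lt_trans _ _ (q * nc z))//.
    by rewrite ler_wpM2r.
  by rewrite mulrC -ltr_pdivlMr// mul1r.
have hl (t : R) w : holo (fun z => t%:C * z) w by apply: holoM; [exact: holo_cst|exact: holo_id].
apply: holoM.
  by apply: (@holo_comp R (fun z => rho%:C * z) G z (hl _ _)); apply: hG; apply: small; [exact: ltW|rewrite le_max lexx].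
apply: (@holo_comp R (fun z => - Her u (s%:C * z)) _ z); last exact: holo_cexp.
apply: holoN; apply: (@holo_comp R (fun z => s%:C * z) (Her u) z (hl _ _)).
by apply: Her_holo => //; apply: small => //; rewrite le_max lexx orbT.
Qed.

Lemma meas_dil : measurable_fun setT (fun x : T => nc (G (rho%:C * zeta x))).
Proof.
have /andP[r0 r1] := r01; apply: meas_nc; apply: cintble_meas.
by apply: (cintble_dilate hG); rewrite ltW.
Qed.

Lemma meas_lndil e : measurable_fun setT (fun x : T => ln (nc (G (rho%:C * zeta x)) + e)).
Proof.
apply: measurableT_comp; first exact: measurable_ln.
by apply: measurable_funD; [exact: meas_dil|exact: measurable_cst].
Qed.

Lemma lndil_bd e : 0 < e -> exists K, forall x : T, `|ln (nc (G (rho%:C * zeta x)) + e)| <= K.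
Proof.
have /andP[r0 r1] := r01; move=> e0.
have [|B B0 BP] := @bounded_dilate G rho hG; first by rewrite ltW.
exists (`|ln (B + e)| + `|ln e|) => x.
have h1 : ln e <= ln (nc (G (rho%:C * zeta x)) + e).
  by rewrite ler_ln ?posrE ?lerDr// ltr_wpDl.
have h2 : ln (nc (G (rho%:C * zeta x)) + e) <= ln (B + e).
  by rewrite ler_ln ?posrE ?lerD2r// ltr_wpDl.
move: h1 h2; set y := ln _; set b := ln e; set c := ln _ => h1 h2.
rewrite ler_norml; apply/andP; split.
  rewrite (le_trans _ h1)// lerNl (le_trans (ler_norm _))// normrN lerDr//.
by rewrite (le_trans h2)// (le_trans (ler_norm _))// lerDl.
Qed.

Lemma dil_ratio_le z e : nc z < 1 -> 0 < e ->
  Rintegral m setT (fun x => nc (G (rho%:C * zeta x)) *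
    expR (- ln (nc (G (rho%:C * zeta x)) + e)) * pz z x) <= 1.
Proof.
move=> z1 e0; rewrite -(Poi1 z1).
have h (x : T) : 0 <= nc (G (rho%:C * zeta x)) * expR (- ln (nc (G (rho%:C * zeta x)) + e)) <= 1.
  rewrite expRN lnK ?posrE ?ltr_wpDl ?nc_ge0//.
  by rewrite divr_ge0 ?addr_ge0 ?(ltW e0)//= ler_pdivrMr ?mul1r ?lerDl ?(ltW e0)// ltr_wpDl.
have mf : measurable_fun setT (fun x : T => nc (G (rho%:C * zeta x)) * expR (- ln (nc (G (rho%:C * zeta x)) + e))).
  apply: measurable_funM; first exact: meas_dil.
  by apply: measurableT_comp; [exact: measurable_expR|apply: measurable_funN; exact: meas_lndil].
apply: le_Rintegral => //.
- apply: RL1_pz => //; apply: (RL1_bd mf (K := 1)) => x.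
  by rewrite (ger0_norm (andP (h x)).1) (andP (h x)).2.
- exact: integrable_pz.
- by move=> x _; rewrite ler_piMl ?(andP (h x)).2// pz_ge0.
Qed.

(* With u = ln (|G(rho .)| + e), the function G(rho z) exp (- H(s z)), where H is
   the Herglotz integral of u, is holomorphic beyond the circle and hence bounded by
   the Poisson integral of its modulus on the circle; let s tend to 1. *)
Lemma sub_log z e : nc z < 1 -> 0 < e ->
  nc (G (rho%:C * z)) <= expR (Pr (fun x => ln (nc (G (rho%:C * zeta x)) + e)) z).
Proof.
move=> z1 e0; have /andP[r0 r1] := r01.
set u := fun x : T => _.
have mu' : measurable_fun setT u by exact: meas_lndil.
have [K uK] := lndil_bd e0; have iu : RL1 u by exact: RL1_bd uK.
have [|B B0 BP] := @bounded_dilate G rho hG; first by rewrite ltW.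
pose g (x : T) := nc (G (rho%:C * zeta x)).
pose f_ n x := g x * expR (- Pr u ((rs R n)%:C * zeta x)) * pz z x.
have step n : nc (G (rho%:C * z)) * expR (- Pr u ((rs R n)%:C * z)) <= Rintegral m setT (f_ n).
  have s0 := rs_ge0 R n; have s1 := rs_lt1 R n.
  have [|R0 R01 hW] := @holo_dil_Her u (rs R n) iu; first by rewrite s0.
  have := holo_Poi R01 hW z1 => /(congr1 (@Normc.normc R)).
  rewrite ncM nc_cexp ReN Re_Her//; last first.
    by rewrite ncM ncR ger0_norm// (le_lt_trans _ z1)// ler_piMl// ltW.
  move=> ->; rewrite (le_trans (nc_Poi _ z1))//.
    by apply: (L1_holo hW); rewrite ler01.
  rewrite /Pr le_eqVlt; apply/orP; left; apply/eqP; congr Rintegral; apply/funext => x.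
  rewrite /f_ (_ : 1%:C = 1 :> C)// mul1r ncM nc_cexp ReN Re_Her//.
  exact: nc_dil_lt1.
have mPr n : measurable_fun setT (fun x : T => Pr u ((rs R n)%:C * zeta x)).
  have s0 := rs_ge0 R n; have s1 := rs_lt1 R n.
  have hl w : nc w < 1 -> holo (Her u) w by exact: Her_holo.
  have [|i1 _] := @cintble_dilate R (Her u) 1 (rs R n) hl; first by rewrite s0.
  have := RL1_meas i1; congr measurable_fun; apply/funext => x.
  by rewrite Re_Her// nc_dil_lt1.
have mf n : measurable_fun setT (f_ n).
  apply: measurable_funM; last exact: meas_pz.
  apply: measurable_funM; first exact: meas_dil.
  apply: measurableT_comp; first exact: measurable_expR.
  by apply: measurable_funN.
(* In the limit the Poisson integral of [u] becomes [u] itself, and the integrand is g / (g + e)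
   times the kernel, of integral at most 1. *)
pose f x := g x * expR (- u x) * pz z x.
have [||||| _ _ H] := @Rint_dct R f_ f (fun=> B * expR K * (2 / (1 - nc z))).
- exact: mf.
- apply: measurable_funM; last exact: meas_pz.
  apply: measurable_funM; first exact: meas_dil.
  by apply: measurableT_comp; [exact: measurable_expR|exact: measurable_funN].
- exact: RL1_cst.
- have := fatou_radial iu; apply: filterS => x /radial_seq hx.
  rewrite /f; apply: cvgM; last exact: cvg_cst.
  apply: cvgM; first exact: cvg_cst.
  apply: (@continuous_cvg _ _ _ _ _ _ (fun t => expR t)); first exact: continuous_expR.
  exact: cvgN.
- move=> n; apply: nearW => x.
  rewrite ger0_norm; last by apply: mulr_ge0; [apply: mulr_ge0; [exact: nc_ge0|exact: expR_ge0]|exact: pz_ge0].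
  apply: ler_pM; [by rewrite mulr_ge0 ?expR_ge0// nc_ge0|exact: pz_ge0| |exact: pz_le].
  apply: ler_pM; [exact: nc_ge0|exact: expR_ge0|exact: BP|].
  rewrite ler_expR lerNl; have w1 := nc_dil_lt1 x (rs_ge0 R n) (rs_lt1 R n).
  by have := normr_Pr_le iu uK w1; rewrite ler_norml => /andP[].
have lim1 : (fun n => nc (G (rho%:C * z)) * expR (- Pr u ((rs R n)%:C * z))) @ \oo -->
    nc (G (rho%:C * z)) * expR (- Pr u z).
  apply: cvgM; first exact: cvg_cst.
  apply: (@continuous_cvg _ _ _ _ _ _ (fun t => expR t)); first exact: continuous_expR.
  by apply: cvgN; exact: holo_Pr_seq.
have fin : nc (G (rho%:C * z)) * expR (- Pr u z) <= 1.
  apply: le_trans (dil_ratio_le z1 e0).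
  by apply: (ler_cvg_to lim1 H); exact: nearW.
by move: fin; rewrite expRN -ler_pdivlMr ?invr_gt0 ?expR_gt0// invrK mul1r.
Qed.

(** Halve the exponent in [sub_log] and apply Jensen's inequality to the exponential; then remove
    the constant by sqrt (a + e) <= sqrt a + sqrt e. *)
Lemma sub_sqrt z : nc z < 1 ->
  Num.sqrt (nc (G (rho%:C * z))) <= Pr (fun x => Num.sqrt (nc (G (rho%:C * zeta x)))) z.
Proof.
move=> z1; apply/ler_addgt0Pr => e0' e0'0.
(* A square, so that sqrt e is the prescribed error [e0']. *)
pose e := e0' ^+ 2; have e0 : 0 < e by rewrite exprn_gt0.
have /andP[r0 r1] := r01.
have [|B B0 BP] := @bounded_dilate G rho hG; first by rewrite ltW.
have ms : measurable_fun setT (fun x : T => Num.sqrt (nc (G (rho%:C * zeta x)))).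
  by apply: measurableT_comp; [apply: continuous_measurable_fun; exact: sqrt_continuous|exact: meas_dil].
have is_ : RL1 (fun x => Num.sqrt (nc (G (rho%:C * zeta x)))).
  apply: (RL1_bd ms (K := Num.sqrt B)) => x.
  by rewrite ger0_norm ?sqrtr_ge0// ler_wsqrtr.
pose u (x : T) := ln (nc (G (rho%:C * zeta x)) + e).
have [K uK] := lndil_bd e0; have iu : RL1 u by apply: RL1_bd uK; exact: meas_lndil.
have iu2 : RL1 (fun x => 2^-1 * u x) by exact: RL1Z.
have E x : expR (2^-1 * u x) = Num.sqrt (nc (G (rho%:C * zeta x)) + e).
  have p : 0 < nc (G (rho%:C * zeta x)) + e by rewrite ltr_wpDl.
  apply: (@pexpIrn _ 2) => //; rewrite ?nnegrE ?expR_ge0 ?sqrtr_ge0//.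
  by rewrite sqr_sqrtr ?ltW// expr2 -expRD -mulrDl half_half mul1r lnK.
have ie : RL1 (fun x => expR (2^-1 * u x)).
  apply: (RL1_bd (K := expR (2^-1 * K))).
    by apply: measurableT_comp; [exact: measurable_expR|exact: (RL1_meas iu2)].
  move=> x; rewrite ger0_norm ?expR_ge0// ler_expR ler_wpM2l ?invr_ge0//.
  by rewrite (le_trans (ler_norm _) (uK x)).
have a1 : Num.sqrt (nc (G (rho%:C * z))) <= expR (Pr (fun x => 2^-1 * u x) z).
  rewrite PrZ// -(ger0_norm (expR_ge0 _)) -sqrtr_sqr ler_wsqrtr// expr2 -expRD -mulrDl.
  by rewrite half_half mul1r; exact: sub_log.
apply: (le_trans a1); apply: (le_trans (Jensen_exp iu2 ie z1)).
rewrite -[X in _ + X](Pr_cst e0' z1) -PrD//; last exact: RL1_cst.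
apply: le_Pr => //; first by apply: RL1D => //; exact: RL1_cst.
apply: nearW => x; rewrite E -ler_sqr ?nnegrE ?addr_ge0 ?sqrtr_ge0 ?(ltW e0'0)//.
rewrite sqr_sqrtr ?addr_ge0 ?(ltW e0)// sqrrD sqr_sqrtr// addrAC lerDl.
by rewrite mulrn_wge0// mulr_ge0 ?sqrtr_ge0// ltW.
Qed.

End sub_poisson.
End subharmonicity.

(** The dominating p + v varies with the index. On the right, min(E, 2 v) and max(v - p, 0) are
    dominated by fixed functions, and p - v integrates to 0 in the application. *)
Lemma scheffe_pt (F : realFieldType) (E p v : F) : 0 <= v -> E <= p + v ->
  E <= Num.min E (2 * v) + (p - v + 2 * Num.max (v - p) 0).
Proof.
move=> v0 Epv.
have h1 : v - p <= Num.max (v - p) 0 by rewrite le_max lexx.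
have h2 : 0 <= Num.max (v - p) 0 by rewrite le_max lexx orbT.
have /orP[h|h] := le_total E (2 * v).
  by rewrite (min_idPl h); lra.
by rewrite (min_idPr h); lra.
Qed.

Lemma scheffe_max (F : realFieldType) (p v : F) : 0 <= v -> 0 <= p ->
  `|Num.max (v - p) 0| <= v.
Proof.
move=> v0 p0; rewrite ger0_norm ?le_max ?lexx ?orbT//.
by rewrite ge_max v0 gerBl p0.
Qed.

Lemma cvgn_cst_eq (R : realType) (c l : R) : (fun=> c) @ \oo --> l -> c = l.
Proof. by move=> h; rewrite -(cvg_lim (@Rhausdorff R) h) lim_cst. Qed.

Lemma cvgn_max (R : realType) (a b : nat -> R) la lb : a @ \oo --> la -> b @ \oo --> lb ->
  (fun n => Num.max (a n) (b n)) @ \oo --> Num.max la lb.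
Proof.
move=> ha hb; under eq_fun do rewrite maxr_absE; rewrite maxr_absE.
apply: cvgM; last exact: cvg_cst.
apply: cvgD; first exact: cvgD.
by apply: cvg_norm; exact: cvgB.
Qed.

Lemma cvgn_min (R : realType) (a b : nat -> R) la lb : a @ \oo --> la -> b @ \oo --> lb ->
  (fun n => Num.min (a n) (b n)) @ \oo --> Num.min la lb.
Proof.
move=> ha hb; under eq_fun do rewrite minr_absE; rewrite minr_absE.
apply: cvgM; last exact: cvg_cst.
apply: cvgB; first exact: cvgD.
by apply: cvg_norm; exact: cvgB.
Qed.

(** * F. Riesz's theorem: dilates converge to the boundary values in L^1 *)

Section riesz_boundary.
Variable R : realType.
Local Notation C := R[i].
Local Notation T := (circle R).
Local Notation m := (@circle_leb R).
Local Notation L1 := (cintble m setT).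
Local Notation RL1 u := (m.-integrable setT (fun x => (u x)%:E)).
Local Notation Rint := (Rintegral m setT).

Lemma mean_value (F : C -> C) (R0 : R) : 1 < R0 -> (forall z, nc z < R0 -> holo F z) ->
  F 0 = cint m setT (fun x => F (1%:C * zeta x)).
Proof.
move=> R1 hF; rewrite (holo_Cau R1 hF) ?nc0//.
by apply: eq_cint => x _; rewrite /cz mul0r subr0 invr1 mulr1.
Qed.

Lemma pz0 (x : T) : pz 0 x = 1.
Proof. by rewrite /pz nc0 mul0r subr0 nc1 expr0n expr1n subr0 divr1. Qed.

Lemma Pr0 (u : T -> R) : Pr u 0 = Rint u.
Proof. by congr Rintegral; apply/funext => x; rewrite pz0 mulr1. Qed.

Lemma L1_Her_dil (u : T -> R) r : RL1 u -> 0 <= r < 1 -> L1 (fun x => Her u (r%:C * zeta x)).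
Proof. by move=> iu r01; apply: (@cintble_dilate R (Her u) 1) => // w; exact: Her_holo. Qed.

Lemma RL1_Pr_dil (u : T -> R) r : RL1 u -> 0 <= r < 1 -> RL1 (fun x => Pr u (r%:C * zeta x)).
Proof.
move=> iu /[dup] /andP[r0 r1] r01; have [i1 _] := L1_Her_dil iu r01.
move: i1; congr integrable; apply/funext => x; rewrite Re_Her//.
exact: nc_dil_lt1.
Qed.

(** The mean value property of the Herglotz integral, whose value at 0 has real part the mean of
    [u]; this replaces an exchange of integrals. *)
Lemma Rint_Pr (u : T -> R) r : RL1 u -> 0 <= r < 1 ->
  Rint (fun x => Pr u (r%:C * zeta x)) = Rint u.
Proof.
move=> iu /[dup] r01 /andP[r0 r1].
have r1' : 0 < 1 + r by rewrite ltr_pwDl.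
(* A radius above 1 which stays below 1 after multiplication by [r]. *)
have R1 : 1 < 2 / (1 + r) by rewrite ltr_pdivlMr// mul1r; lra.
have hF z : nc z < 2 / (1 + r) -> holo (fun z => Her u (r%:C * z)) z.
  move=> zR; apply: (@holo_comp R (fun z => r%:C * z) (Her u) z).
    by apply: holoM; [exact: holo_cst|exact: holo_id].
  apply: Her_holo => //; rewrite ncM ncR ger0_norm//.
  apply: (@le_lt_trans _ _ (r * (2 / (1 + r)))); first by rewrite ler_wpM2l// ltW.
  by rewrite mulrA ltr_pdivrMr// mul1r; lra.
have := congr1 (@complex.Re R) (mean_value R1 hF).
rewrite mulr0 Re_Her ?nc0// Pr0 => ->; congr Rintegral; apply/funext => x.
by rewrite (_ : 1%:C = 1 :> C)// mul1r Re_Her// nc_dil_lt1.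
Qed.

(* Scheffe's lemma, with E_ n dominated by the convergent p_ n + v. *)
Lemma L1_cvg_dom (E_ p_ : nat -> T -> R) (v : T -> R) :
  RL1 v -> (forall x, 0 <= v x) -> (forall n, RL1 (p_ n)) ->
  (forall n x, 0 <= p_ n x) -> (forall n, Rint (p_ n) = Rint v) ->
  (\forall x \ae m, (fun n => p_ n x) @ \oo --> v x) ->
  (forall n, RL1 (E_ n)) -> (forall n x, 0 <= E_ n x) ->
  (\forall x \ae m, (fun n => E_ n x) @ \oo --> (0 : R)) ->
  (forall n x, E_ n x <= p_ n x + v x) ->
  (fun n => Rint (E_ n)) @ \oo --> (0 : R).
Proof.
move=> iv v0 ip p0 pE pv iE E0 Ec Epv.
pose d_ n x := Num.max (v x - p_ n x) 0.
pose e_ n x := Num.min (E_ n x) (2 * v x).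
have md n : measurable_fun setT (d_ n).
  apply: measurable_maxr; last exact: measurable_cst.
  by apply: measurable_funB; apply: RL1_meas.
have me n : measurable_fun setT (e_ n).
  apply: measurable_minr; first exact: RL1_meas.
  by apply: RL1_meas; exact: RL1Z.
have m0 : measurable_fun [set: T] (fun=> 0 : R) by exact: measurable_cst.
have d_le n x : `|d_ n x| <= v x by exact: scheffe_max.
have e_le n x : `|e_ n x| <= 2 * v x.
  rewrite ger0_norm; first by rewrite /e_ ge_min lexx orbT.
  by rewrite le_min E0 mulr_ge0.
have [|_ _ hd] := Rint_dct md m0 iv _ (fun n => nearW _ (d_le n)).
  apply: filterS pv => x hx; rewrite -[X in _ --> X](_ : Num.max (v x - v x) 0 = 0).
    by apply: cvgn_max; [apply: cvgB => //; exact: cvg_cst|exact: cvg_cst].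
  by rewrite subrr maxxx.
have [|_ _ he] := Rint_dct me m0 (RL1Z 2 iv) _ (fun n => nearW _ (e_le n)).
  apply: filterS Ec => x hx; rewrite -[X in _ --> X](_ : Num.min 0 (2 * v x) = 0).
    by apply: cvgn_min => //; exact: cvg_cst.
  by apply/min_idPl; rewrite mulr_ge0.
rewrite Rint_cst_circle in hd; rewrite Rint_cst_circle in he.
have hs : (fun n => Rint (e_ n) + 2 * Rint (d_ n)) @ \oo --> (0 : R).
  rewrite -[X in _ --> X](_ : 0 + 2 * 0 = 0); last by rewrite mulr0 addr0.
  by apply: cvgD => //; apply: cvgM => //; exact: cvg_cst.
apply: (@squeeze_cvgr _ _ _ _ (fun=> 0) (fun n => Rint (e_ n) + 2 * Rint (d_ n))) => //; last exact: cvg_cst.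
apply: nearW => n; apply/andP; split; first exact: Rintegral_ge0.
have id : RL1 (d_ n) by apply: (ae_integrable_le (md n) iv); exact: nearW.
have ie : RL1 (e_ n) by apply: (ae_integrable_le (me n) (RL1Z 2 iv)); exact: nearW.
have ipv : RL1 (fun x => p_ n x - v x) by exact: RL1B.
have i2d : RL1 (fun x => 2 * d_ n x) by exact: RL1Z.
have is_ : RL1 (fun x => p_ n x - v x + 2 * d_ n x) by exact: RL1D.
apply: (@le_trans _ _ (Rint (fun x => e_ n x + (p_ n x - v x + 2 * d_ n x)))).
  apply: le_Rintegral; [exact: measurableT|exact: iE|exact: RL1D ie is_|move=> x _; exact: scheffe_pt].
have pv0 : Rint (fun x => p_ n x - v x) = 0.
  transitivity (Rint (p_ n) - Rint v); last by rewrite pE subrr.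
  by apply: RintegralB => //; exact: ip.
rewrite RintegralD// lerD2l RintegralD// pv0 add0r.
by rewrite RintegralZl.
Qed.

Lemma fatou_Pr_seq (u : T -> R) : RL1 u ->
  \forall x \ae m, (fun n => Pr u ((rs R n)%:C * zeta x)) @ \oo --> u x.
Proof. by move=> /fatou_radial; apply: filterS => x /radial_seq. Qed.

Lemma rs01 n : 0 <= rs R n < 1.
Proof. by rewrite rs_ge0 rs_lt1. Qed.

(** The dilates of the Poisson integral of |g| are majorants with constant mean converging a.e. to
    |g|, which is the situation of [L1_cvg_dom]. *)
Lemma dilate_cvg_L1 (G : C -> C) (g : T -> C) : L1 g ->
  (forall z, nc z < 1 -> holo G z) ->
  (forall z, nc z < 1 -> nc (G z) <= Pr (fun x => nc (g x)) z) ->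
  (\forall x \ae m, cradial G x (g x)) ->
  (fun n => N1 (fun x => G ((rs R n)%:C * zeta x) - g x)) @ \oo --> (0 : R).
Proof.
move=> ig hG Gle Gg; have iv := L1_RL1 ig.
have iGn n : L1 (fun x => G ((rs R n)%:C * zeta x)) by exact: (cintble_dilate hG (rs01 n)).
apply: (@L1_cvg_dom _ (fun n x => Pr (fun x => nc (g x)) ((rs R n)%:C * zeta x)) (fun x => nc (g x))).
- exact: iv.
- by move=> x; exact: nc_ge0.
- by move=> n; apply: RL1_Pr_dil => //; exact: rs01.
- by move=> n x; apply: Pr_ge0 => //; apply: nc_dil_lt1; [exact: rs_ge0|exact: rs_lt1].
- by move=> n; apply: Rint_Pr => //; exact: rs01.
- exact: fatou_Pr_seq.
- by move=> n; apply: L1_RL1; apply: cintbleB.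
- by move=> n x; exact: nc_ge0.
- by apply: filterS Gg => x; exact: cradial_seq.
- move=> n x; apply: (le_trans (ncB _ _)); apply: lerD => //; apply: Gle.
  by apply: nc_dil_lt1; [exact: rs_ge0|exact: rs_lt1].
Qed.

Lemma N1_cvg_cint (g_ : nat -> T -> C) g (h : T -> C) M : (forall n, L1 (g_ n)) -> L1 g ->
  cmeas setT h -> (forall x, nc (h x) <= M) ->
  (fun n => N1 (fun x => g_ n x - g x)) @ \oo --> (0 : R) ->
  (fun n => nc (cint m setT (fun x => g_ n x * h x) - cint m setT (fun x => g x * h x)))
    @ \oo --> (0 : R).
Proof.
move=> ign ig mh hM H.
apply: (@squeeze_cvgr _ _ _ _ (fun=> 0) (fun n => N1 (fun x => g_ n x - g x) * M)) => //.
- apply: nearW => n; rewrite nc_ge0 andTb.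
  have i1 := L1M (ign n) mh hM; have i2 := L1M ig mh hM.
  have i3 : L1 (fun x => g_ n x - g x) by exact: cintbleB.
  rewrite -cintB// (le_trans (nc_cintm (cintbleB measurableT i1 i2)))// /N1.
  rewrite mulrC -RintegralZl//; last exact: L1_RL1.
  apply: le_Rintegral => //.
  + by apply: L1_RL1; exact: cintbleB.
  + by apply: RL1Z; exact: L1_RL1.
  + by move=> x _; rewrite -mulrBl ncM mulrC ler_wpM2r.
- exact: cvg_cst.
- by rewrite -[X in _ --> X](mul0r M); apply: cvgM => //; exact: cvg_cst.
Qed.

(** With h a square root, h^2 / K is a modulus divided by K, hence small in L^1 for large K. *)
Lemma trunc_le (K h : R) : 0 < K -> 0 <= h -> h <= Num.min h K + h ^+ 2 / K.
Proof.
move=> K0 h0; have /orP[hK|hK] := le_total h K.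
  by rewrite (min_idPl hK) lerDl divr_ge0 ?sqr_ge0// ltW.
rewrite (min_idPr hK) -[leLHS]add0r lerD ?(ltW K0)// ler_pdivlMr// expr2 ler_wpM2l//.
Qed.

Section riesz.
Variables (G : C -> C) (g : T -> C) (M : R).
Hypothesis hG : forall z, nc z < 1 -> holo G z.
Hypothesis hM : forall r, 0 <= r < 1 -> N1 (fun x => G (r%:C * zeta x)) <= M.
Hypothesis ig : L1 g.
Hypothesis Gg : \forall x \ae m, cradial G x (g x).

Let sq r (x : T) := Num.sqrt (nc (G (r%:C * zeta x))).
Let sg x := Num.sqrt (nc (g x)).

Lemma RL1_sqrt (u : T -> R) : RL1 u -> (forall x, 0 <= u x) -> RL1 (fun x => Num.sqrt (u x)).
Proof.
move=> iu u0; have mu' : measurable_fun setT (fun x => Num.sqrt (u x)).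
  by apply: measurableT_comp; [apply: continuous_measurable_fun; exact: sqrt_continuous|exact: RL1_meas].
apply: (ae_integrable_le mu' (RL1D (RL1_cst 1) iu)); apply: nearW => x.
have := trunc_le ltr01 (sqrtr_ge0 (u x)); rewrite divr1 sqr_sqrtr// => h.
by rewrite ger0_norm ?sqrtr_ge0// (le_trans h)// lerD2r ge_min lexx orbT.
Qed.

Lemma RL1_min (u : T -> R) K : RL1 u -> (forall x, 0 <= u x) -> 0 <= K -> RL1 (fun x => Num.min (u x) K).
Proof.
move=> iu u0 K0; apply: (RL1_bd (K := K)).
  by apply: measurable_minr; [exact: RL1_meas|exact: measurable_cst].
by move=> x; rewrite ger0_norm ?le_min ?u0// ge_min lexx orbT.
Qed.

(* Truncating the square root of |G(r .)| at height K makes dominated convergence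
   applicable; the remainder is controlled by the L^1 bound, divided by K. *)
Lemma sqrt_Pr_le z K : nc z < 1 -> 0 < K ->
  Num.sqrt (nc (G z)) <= Pr sg z + 2 / (1 - nc z) * M / K.
Proof.
move=> z1 K0.
have ign r : 0 <= r < 1 -> RL1 (fun x => nc (G (r%:C * zeta x))).
  by move=> r01; apply: L1_RL1; exact: (cintble_dilate hG).
have isg : RL1 sg by apply: RL1_sqrt => //; exact: L1_RL1.
have isq r : 0 <= r < 1 -> RL1 (sq r) by move=> r01; apply: RL1_sqrt => //; exact: ign.
have c1 : 0 < 1 - nc z by rewrite subr_gt0.
have step n : Num.sqrt (nc (G ((rs R n.+1)%:C * z))) <=
    Rint (fun x => Num.min (sq (rs R n.+1) x) K * pz z x) + 2 / (1 - nc z) * M / K.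
  have r01 := rs01 n.+1.
  have rp : 0 < rs R n.+1 < 1.
    by rewrite rs_lt1 andbT subr_gt0 invf_lt1 ?ltr1n// ltr0n.
  rewrite (le_trans (sub_sqrt hG rp z1))//.
  have i1 : RL1 (fun x => Num.min (sq (rs R n.+1) x) K).
    by apply: RL1_min; [exact: isq|move=> x; exact: sqrtr_ge0|exact: ltW].
  have i2 : RL1 (fun x => K^-1 * nc (G ((rs R n.+1)%:C * zeta x))) by apply: RL1Z; exact: ign.
  apply: (@le_trans _ _ (Pr (fun x => Num.min (sq (rs R n.+1) x) K + K^-1 * nc (G ((rs R n.+1)%:C * zeta x))) z)).
    apply: le_Pr => //; [exact: isq|exact: RL1D|apply: nearW => x].
    have := trunc_le K0 (sqrtr_ge0 (nc (G ((rs R n.+1)%:C * zeta x)))).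
    by rewrite sqr_sqrtr// [_ / K]mulrC.
  rewrite PrD// -[X in X + _ <= _]/(Rint _) lerD2l PrZ//; last exact: ign.
  rewrite mulrC ler_wpM2r ?invr_ge0 ?(ltW K0)//.
  apply: (@le_trans _ _ (Rint (fun x => 2 / (1 - nc z) * nc (G ((rs R n.+1)%:C * zeta x))))).
    apply: le_Rintegral => //; [apply: RL1_pz => //; exact: ign|apply: RL1Z; exact: ign|].
    by move=> x _; rewrite mulrC ler_wpM2r// pz_le.
  rewrite RintegralZl//; last exact: ign.
  by rewrite ler_wpM2l ?divr_ge0 ?(ltW c1)// hM.
have [||||| _ _ H] := @Rint_dct R (fun n x => Num.min (sq (rs R n.+1) x) K * pz z x)
    (fun x => Num.min (sg x) K * pz z x) (fun=> K * (2 / (1 - nc z))).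
- move=> n; apply: RL1_meas; apply: RL1_pz => //.
  by apply: RL1_min; [apply: isq; exact: rs01|move=> x; exact: sqrtr_ge0|exact: ltW].
- by apply: RL1_meas; apply: RL1_pz => //; apply: RL1_min => //; [move=> x; exact: sqrtr_ge0|exact: ltW].
- exact: RL1_cst.
- apply: filterS Gg => x /cradial_seq hx; apply: cvgM; last exact: cvg_cst.
  apply: cvgn_min; last exact: cvg_cst.
  apply: (@continuous_cvg _ _ _ _ _ _ (fun t => Num.sqrt t)); first exact: sqrt_continuous.
  rewrite -cvg_shiftS in hx.
  apply/cvgrPdist_le => e e0; move/cvgrPdist_le: hx => /(_ e e0).
  apply: filterS => n; rewrite sub0r normrN ger0_norm ?nc_ge0// => h.
  by rewrite distrC; apply: le_trans (ncBB _ _) _.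
- move=> n; apply: nearW => x; rewrite ger0_norm; last first.
    by apply: mulr_ge0; [rewrite le_min sqrtr_ge0 ltW|exact: pz_ge0].
  apply: ler_pM; [by rewrite le_min sqrtr_ge0 ltW|exact: pz_ge0| |exact: pz_le].
  by rewrite ge_min lexx orbT.
have lim1 : (fun n => Num.sqrt (nc (G ((rs R n.+1)%:C * z)))) @ \oo --> Num.sqrt (nc (G z)).
  apply: (@continuous_cvg _ _ _ _ _ _ (fun t => Num.sqrt t)); first exact: sqrt_continuous.
  apply/cvgrPdist_le => e e0.
  have /cvgrPdist_lt/(_ _ e0)/nbhs_nc[d d0 dP] := holo_cvg (hG z1).
  have [N NP] := rs_cvg d0; exists N => // n /= Nn.
  have wz : nc ((rs R n.+1)%:C * z - z) < d.
    rewrite dil_sub ncN ncM ncR ger0_norm ?subr_ge0 ?(ltW (rs_lt1 _ _))//.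
    apply: (@le_lt_trans _ _ (1 - rs R n.+1)).
      by rewrite ler_piMr ?subr_ge0 ?(ltW (rs_lt1 _ _)) ?(ltW z1).
    by rewrite ltrBlDr -ltrBlDl; apply: NP; rewrite leqW.
  have := dP _ wz; rewrite sub0r normrN ger0_norm ?nc_ge0// => h.
  by rewrite distrC (le_trans (ncBB _ _))// ltW.
have lim2 : (fun n => Rint (fun x => Num.min (sq (rs R n.+1) x) K * pz z x) + 2 / (1 - nc z) * M / K) @ \oo -->
    Rint (fun x => Num.min (sg x) K * pz z x) + 2 / (1 - nc z) * M / K.
  by apply: cvgD => //; exact: cvg_cst.
apply: (@le_trans _ _ (Rint (fun x => Num.min (sg x) K * pz z x) + 2 / (1 - nc z) * M / K)).
  by apply: (ler_cvg_to lim1 lim2); exact: nearW.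
rewrite lerD2r; apply: le_Pr => //.
  by apply: RL1_min => //; [move=> x; exact: sqrtr_ge0|exact: ltW].
by apply: nearW => x; rewrite ge_min lexx.
Qed.

(** Let K tend to infinity in [sqrt_Pr_le], then square; the square of the Poisson integral of
    |g|^(1/2) is at most that of |g|. *)
Lemma riesz_bound z : nc z < 1 -> nc (G z) <= Pr (fun x => nc (g x)) z.
Proof.
move=> z1; have c1 : 0 < 1 - nc z by rewrite subr_gt0.
have isg : RL1 sg by apply: RL1_sqrt => //; exact: L1_RL1.
have h1 : Num.sqrt (nc (G z)) <= Pr sg z.
  apply/ler_addgt0Pr => e e0.
  have M0 : 0 <= M.
    by apply: le_trans (N1_ge0 _) (hM (r := 0) _); rewrite lexx ltr01.
  pose B := 2 / (1 - nc z) * M; have B0 : 0 <= B by rewrite mulr_ge0 ?divr_ge0// ltW.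
  have K0 : 0 < (B + 1) / e by rewrite divr_gt0// ltr_wpDl.
  apply: (le_trans (sqrt_Pr_le z1 K0)); rewrite lerD2l -/B.
  by rewrite invf_div mulrA ler_pdivrMr ?ltr_wpDl// mulrC ler_wpM2l ?(ltW e0)// lerDl.
have h0 : 0 <= Pr sg z by apply: Pr_ge0 => // x; exact: sqrtr_ge0.
have E x : sg x ^+ 2 = nc (g x) by rewrite sqr_sqrtr.
have -> : nc (G z) = Num.sqrt (nc (G z)) ^+ 2 by rewrite sqr_sqrtr.
apply: (@le_trans _ _ (Pr sg z ^+ 2)); first by rewrite lerXn2r ?nnegrE ?sqrtr_ge0.
apply: (le_trans (Pr_sqr isg _ z1)).
  by under eq_fun do rewrite E; exact: L1_RL1.
by under [X in Pr X]eq_fun do rewrite E.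
Qed.

(** The coefficients of the dilates vanish by [fn_holo], and L^1 convergence carries this over to
    the boundary function. *)
Lemma fn_boundary k : (0 < k)%N -> fn g k = 0.
Proof.
move=> k0; have H := dilate_cvg_L1 ig hG riesz_bound Gg.
have iGn n : L1 (fun x => G ((rs R n)%:C * zeta x)) by exact: (cintble_dilate hG (rs01 n)).
have mX : cmeas setT (fun x : T => zeta x ^+ k) by apply: cmeasX; exact: cmeas_val.
have := fun hX => N1_cvg_cint iGn ig mX (M := 1) hX H.
have nX (x : T) : nc (zeta x ^+ k) <= 1 by rewrite nc_valX.
move=> /(_ nX) lim.
have l2 : (fun=> nc (fn g k)) @ \oo --> (0 : R).
  apply: cvg_trans lim; apply: near_eq_cvg; exists 1%N => // n n1.
  rewrite -[cint _ _ (fun x => _ * _)]/(fn _ k) (fn_holo hG)//; first by rewrite sub0r ncN.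
  by move: n1; rewrite /mkset => n1; rewrite rs_lt1 andbT subr_gt0 invf_lt1 ?ltr1n ?ltr0n.
by apply/eqP; rewrite -nc_eq0; apply/eqP; exact: cvgn_cst_eq l2.
Qed.

End riesz.

Lemma Poi_holo g z : L1 g -> nc z < 1 -> (forall k, (0 < k)%N -> fn g k = 0) -> holo (Poi g) z.
Proof.
move=> ig z1 gk; have := Cau_holo ig z1; rewrite /holo.
apply: near_eq_derivable.
apply/nbhs_nc; exists (1 - nc z) => [|w wz]; first by rewrite subr_gt0.
rewrite Poi_Cau//; have := ncB_ge w z; lra.
Qed.

End riesz_boundary.

(** * Hardy spaces described by Fourier coefficients *)

Section hardy_spaces.
Variable R : realType.
Local Notation C := R[i].
Local Notation T := (circle R).
Local Notation m := (@circle_leb R).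
Local Notation L1 := (cintble m setT).
Local Notation RL1 u := (m.-integrable setT (fun x => (u x)%:E)).
Local Notation Rint := (Rintegral m setT).

Definition L2 (f : T -> C) := cmeas setT f /\ RL1 (fun x => nc (f x) ^+ 2).
(** The square of the norm; root and exponent 2 of [Lp_norm] are dealt with once, in [Lp2_le] and
    [le_Lp2]. *)
Definition N2 (f : T -> C) : R := Rint (fun x => nc (f x) ^+ 2).
Definition Loo (f : T -> C) := cmeas setT f /\ exists M : R, \forall x \ae m, nc (f x) <= M.

Lemma Lp1E (f : T -> C) : Lp_norm 1%E f = (\int[m]_x (nc (f x))%:E)%E.
Proof.
rewrite /Lp_norm Lnorm1; apply: eq_integral => x _.
by rewrite abse_EFin ger0_norm.
Qed.

Lemma Lp2E (f : T -> C) : (Lp_norm 2%:E f `^ 2 = \int[m]_x (nc (f x) ^+ 2)%:E)%E.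
Proof.
rewrite /Lp_norm powR_Lnorm ?pnatr_eq0//; apply: eq_integral => x _.
by rewrite abse_EFin ger0_norm ?nc_ge0// poweR_EFin powR_mulrn.
Qed.

Lemma RL1_fin (u : T -> R) : measurable_fun setT u -> (forall x, 0 <= u x) ->
  (\int[m]_x (u x)%:E < +oo)%E -> RL1 u.
Proof.
move=> mu' u0 ui; apply/integrableP; split; first exact/measurable_EFinP.
by under eq_integral do rewrite abse_EFin ger0_norm//.
Qed.

Lemma RintE (u : T -> R) : RL1 u -> (\int[m]_x (u x)%:E)%E = (Rint u)%:E.
Proof. by move=> iu; rewrite fineK//; exact: integrable_fin_num. Qed.

Lemma Lp1_spaceP (f : T -> C) : Lp_space 1%E f <-> L1 f.
Proof.
split=> [[mf fi]|i1].
  apply: (cintbleP measurableT mf); apply: RL1_fin => //; first exact: meas_nc.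
  by rewrite -Lp1E.
split; first exact: (cintble_meas i1).
by rewrite Lp1E RintE ?ltry//; exact: L1_RL1.
Qed.

Lemma Lp_norm1 (f : T -> C) : L1 f -> Lp_norm 1%E f = (N1 f)%:E.
Proof. by move=> i1; rewrite Lp1E RintE//; exact: L1_RL1. Qed.

Lemma meas_nc2 (f : T -> C) : cmeas setT f -> measurable_fun setT (fun x => nc (f x) ^+ 2).
Proof. by move=> mf; apply: measurable_funX; exact: meas_nc. Qed.

Lemma Lp2_spaceP (f : T -> C) : Lp_space 2%:E f <-> L2 f.
Proof.
split=> [[mf fi]|[mf i2]]; split=> //.
  apply: RL1_fin; [exact: meas_nc2|by move=> x; exact: sqr_ge0|].
  by rewrite -Lp2E poweR_lty.
have := Lp2E f; rewrite RintE//; case: (Lp_norm _ f) (Lnorm_ge0 m 2%:E (fun x => (nc (f x))%:E)) => [r|//|//] _.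
  by rewrite ltry.
by rewrite poweRyr// pnatr_eq0.
Qed.

Lemma Lp2_le (f : T -> C) (M : R) : L2 f -> (Lp_norm 2%:E f <= M%:E)%E -> N2 f <= M ^+ 2.
Proof.
move=> [mf i2] fM; have n0 := Lnorm_ge0 m 2%:E (fun x => (nc (f x))%:E).
have M0 : 0 <= M by rewrite -lee_fin (le_trans n0).
rewrite -lee_fin -[(N2 f)%:E]RintE// -Lp2E -(powR_mulrn 2 M0) -poweR_EFin.
by apply: gt0_ler_poweR => //; rewrite in_itv/= ?n0 ?leey// lee_fin M0.
Qed.

Lemma le_Lp2 (f : T -> C) (M : R) : L2 f -> 0 <= M -> N2 f <= M ^+ 2 -> (Lp_norm 2%:E f <= M%:E)%E.
Proof.
move=> [mf i2] M0 fM; have := Lp2E f; rewrite RintE//.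
have : (0 <= Lp_norm 2%:E f)%E by exact: Lnorm_ge0.
case: (Lp_norm _ f) => [r|_|//]; first rewrite lee_fin => r0.
  rewrite poweR_EFin powR_mulrn// => -[E]; rewrite lee_fin.
  by rewrite -(@ler_pXn2r _ 2) ?nnegrE// E.
by rewrite poweRyr// pnatr_eq0.
Qed.

Lemma circle_leb_gt0 : (0 < m setT)%E.
Proof. by rewrite probability_setT. Qed.

Lemma Lpoo_le (f : T -> C) (M : R) :
  (Lp_norm +oo%E f <= M%:E)%E <-> \forall x \ae m, nc (f x) <= M.
Proof.
rewrite /Lp_norm unlock circle_leb_gt0; split.
  by move/ess_supP; apply: filterS => x; rewrite /= ger0_norm.
by move=> h; apply/ess_supP; apply: filterS h => x; rewrite /= ger0_norm.
Qed.

Lemma Lpoo_spaceP (f : T -> C) : Lp_space +oo%E f <-> Loo f.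
Proof.
split=> [[mf fi]|[mf [M fM]]]; split=> //.
  have n0 := Lnorm_ge0 m +oo%E (fun x => (nc (f x))%:E).
  exists (fine (Lp_norm +oo%E f)); apply/Lpoo_le; rewrite fineK//.
  by rewrite ge0_fin_numE.
by apply: le_lt_trans (ltry M); exact/Lpoo_le.
Qed.

Lemma nc_le_sqr (x : R) : x <= 1 + x ^+ 2.
Proof. by have := sqr_ge0 (x - 1); have := sqr_ge0 x; rewrite sqrrB1; lra. Qed.

Lemma L2_L1 f : L2 f -> L1 f.
Proof.
move=> [mf i2]; apply: (cintble_ae_le mf (RL1D (RL1_cst 1) i2)).
by apply: nearW => x; exact: nc_le_sqr.
Qed.

Lemma Loo_L1 f : Loo f -> L1 f.
Proof. by move=> [mf [M fM]]; exact: cintble_bd fM. Qed.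

Lemma Loo_L2 f : Loo f -> L2 f.
Proof.
move=> [mf [M fM]]; split=> //.
apply: (ae_integrable_le (meas_nc2 mf) (RL1_cst (M ^+ 2))).
apply: filterS fM => x xM; rewrite ger0_norm ?sqr_ge0//.
by rewrite lerXn2r ?nnegrE// (le_trans _ xM).
Qed.

Lemma N1_le_N2 f : L2 f -> N1 f <= 1 + N2 f.
Proof.
move=> /[dup] /L2_L1 i1 [mf i2]; rewrite /N2 -[in leRHS](Rint_cst_circle (1 : R)) -RintegralD//; last exact: RL1_cst.
apply: le_Rintegral => //; [exact: L1_RL1|exact: RL1D (RL1_cst 1) i2|].
by move=> x _; exact: nc_le_sqr.
Qed.

Lemma holo_discP (F : C -> C) : holomorphic_disc F <-> forall z, nc z < 1 -> holo F z.
Proof. by split=> h z z1; apply: h; rewrite ?normc_lt1// -normc_lt1. Qed.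

Lemma boundaryP (F : C -> C) f : boundary_value F f <-> \forall x \ae m, cradial F x (f x).
Proof. by split; apply: filterS => x /cradialP. Qed.

Lemma L1_dilate F r : (forall z : C, nc z < 1 -> holo F z) -> 0 <= r < 1 -> L1 (dilate F r).
Proof. exact: cintble_dilate. Qed.

Lemma L2_dilate F r : (forall z : C, nc z < 1 -> holo F z) -> 0 <= r < 1 -> L2 (dilate F r).
Proof.
move=> hF r01; have [B B0 BP] := bounded_dilate hF r01.
apply: Loo_L2; split; first by apply: cintble_meas; exact: L1_dilate.
by exists B; exact: nearW.
Qed.

Lemma N1_Poi_dil f r : L1 f -> 0 <= r < 1 -> (forall z, nc z < 1 -> holo (Poi f) z) ->
  N1 (dilate (Poi f) r) <= N1 f.
Proof.
move=> i1 r01 hP; have iu := L1_RL1 i1; rewrite /N1 -(Rint_Pr iu r01).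
apply: le_Rintegral => //; [by apply: L1_RL1; exact: L1_dilate|exact: RL1_Pr_dil|].
by move=> x _; apply: nc_Poi => //; case/andP: r01 => r0 r1; exact: nc_dil_lt1.
Qed.

Lemma N2_Poi_dil f r : L2 f -> 0 <= r < 1 -> (forall z, nc z < 1 -> holo (Poi f) z) ->
  N2 (dilate (Poi f) r) <= N2 f.
Proof.
move=> /[dup] /L2_L1 i1 [mf i2] r01 hP; have iu := L1_RL1 i1; rewrite /N2 -(Rint_Pr i2 r01).
apply: le_Rintegral => //; [by have [_] := L2_dilate hP r01|exact: RL1_Pr_dil|].
move=> x _; have w1 : nc (r%:C * zeta x) < 1 by case/andP: r01 => r0 r1; exact: nc_dil_lt1.
apply: le_trans (Pr_sqr iu i2 w1); have h := nc_Poi i1 w1.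
by rewrite lerXn2r ?nnegrE ?nc_ge0// (le_trans _ h).
Qed.

(** Membership becomes a linear condition on coefficients. One direction is Riesz's theorem; in the
    other the Poisson integral is the extension, with radial limits by Fatou and L^1 means at most
    [N1 f]. *)
Lemma hardy1P f : hardy 1%E f <-> L1 f /\ forall k, (0 < k)%N -> fn f k = 0.
Proof.
split=> [[/Lp1_spaceP i1 [F [/holo_discP hF [M hM] /boundaryP bF]]]|[i1 fk]].
  split=> // k; apply: (fn_boundary hF (M := M)) => // r r01.
  by rewrite -lee_fin -Lp_norm1; [exact: hM|exact: L1_dilate].
have hP z : nc z < 1 -> holo (Poi f) z by move=> z1; exact: Poi_holo.
split; first exact/Lp1_spaceP; exists (Poi f); split; first exact/holo_discP.
  exists (N1 f) => r r01; rewrite Lp_norm1; last exact: L1_dilate.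
  by rewrite lee_fin; exact: N1_Poi_dil.
by apply/boundaryP; exact: fatou_cradial.
Qed.

Lemma hardy2P f : hardy 2%:E f <-> L2 f /\ forall k, (0 < k)%N -> fn f k = 0.
Proof.
split=> [[/Lp2_spaceP i2 [F [/holo_discP hF [M hM] /boundaryP bF]]]|[i2 fk]].
  split=> // k; apply: (fn_boundary hF (M := 1 + M ^+ 2)) => //; last exact: L2_L1.
  move=> r r01; have iF := L2_dilate hF r01.
  by rewrite (le_trans (N1_le_N2 iF))// lerD2l; apply: Lp2_le => //; exact: hM.
have i1 := L2_L1 i2.
have hP z : nc z < 1 -> holo (Poi f) z by move=> z1; exact: Poi_holo.
split; first exact/Lp2_spaceP; exists (Poi f); split; first exact/holo_discP.
  (* A bound without a square root: N2 f <= (1 + N2 f)^2. *)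
  exists (1 + N2 f) => r r01; have n20 : 0 <= N2 f by apply: Rintegral_ge0 => x _; exact: sqr_ge0.
  apply: le_Lp2; [exact: L2_dilate|exact: addr_ge0|].
  apply: le_trans (N2_Poi_dil i2 r01 hP) _; rewrite expr2 mulrDl mul1r.
  by rewrite addrAC lerDr addr_ge0// mulr_ge0// addr_ge0.
by apply/boundaryP; exact: fatou_cradial.
Qed.

Lemma fn_shift (f : T -> C) k : fn (fun x => zeta x * f x) k = fn f k.+1.
Proof. by apply: eq_cint => x _; rewrite exprS; ring. Qed.

Lemma L1_val f : L1 f -> L1 (fun x => zeta x * f x).
Proof.
move=> i1; apply: (cintbleP measurableT).
  by apply: cmeasM => //; [exact: cmeas_val|exact: (cintble_meas i1)].
by under eq_fun do rewrite ncM nc_val mul1r; exact: L1_RL1.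
Qed.

Lemma L1_valJ f : L1 f -> L1 (fun x => cj (zeta x) * f x).
Proof.
move=> i1; apply: (cintbleP measurableT).
  by apply: cmeasM => //; [exact: cmeas_valJ|exact: (cintble_meas i1)].
by under eq_fun do rewrite ncM nc_valJ mul1r; exact: L1_RL1.
Qed.

Lemma hardy01P f : hardy0 1%E f <-> L1 f /\ forall k, fn f k = 0.
Proof.
split=> [[g /hardy1P[ig gk] ->]|[i1 fk]].
  by split=> [|k]; [exact: L1_val|rewrite fn_shift gk].
exists (fun x => cj (zeta x) * f x).
  apply/hardy1P; split=> [|[//|k] _]; first exact: L1_valJ.
  rewrite -fn_shift -[RHS](fk k); apply: eq_cint => x _.
  by rewrite mulrA val_valJ mul1r.
by apply/funext => x; rewrite mulrA val_valJ mul1r.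
Qed.

Lemma L1_holo_mul F G (M N : R) r : (forall z : C, nc z < 1 -> holo F z) ->
  (forall z : C, nc z < 1 -> holo G z) -> 0 <= r < 1 ->
  N2 (dilate F r) <= M -> N2 (dilate G r) <= N -> N1 (dilate (fun z => F z * G z) r) <= M + N.
Proof.
move=> hF hG r01 FM GN; have [_ i1] := L2_dilate hF r01; have [_ i2] := L2_dilate hG r01.
have hFG z : nc z < 1 -> holo (fun z => F z * G z) z by move=> z1; apply: holoM; [exact: hF|exact: hG].
apply: le_trans (lerD FM GN); rewrite /N2 -RintegralD//.
apply: le_Rintegral => //; [by apply: L1_RL1; exact: L1_dilate|exact: RL1D i1 i2|].
move=> x _; rewrite /dilate ncM; move: (nc _) (nc _) => a b.
by have := sqr_ge0 (a - b); rewrite sqrrB; have := sqr_ge0 a; have := sqr_ge0 b; lra.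
Qed.

Lemma cradialM (F G : C -> C) x a b : cradial F x a -> cradial G x b -> cradial (fun z => F z * G z) x (a * b).
Proof.
move=> /cradialP hF /cradialP hG; apply/cradialP; exact: (@cvgM C _ _ _ _ _ _ _ hF hG).
Qed.

Lemma L2_mul f g : L2 f -> L2 g -> L1 (fun x => f x * g x).
Proof.
move=> [mf i1] [mg i2]; apply: (cintble_ae_le _ (RL1D i1 i2)); first exact: cmeasM.
apply: nearW => x; rewrite ncM; move: (nc _) (nc _) => a b.
by have := sqr_ge0 (a - b); rewrite sqrrB; have := sqr_ge0 a; have := sqr_ge0 b; lra.
Qed.

(** The product of the two Poisson extensions is holomorphic with means bounded in L^1, since |x y|
    <= |x|^2 + |y|^2, and has the product as radial limit. No convolution of coefficients is
    needed. *)
Lemma fn_mul2 f g k : L2 f -> (forall k, (0 < k)%N -> fn f k = 0) ->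
  L2 g -> (forall k, (0 < k)%N -> fn g k = 0) -> (0 < k)%N -> fn (fun x => f x * g x) k = 0.
Proof.
move=> i2 fk j2 gk; have i1 := L2_L1 i2; have j1 := L2_L1 j2.
have hF z : nc z < 1 -> holo (Poi f) z by move=> z1; exact: Poi_holo.
have hG z : nc z < 1 -> holo (Poi g) z by move=> z1; exact: Poi_holo.
apply: (@fn_boundary R (fun z => Poi f z * Poi g z) _ (N2 f + N2 g)).
- by move=> z z1; apply: holoM; [exact: hF|exact: hG].
- move=> r r01; apply: (L1_holo_mul hF hG r01); [exact: N2_Poi_dil|exact: N2_Poi_dil].
- exact: L2_mul.
- by apply: filterS2 (fatou_cradial i1) (fatou_cradial j1) => x; exact: cradialM.
Qed.

End hardy_spaces.

(** * The Riesz-Fischer theorem *)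

Section l1_limits.
Variable R : realType.
Local Notation C := R[i].
Local Notation T := (circle R).
Local Notation m := (@circle_leb R).
Local Notation L1 := (cintble m setT).
Local Notation RL1 u := (m.-integrable setT (fun x => (u x)%:E)).
Local Notation Rint := (Rintegral m setT).

Lemma cvgn_EFin (u : nat -> R) l : u @ \oo --> l -> (fun n => (u n)%:E) @ \oo --> l%:E.
Proof. by move=> h; apply: cvg_EFin => //; exact: nearW. Qed.

Lemma Rint_fatou (f_ : nat -> T -> R) (f : T -> R) B :
  (forall n, RL1 (f_ n)) -> (forall n x, 0 <= f_ n x) -> (forall n, Rint (f_ n) <= B) ->
  measurable_fun setT f -> (forall x, 0 <= f x) ->
  (\forall x \ae m, (fun n => f_ n x) @ \oo --> f x) -> RL1 f /\ Rint f <= B.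
Proof.
move=> if_ f0_ fB mf f0 hc.
have mE n : measurable_fun setT (fun x => (f_ n x)%:E) by apply/measurable_EFinP; exact: RL1_meas.
have le : (\int[m]_x (f x)%:E <= B%:E)%E.
  rewrite (@ae_eq_integral _ _ _ m setT (fun x => limn_einf (fun n => (f_ n x)%:E)) _ measurableT).
  - apply: le_trans (fatou m measurableT mE _) _; first by move=> n x _; rewrite lee_fin.
    rewrite limn_einf_lim; apply: lime_le; first exact: is_cvg_einfs.
    apply: nearW => n; apply: (@le_trans _ _ (\int[m]_x (f_ n x)%:E)%E).
      by apply: ereal_inf_lbound; exists n => /=.
    by rewrite RintE// lee_fin.
  - exact/measurable_EFinP.
  - apply: (@emeasurable_fun_cvg _ _ _ _ (fun n x => einfs (fun n => (f_ n x)%:E) n)).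
      exact: measurable_fun_einfs.
    by move=> x _; rewrite limn_einf_lim; exact: is_cvg_einfs.
  - apply: filterS hc => x hx _.
    by have [|-> _] := @cvg_limn_einf_sup R (fun n => (f_ n x)%:E) (f x)%:E; first exact: cvgn_EFin.
have i1 : RL1 f by apply: RL1_fin => //; exact: le_lt_trans le (ltry _).
by split=> //; rewrite -lee_fin -RintE.
Qed.

Lemma geom_sum_le (K : R) N : 0 <= K -> \sum_(0 <= n < N) K * 2^-1 ^+ n <= 2 * K.
Proof.
move=> K0; suff -> : \sum_(0 <= n < N) K * 2^-1 ^+ n = 2 * K - 2 * K * 2^-1 ^+ N.
  by rewrite gerBl !mulr_ge0// exprn_ge0// invr_ge0.
elim: N => [|N IH]; first by rewrite big_nil expr0 mulr1 subrr.
by rewrite big_nat_recr//= IH exprS; field.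
Qed.

(** The usual completeness argument: the sum of the absolute increments is integrable, hence finite
    a.e., and together with |s 0| it dominates the sequence. *)
Lemma L1_fast (s : nat -> T -> R) (K : R) : (forall n, RL1 (s n)) ->
  (forall n, Rint (fun x => `|s n.+1 x - s n x|) <= K * 2^-1 ^+ n) ->
  exists f, [/\ RL1 f, (\forall x \ae m, (fun n => s n x) @ \oo --> f x) &
    (fun n => Rint (fun x => `|s n x - f x|)) @ \oo --> (0 : R)].
Proof.
move=> is_ hs; pose d n x := `|s n.+1 x - s n x|.
have d0 n x : 0 <= d n x by exact: normr_ge0.
have id n : RL1 (d n) by apply: RL1_norm; exact: RL1B.
have md n : measurable_fun setT (fun x => (d n x)%:E) by apply/measurable_EFinP; exact: RL1_meas.
have K0 : 0 <= K.
  by have := hs 0%N; rewrite expr0 mulr1; apply: le_trans; apply: Rintegral_ge0.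
pose Phi x := (\sum_(0 <= n <oo) (d n x)%:E)%E.
have Phi0 x : (0 <= Phi x)%E by apply: nneseries_ge0 => n _ _; rewrite lee_fin.
have mPhi : measurable_fun setT Phi.
  apply: (@emeasurable_fun_cvg _ _ _ _ (fun N x => \sum_(0 <= n < N) (d n x)%:E)%E).
    by move=> N; apply: emeasurable_sum => n; exact: md.
  by move=> x _; apply: is_cvg_nneseries => n _ _; rewrite lee_fin.
have iPhi : (\int[m]_x Phi x <= (2 * K)%:E)%E.
  rewrite integral_nneseries//; last by move=> n x _; rewrite lee_fin.
  apply: lime_le; first by apply: is_cvg_nneseries => n _ _; apply: integral_ge0 => x _; rewrite lee_fin.
  apply: nearW => N; apply: le_trans (_ : (\sum_(0 <= n < N) (K * 2^-1 ^+ n)%:E <= _)%E).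
    by apply: lee_sum => n _; rewrite (RintE (id n)) lee_fin; exact: hs.
  by rewrite sumEFin lee_fin geom_sum_le.
have fPhi : \forall x \ae m, Phi x \is a fin_num.
  have : m.-integrable setT Phi.
    apply/integrableP; split=> //; under eq_integral do rewrite gee0_abs//.
    exact: le_lt_trans iPhi (ltry _).
  by move=> /integrable_ae -/(_ measurableT); apply: filterS => x; apply.
pose g x := `|s 0%N x| + fine (Phi x).
have ig : RL1 g.
  apply: RL1D; first exact: RL1_norm.
  apply: RL1_fin; first by apply: measurableT_comp => //; exact: fine_measurable.
    by move=> x; exact: fine_ge0.
  apply: le_lt_trans (ltry (2 * K)); apply: le_trans iPhi; apply: ge0_le_integral => //.
  - by move=> x _; rewrite lee_fin fine_ge0.
  - by apply/measurable_EFinP; apply: measurableT_comp => //; exact: fine_measurable.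
  - by move=> x _; have := Phi0 x; case: (Phi x).
have psum x N : Phi x \is a fin_num -> \sum_(0 <= n < N) d n x <= fine (Phi x).
  move=> fx; rewrite -lee_fin fineK// -sumEFin.
  by apply: nneseries_lim_ge => n _ _; rewrite lee_fin.
have sE n x : s n x = s 0%N x + \sum_(0 <= k < n) (s k.+1 x - s k x).
  by rewrite telescope_sumr// addrC subrK.
have dom n : \forall x \ae m, `|s n x| <= g x.
  apply: filterS fPhi => x fx; rewrite sE (le_trans (ler_normD _ _))// lerD2l.
  by rewrite (le_trans (ler_norm_sum _ _ _))// psum.
(* The upper limit is measurable everywhere, also on the null set where the sequence diverges. *)
pose f x := fine (limn_esup (fun n => (s n x)%:E)).
have cv : \forall x \ae m, (fun n => s n x) @ \oo --> f x.
  apply: filterS fPhi => x fx.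
  have : cvgn (fun n => s n x).
    have : cvgn [normed series (fun k => s k.+1 x - s k x)].
      apply: nondecreasing_is_cvgn.
        by apply/nondecreasing_seqP => n; rewrite /= /series /= big_nat_recr//= lerDl.
      by exists (fine (Phi x)) => _ [n _ <-]; exact: psum.
    move/normed_cvg => h; have -> : (fun n => s n x) = (fun n => s 0%N x + series (fun k => s k.+1 x - s k x) n).
      by apply/funext => n; rewrite sE.
    by apply: is_cvgD => //; exact: is_cvg_cst.
  move=> h; suff -> : f x = limn (fun n => s n x) by [].
  rewrite /f; have [|_ ->] := @cvg_limn_einf_sup R (fun n => (s n x)%:E) (limn (fun n => s n x))%:E => //.
  exact: cvgn_EFin.
have mf : measurable_fun setT f.
  apply: measurableT_comp; first exact: fine_measurable.
  by apply: measurable_fun_limn_esup => n; apply/measurable_EFinP; exact: RL1_meas.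
have [|i1 i2 _] := Rint_dct (fun n => RL1_meas (is_ n)) mf ig cv; first exact: dom.
by exists f.
Qed.

End l1_limits.

Section riesz_fischer.
Variable R : realType.
Local Notation C := R[i].
Local Notation T := (circle R).
Local Notation m := (@circle_leb R).
Local Notation L1 := (cintble m setT).
Local Notation RL1 u := (m.-integrable setT (fun x => (u x)%:E)).
Local Notation Rint := (Rintegral m setT).

Lemma fc_valX i j : fc (fun x : T => zeta x ^+ i) j = (i == j)%:R.
Proof.
have /orP[ij|ji] := leq_total i j.
- have E (x : T) : zeta x ^+ i * cj (zeta x) ^+ j = cj (zeta x ^+ (j - i)).
    by rewrite -(subnKC ij) exprD mulrA -exprMn val_valJ expr1n mul1r addKn conjcX.
  rewrite /fc (eq_cint _ (fun x _ => E x)).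
  have i1 : L1 (fun x : T => zeta x ^+ (j - i)).
    by apply: (cintble_bd (M := 1)); [apply: cmeasX; exact: cmeas_val|apply: nearW => x; rewrite nc_valX].
  rewrite (cintJ measurableT i1).
  have [->|ne] := eqVneq i j.
    by rewrite subnn; under eq_fun do rewrite expr0; rewrite cint_cst_circle conjc1.
  rewrite cint_char ?conjc0// subn_gt0 ltn_neqAle ne//.
- have E (x : T) : zeta x ^+ i * cj (zeta x) ^+ j = zeta x ^+ (i - j).
    by rewrite -{1}(subnK ji) exprD -mulrA -exprMn val_valJ expr1n mulr1.
  rewrite /fc (eq_cint _ (fun x _ => E x)).
  have [->|ne] := eqVneq i j.
    by rewrite subnn; under eq_fun do rewrite expr0; rewrite cint_cst_circle.
  by rewrite cint_char// subn_gt0 ltn_neqAle eq_sym ne.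
Qed.

Definition tp (c : nat -> C) n (x : T) := \sum_(k < n) c k * zeta x ^+ k.

Lemma valX_Loo n : Loo (fun x : T => zeta x ^+ n).
Proof.
split; first by apply: cmeasX; exact: cmeas_val.
by exists 1; apply: nearW => x; rewrite nc_valX.
Qed.

Lemma tp_Loo c n : Loo (tp c n).
Proof.
split.
  elim: n => [|n IH].
    by rewrite (_ : tp c 0 = fun=> 0); [exact: cmeas_cst|apply/funext => x; rewrite /tp big_ord0].
  rewrite (_ : tp c n.+1 = fun x => tp c n x + c n * zeta x ^+ n); last first.
    by apply/funext => x; rewrite /tp big_ord_recr.
  have h := cintble_meas (cintbleZ measurableT (c n) (Loo_L1 (valX_Loo n))).
  exact: (cmeasD IH h).
exists (\sum_(k < n) nc (c k)); apply: nearW => x; rewrite /tp.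
elim/big_ind2 : _ => [|a b a' b' h1 h2|k _]; first by rewrite nc0.
  by rewrite (le_trans (ncD _ _))// lerD.
by rewrite ncM nc_valX mulr1.
Qed.

Lemma tp_L1 c n : L1 (tp c n).
Proof. exact: (Loo_L1 (tp_Loo c n)). Qed.

Lemma tpS c n : tp c n.+1 = fun x => tp c n x + c n * zeta x ^+ n.
Proof. by apply/funext => x; rewrite /tp big_ord_recr. Qed.

Lemma fcD f g k : L1 f -> L1 g -> fc (fun x => f x + g x) k = fc f k + fc g k.
Proof.
move=> i1 i2; rewrite /fc -cintD//; [|exact: L1_valJX|exact: L1_valJX].
by congr cint; apply/funext => x; rewrite mulrDl.
Qed.

Lemma fcZ a f k : L1 f -> fc (fun x => a * f x) k = a * fc f k.
Proof.
move=> i1; rewrite /fc -cintZ//; last exact: L1_valJX.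
by congr cint; apply/funext => x; rewrite mulrA.
Qed.

Lemma fnD f g k : L1 f -> L1 g -> fn (fun x => f x + g x) k = fn f k + fn g k.
Proof.
move=> i1 i2; rewrite /fn -cintD//; [|exact: L1_valX|exact: L1_valX].
by congr cint; apply/funext => x; rewrite mulrDl.
Qed.

Lemma fnZ a f k : L1 f -> fn (fun x => a * f x) k = a * fn f k.
Proof.
move=> i1; rewrite /fn -cintZ//; last exact: L1_valX.
by congr cint; apply/funext => x; rewrite mulrA.
Qed.

Lemma fc_tp c n j : fc (tp c n) j = if (j < n)%N then c j else 0.
Proof.
elim: n => [|n IH].
  rewrite ltn0 (_ : tp c 0 = fun=> 0); last by apply/funext => x; rewrite /tp big_ord0.
  by rewrite /fc; under eq_fun do rewrite mul0r; rewrite cint0.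
have iX := Loo_L1 (valX_Loo n).
rewrite tpS fcD; [|exact: tp_L1|exact: cintbleZ].
rewrite fcZ// IH fc_valX; case: (ltngtP n j) => [nj|jn|->].
- by rewrite mulr0 addr0 ltnS leqNgt nj.
- by rewrite mulr0 addr0 ltnS ltnW.
- by rewrite mulr1 add0r ltnSn.
Qed.

Lemma fn_tp c n j : (0 < j)%N -> fn (tp c n) j = 0.
Proof.
move=> j0; elim: n => [|n IH].
  rewrite (_ : tp c 0 = fun=> 0); last by apply/funext => x; rewrite /tp big_ord0.
  by rewrite /fn; under eq_fun do rewrite mul0r; rewrite cint0.
have iX := Loo_L1 (valX_Loo n).
rewrite tpS fnD; [|exact: tp_L1|exact: cintbleZ].
rewrite fnZ// IH /fn; under eq_fun do rewrite -exprD.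
by rewrite cint_char ?mulr0 ?addr0// addn_gt0 j0 orbT.
Qed.

Lemma nc_sqrD (a b : C) : nc (a + b) ^+ 2 = nc a ^+ 2 + nc b ^+ 2 + 2 * Re (a * cj b).
Proof. by rewrite !sqr_nc ReM ReJ ImJ ReD ImD; ring. Qed.

Lemma Rint_Re f : Rint (fun x => Re (f x)) = Re (cint m setT f).
Proof. by []. Qed.

Lemma N2_addX (f : T -> C) d n : L2 f -> fc f n = 0 ->
  N2 (fun x => f x + d * zeta x ^+ n) = N2 f + nc d ^+ 2.
Proof.
move=> f2 fn0; have f1 := L2_L1 f2; have [_ i2] := f2.
have iJ : L1 (fun x => cj d * (f x * cj (zeta x) ^+ n)) by apply: cintbleZ => //; exact: L1_valJX.
have E x : nc (f x + d * zeta x ^+ n) ^+ 2 =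
    nc (f x) ^+ 2 + nc d ^+ 2 + 2 * Re (cj d * (f x * cj (zeta x) ^+ n)).
  by rewrite nc_sqrD ncM nc_valX mulr1 conjcM conjcX mulrCA.
rewrite /N2 (eq_Rintegral _ (fun x _ => E x)).
have [iR _] := iJ.
rewrite RintegralD//; [|exact: RL1D i2 (RL1_cst _)|exact: RL1Z].
rewrite RintegralD//; last exact: RL1_cst.
rewrite Rint_cst_circle RintegralZl// Rint_Re cintZ//; last exact: L1_valJX.
by rewrite -[cint _ _ _]/(fc f n) fn0 mulr0 mulr0 addr0.
Qed.

Lemma N2_tp c n : N2 (tp c n) = \sum_(k < n) nc (c k) ^+ 2.
Proof.
elim: n => [|n IH].
  rewrite big_ord0 (_ : tp c 0 = fun=> 0); last by apply/funext => x; rewrite /tp big_ord0.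
  by rewrite /N2 nc0 expr0n Rint_cst_circle.
rewrite tpS N2_addX; [by rewrite IH big_ord_recr|exact/Loo_L2/tp_Loo|by rewrite fc_tp ltnn].
Qed.

(* AM-GM: 2 q |f| <= q^2 + |f|^2. *)
Lemma N1_le_sqrt (f : T -> C) q : L2 f -> 0 < q -> N2 f <= q ^+ 2 -> N1 f <= q.
Proof.
move=> f2 q0 fq; have [_ i2] := f2; have i1 := L1_RL1 (L2_L1 f2).
rewrite -(ler_pM2l (_ : 0 < 2 * q)) ?mulr_gt0//.
rewrite /N1 -RintegralZl// (@le_trans _ _ (Rint (fun x => q ^+ 2 + nc (f x) ^+ 2)))//.
  apply: le_Rintegral => //; [exact: RL1Z|exact: RL1D (RL1_cst _) i2|].
  move=> x _; move: (nc _) => a; have := sqr_ge0 (q - a).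
  by rewrite sqrrB -mulrA -mulr_natl; lra.
rewrite RintegralD//; last exact: RL1_cst.
by rewrite Rint_cst_circle -/(N2 f) -mulrA -expr2 mulr_natl mulr2n lerD2l.
Qed.

(** A difference of two partial sums is written as a single trigonometric polynomial, to which
    [N2_tp] applies. *)
Definition cut (c : nat -> C) a k := if (k < a)%N then 0 else c k.

Lemma tp_cut c a b x : (a <= b)%N -> tp (cut c a) b x = tp c b x - tp c a x.
Proof.
move=> ab; apply/eqP; rewrite eq_sym subr_eq; apply/eqP; rewrite /tp /cut.
rewrite -(subnK ab) addnC !big_split_ord/= addrC.
rewrite [X in _ = X + _ + _]big1 ?add0r => [|i _]; last by rewrite ltn_ord mul0r.
congr (_ + _); apply: eq_bigr => i _.
by rewrite ltnNge leq_addr.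
Qed.

Lemma sum_cut c a b : (a <= b)%N ->
  \sum_(k < b) nc (cut c a k) ^+ 2 = \sum_(k < b) nc (c k) ^+ 2 - \sum_(k < a) nc (c k) ^+ 2.
Proof.
move=> ab; apply/eqP; rewrite eq_sym subr_eq; apply/eqP; rewrite /cut.
rewrite -(subnK ab) addnC !big_split_ord/= addrC.
rewrite [X in _ = X + _ + _]big1 ?add0r => [|i _]; last by rewrite ltn_ord nc0 expr0n.
congr (_ + _); apply: eq_bigr => i _.
by rewrite ltnNge leq_addr.
Qed.

(** The subsequence makes consecutive L^2 distances at most 2^(-j), the rate required by [L1_fast];
    [j < n_ j] ensures that every coefficient is eventually frozen. *)
Lemma fast_tails (A : nat -> R) B : (forall n, A n <= A n.+1) -> (forall n, A n <= B) ->
  exists n_ : nat -> nat, [/\ forall j, (j < n_ j)%N, forall j, (n_ j <= n_ j.+1)%N &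
    forall j, A (n_ j.+1) - A (n_ j) <= (2^-1 ^+ j) ^+ 2].
Proof.
move=> Ainc AB; have Amono : {homo A : a b / (a <= b)%N >-> a <= b}.
  by apply/nondecreasing_seqP.
have cA : cvgn A by apply: nondecreasing_is_cvgn => //; exists B => _ [n _ <-].
have lA n : A n <= limn A by apply: nondecreasing_cvgn_le.
have [|N NP] := @choice nat nat (fun j N => limn A - A N <= (2^-1 ^+ j) ^+ 2).
  move=> j.
  have e0 : 0 < (2^-1 ^+ j) ^+ 2 :> R by rewrite !exprn_gt0// invr_gt0.
  move/cvgrPdist_le: cA => /(_ _ e0)[N _ NP]; exists N.
  by have := NP N (leqnn N); apply: le_trans; exact: ler_norm.
(* Adding up the thresholds makes the indices increase, and the successor in each summand makes
   [n_ j] exceed [j]. *)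
pose n_ j := (\sum_(i < j.+1) (N i).+1)%N.
have n_S j : n_ j.+1 = (n_ j + (N j.+1).+1)%N by rewrite /n_ big_ord_recr.
have n_N j : (N j <= n_ j)%N by rewrite /n_ big_ord_recr/= addnS leqW// leq_addl.
exists n_; split.
- elim=> [|j IH]; first by rewrite /n_ big_ord_recr/= addnS.
  by rewrite n_S addnS ltnS (leq_trans IH)// leq_addr.
- by move=> j; rewrite n_S leq_addr.
- move=> j; apply: le_trans (NP j); apply: lerB; first exact: lA.
  exact: Amono.
Qed.

Theorem riesz_fischer (c : nat -> C) B : (forall n, \sum_(k < n) nc (c k) ^+ 2 <= B) ->
  exists a : T -> C, [/\ L2 a, forall k, fc a k = c k & forall k, (0 < k)%N -> fn a k = 0].
Proof.
move=> cB; pose A n := \sum_(k < n) nc (c k) ^+ 2.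
have [|n_ [n_gt n_le n_A]] := @fast_tails A B _ cB.
  by move=> n; rewrite /A big_ord_recr lerDl sqr_ge0.
pose S j := tp c (n_ j).
have S1 j : L1 (S j) by exact: tp_L1.
have SD j : N1 (fun x => S j.+1 x - S j x) <= 1 * 2^-1 ^+ j.
  rewrite mul1r; have -> : (fun x => S j.+1 x - S j x) = tp (cut c (n_ j)) (n_ j.+1).
    by apply/funext => x; rewrite tp_cut.
  apply: N1_le_sqrt; [exact/Loo_L2/tp_Loo|by rewrite exprn_gt0// invr_gt0|].
  by rewrite N2_tp sum_cut; [exact: n_A|exact: n_le].
have SD1 j : L1 (fun x => S j.+1 x - S j x) by exact: cintbleB.
have [|fr [ir cr lr]] := @L1_fast R (fun j x => Re (S j x)) 1 (fun j => (S1 j).1).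
  move=> j; apply: le_trans (SD j); apply: le_Rintegral => //.
  - by apply: RL1_norm; apply: RL1B; [exact: (S1 _).1|exact: (S1 _).1].
  - exact: L1_RL1.
  - by move=> x _; rewrite -ReB; exact: Re_le_nc.
have [|fi [ii ci li]] := @L1_fast R (fun j x => Im (S j x)) 1 (fun j => (S1 j).2).
  move=> j; apply: le_trans (SD j); apply: le_Rintegral => //.
  - by apply: RL1_norm; apply: RL1B; [exact: (S1 _).2|exact: (S1 _).2].
  - exact: L1_RL1.
  - by move=> x _; rewrite -ImB; exact: Im_le_nc.
pose a x := fr x +i* fi x.
have a1 : L1 a by [].
have Sa : (fun j => N1 (fun x => S j x - a x)) @ \oo --> (0 : R).
  apply: (@squeeze_cvgr _ _ _ _ (fun=> 0) (fun j => Rint (fun x => `|Re (S j x) - fr x|) +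
     Rint (fun x => `|Im (S j x) - fi x|))); [|exact: cvg_cst|by rewrite -[0]addr0; exact: cvgD].
  apply: nearW => j; rewrite N1_ge0/=.
  have i1 : RL1 (fun x => `|Re (S j x) - fr x|) by apply: RL1_norm; apply: RL1B => //; exact: (S1 _).1.
  have i2 : RL1 (fun x => `|Im (S j x) - fi x|) by apply: RL1_norm; apply: RL1B => //; exact: (S1 _).2.
  rewrite -RintegralD//; apply: le_Rintegral => //; first by apply: L1_RL1; apply: cintbleB.
    exact: RL1D.
  by move=> x _; rewrite (le_trans (nc_le_ReIm _))// ReB ImB.
exists a; split.
- split; first exact: (cintble_meas a1).
  have [||||||] := @Rint_fatou R (fun j x => nc (S j x) ^+ 2) (fun x => nc (a x) ^+ 2) B => //.
  + by move=> j; have [_] := Loo_L2 (tp_Loo c (n_ j)).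
  + by move=> j x; exact: sqr_ge0.
  + by move=> j; rewrite -[Rint _]/(N2 _) N2_tp.
  + by apply: meas_nc2; exact: (cintble_meas a1).
  + by move=> x; exact: sqr_ge0.
  + apply: filterS2 cr ci => x xr xi.
    under eq_fun do rewrite sqr_nc; rewrite sqr_nc.
    by apply: cvgD; exact: cvgM.
- move=> k; apply/eqP; rewrite eq_sym -subr_eq0 -nc_eq0; apply/eqP.
  have nX (x : T) : nc (cj (zeta x) ^+ k) <= 1 by rewrite nc_valJX.
  have mX : cmeas setT (fun x : T => cj (zeta x) ^+ k) by apply: cmeasX; exact: cmeas_valJ.
  have lim := N1_cvg_cint S1 a1 mX nX Sa.
  apply: cvgn_cst_eq; apply: cvg_trans lim; apply: near_eq_cvg; exists k => // j kj.
  rewrite -[cint m setT (fun x => S j x * _)]/(fc (S j) k) fc_tp.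
  by rewrite (leq_ltn_trans kj (n_gt j)).
- move=> k k0; apply/eqP; rewrite -nc_eq0; apply/eqP.
  have nX (x : T) : nc (zeta x ^+ k) <= 1 by rewrite nc_valX.
  have mX : cmeas setT (fun x : T => zeta x ^+ k) by apply: cmeasX; exact: cmeas_val.
  have lim := N1_cvg_cint S1 a1 mX nX Sa.
  apply: cvgn_cst_eq; apply: cvg_trans lim; apply: near_eq_cvg; exists k => // j kj.
  rewrite -[cint m setT (fun x => S j x * _)]/(fn (S j) k) fn_tp//.
  by rewrite sub0r ncN.
Qed.

Lemma bessel (u : T -> C) n : L2 u -> \sum_(k < n) nc (fc u k) ^+ 2 <= N2 u.
Proof.
move=> u2; have u1 := L2_L1 u2; pose c k := fc u k.
rewrite -[\sum_(k < n) _]/(\sum_(k < n) nc (c k) ^+ 2).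
(* The squared distance from [u] to its partial sum is computed exactly, one coefficient at a
   time. *)
suff H : N2 (fun x => u x - tp c n x) = N2 u - \sum_(k < n) nc (c k) ^+ 2.
  by rewrite -subr_ge0 -H; apply: Rintegral_ge0 => x _; exact: sqr_ge0.
elim: n => [|n IH].
  by rewrite big_ord0 subr0 (_ : (fun x => u x - _) = u)//; apply/funext => x; rewrite /tp big_ord0 subr0.
have -> : (fun x => u x - tp c n.+1 x) = fun x => (u x - tp c n x - c n * zeta x ^+ n).
  by apply/funext => x; rewrite tpS opprD addrA.
pose v x := u x - tp c n x.
have v2 : L2 v.
  split; first by apply: cmeasB => //; [exact: u2.1|exact: (tp_Loo c n).1].
  have [B BP] := (tp_Loo c n).2.
  apply: (@ae_integrable_le _ _ _ _ _ (fun x => 2 * nc (u x) ^+ 2 + 2 * B ^+ 2)).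
  - apply: meas_nc2; apply: cmeasB => //; [exact: u2.1|exact: (tp_Loo c n).1].
  - by apply: RL1D; [apply: RL1Z; exact: u2.2|exact: RL1_cst].
  - apply: filterS BP => x xB; rewrite ger0_norm ?sqr_ge0// -mulrDr.
    have h1 : nc (v x) ^+ 2 <= (nc (u x) + B) ^+ 2.
      rewrite lerXn2r ?nnegrE ?addr_ge0 ?(le_trans _ xB)//.
      by rewrite (le_trans (ncB _ _))// lerD2l.
    by apply: le_trans h1 _; have := sqr_ge0 (nc (u x) - B); rewrite sqrrB sqrrD; lra.
have vn : fc v n = c n.
  have -> : v = fun x => u x + (-1) * tp c n x by apply/funext => x; rewrite mulN1r.
  rewrite fcD ?fcZ//; [|exact: tp_L1|exact: (cintbleZ measurableT _ (tp_L1 c n))].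
  by rewrite fc_tp ltnn mulr0 addr0.
have [mv i2] := v2; have v1 := L2_L1 v2.
have E x : nc (v x - c n * zeta x ^+ n) ^+ 2 =
    nc (v x) ^+ 2 + nc (c n) ^+ 2 - 2 * Re (cj (c n) * (v x * cj (zeta x) ^+ n)).
  rewrite nc_sqrD ncN ncM nc_valX mulr1 conjcN conjcM conjcX mulrN ReN mulrN.
  by rewrite mulrCA.
have iJ : L1 (fun x => cj (c n) * (v x * cj (zeta x) ^+ n)) by apply: cintbleZ => //; exact: L1_valJX.
have [iR _] := iJ.
transitivity (N2 v + nc (c n) ^+ 2 - 2 * nc (c n) ^+ 2); last first.
  have -> : \sum_(k < n.+1) nc (c k) ^+ 2 = \sum_(k < n) nc (c k) ^+ 2 + nc (c n) ^+ 2.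
    by rewrite big_ord_recr.
  rewrite [N2 v]IH; move: (N2 u) (\sum_(k < n) _) (nc (c n) ^+ 2) => p q r; ring.
rewrite [LHS](eq_Rintegral _ (fun x _ => E x)).
rewrite RintegralB//; [|exact: RL1D i2 (RL1_cst _)|exact: RL1Z].
rewrite RintegralD//; last exact: RL1_cst.
rewrite Rint_cst_circle RintegralZl// Rint_Re cintZ//; last exact: L1_valJX.
by rewrite -[cint _ _ _]/(fc v n) vn [X in Re X]mulrC mulcJ.
Qed.

(** The Riesz projection onto H^2: coefficients of nonnegative index are kept, those of negative
    index become 0. *)
Lemma proj_exists u : L2 u ->
  exists a : T -> C, [/\ L2 a, forall k, fc a k = fc u k & forall k, (0 < k)%N -> fn a k = 0].
Proof. by move=> u2; apply: (@riesz_fischer (fc u) (N2 u)) => n; exact: bessel. Qed.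

End riesz_fischer.

(** * The annihilator of the model space *)

Section annihilator.
Variable R : realType.
Local Notation C := R[i].
Local Notation T := (circle R).
Local Notation m := (@circle_leb R).
Local Notation cintm := (cint m setT).
Local Notation L1 := (cintble m setT).
Local Notation RL1 u := (m.-integrable setT (fun x => (u x)%:E)).
Local Notation Rint := (Rintegral m setT).
Implicit Types f g h : T -> C.

Lemma sqr_normD (a b : R) : (a + b) ^+ 2 <= 2 * a ^+ 2 + 2 * b ^+ 2.
Proof. by have := sqr_ge0 (a - b); rewrite sqrrB sqrrD; lra. Qed.

Lemma L2D f g : L2 f -> L2 g -> L2 (fun x => f x + g x).
Proof.
move=> [mf i1] [mg i2]; have mfg := cmeasD mf mg; split=> //.
apply: (ae_integrable_le (meas_nc2 mfg) (RL1D (RL1Z 2 i1) (RL1Z 2 i2))).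
apply: nearW => x; rewrite ger0_norm ?sqr_ge0//.
by apply: le_trans (sqr_normD _ _); rewrite lerXn2r ?nnegrE ?addr_ge0 ?ncD.
Qed.

Lemma L2_mulbd f h : L2 f -> Loo h -> L2 (fun x => h x * f x).
Proof.
move=> [mf i1] [mh [M hM]]; have mhf := cmeasM mh mf; split=> //.
apply: (ae_integrable_le (meas_nc2 mhf) (RL1Z (M ^+ 2) i1)).
apply: filterS hM => x xM; rewrite ger0_norm ?sqr_ge0// ncM exprMn ler_wpM2r ?sqr_ge0//.
by rewrite lerXn2r ?nnegrE// (le_trans _ xM).
Qed.

Lemma Loo_cst (a : C) : Loo (fun=> a : C).
Proof. by split; [exact: cmeas_cst|exists (nc a); exact: nearW]. Qed.

Lemma L2Z a f : L2 f -> L2 (fun x => a * f x).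
Proof. by move=> f2; apply: L2_mulbd => //; exact: Loo_cst. Qed.

Lemma L2B f g : L2 f -> L2 g -> L2 (fun x => f x - g x).
Proof.
move=> f2 g2; have := L2D f2 (L2Z (-1) g2).
by under [X in L2 X -> _]eq_fun do rewrite mulN1r.
Qed.

Lemma L2J f : L2 f -> L2 (fun x => cj (f x)).
Proof. by move=> [mf i1]; split; [exact: cmeasJ|under eq_fun do rewrite ncJ]. Qed.

Lemma LooJ f : Loo f -> Loo (fun x => cj (f x)).
Proof.
move=> [mf [M fM]]; split; first exact: cmeasJ.
by exists M; apply: filterS fM => x; rewrite ncJ.
Qed.

Lemma fnB f g k : L1 f -> L1 g -> fn (fun x => f x - g x) k = fn f k - fn g k.
Proof.
move=> i1 i2; rewrite /fn -cintB//; [|exact: L1_valX|exact: L1_valX].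
by congr cint; apply/funext => x; rewrite mulrBl.
Qed.

Lemma fcB f g k : L1 f -> L1 g -> fc (fun x => f x - g x) k = fc f k - fc g k.
Proof.
move=> i1 i2; rewrite /fc -cintB//; [|exact: L1_valJX|exact: L1_valJX].
by congr cint; apply/funext => x; rewrite mulrBl.
Qed.

Lemma fnJ f k : L1 f -> fn (fun x => cj (f x)) k = cj (fc f k).
Proof.
move=> i1; rewrite /fc -cintJ//; last exact: L1_valJX.
by congr cint; apply/funext => x; rewrite conjcM conjcX conjcK.
Qed.

Lemma fcJ f k : L1 f -> fc (fun x => cj (f x)) k = cj (fn f k).
Proof.
move=> i1; rewrite /fn -cintJ//; last exact: L1_valX.
by congr cint; apply/funext => x; rewrite conjcM conjcX.
Qed.

Lemma fn_cst (a : C) k : (0 < k)%N -> fn (fun=> a) k = 0.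
Proof.
move=> k0; rewrite /fn (cintZ measurableT _ (Loo_L1 (valX_Loo R k))).
by rewrite cint_char// mulr0.
Qed.

Lemma fn0E f : fn f 0 = cintm f.
Proof. by congr cint; apply/funext => x; rewrite expr0 mulr1. Qed.

Lemma fc0E f : fc f 0 = cintm f.
Proof. by congr cint; apply/funext => x; rewrite expr0 mulr1. Qed.

Lemma Rint_sqr0 f : L2 f -> N2 f = 0 -> \forall x \ae m, f x = 0.
Proof.
move=> [mf i2] f0; have := RintE i2; rewrite -/(N2 f) f0.
have E : (\int[m]_x (nc (f x) ^+ 2)%:E = \int[m]_x `|(nc (f x) ^+ 2)%:E|)%E.
  by apply: eq_integral => x _; rewrite abse_EFin ger0_norm ?sqr_ge0.
rewrite E => /(ae_eq_integral_abs m measurableT (measurable_int _ i2)).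
apply: filterS => x h; have Tx : [set: T] x by [].
by move: (h Tx) => -[] /eqP; rewrite sqrf_eq0 nc_eq0 => /eqP.
Qed.

Lemma cint_sqr f : L2 f -> cintm (fun x => f x * cj (f x)) = (N2 f)%:C.
Proof.
by move=> _; under eq_cint do rewrite mulcJ; rewrite cintR.
Qed.

(** Strip one factor [zeta] from f, multiply in H^2, and read the integral as a coefficient of
    negative index of the product. *)
Lemma int_mul0 f g : L2 f -> (forall k, fn f k = 0) -> L2 g ->
  (forall k, (0 < k)%N -> fn g k = 0) -> cintm (fun x => f x * g x) = 0.
Proof.
move=> f2 fk g2 gk; have f1 := L2_L1 f2.
have vJ : Loo (fun x : T => cj (zeta x)).
  by split; [exact: cmeas_valJ|exists 1; apply: nearW => x; rewrite nc_valJ].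
pose f' x := cj (zeta x) * f x; have f'2 : L2 f' by exact: L2_mulbd.
have f'k k : (0 < k)%N -> fn f' k = 0.
  case: k => [//|k _]; rewrite -(fn_shift f' k) -[RHS](fk k); apply: eq_cint => x _.
  by rewrite mulrA val_valJ mul1r.
have := fn_mul2 f'2 f'k g2 gk (ltn0Sn 0); rewrite /fn => E; rewrite -[RHS]E.
congr cint; apply/funext => x; rewrite expr1 /f'.
have := val_valJ x; move: (zeta x : C) (cj (zeta x)) (f x) (g x) => p q r s pq.
by transitivity ((p * q) * (r * s)); [rewrite pq mul1r|ring].
Qed.

Section inner.
Variable I : T -> C.
Hypothesis I2 : L2 I.
Hypothesis Ik : forall k, (0 < k)%N -> fn I k = 0.
Hypothesis I1 : \forall x \ae m, nc (I x) = 1.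

Lemma I_Loo : Loo I.
Proof. by split; [exact: I2.1|exists 1; apply: filterS I1 => x ->]. Qed.

Lemma IJ1 : \forall x \ae m, I x * cj (I x) = 1.
Proof. by apply: filterS I1 => x h; rewrite mulcJ h expr1n. Qed.

(** The equality case of |mean| <= 1: the integral of |I - i0|^2 is 1 + 1 - 2 = 0. It covers the
    degenerate case of constant I in [annihilator_split]. *)
Lemma I_mean1 : nc (cintm I) = 1 -> \forall x \ae m, I x = cintm I.
Proof.
move=> h; set i0 := cintm I; have d2 : L2 (fun x => I x - i0) by apply: L2B => //; exact/Loo_L2/Loo_cst.
have i1 := L2_L1 I2.
suff /(Rint_sqr0 d2) : N2 (fun x => I x - i0) = 0.
  by apply: filterS => x /eqP; rewrite subr_eq0 => /eqP.
have E x : nc (I x - i0) ^+ 2 = nc (I x) ^+ 2 + 1 - 2 * Re (cj i0 * I x).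
  by rewrite nc_sqrD ncN h conjcN mulrN ReN mulrN expr1n [cj _ * _]mulrC.
have iZ : L1 (fun x => cj i0 * I x) by exact: cintbleZ.
rewrite /N2 (eq_Rintegral _ (fun x _ => E x)) RintegralB//; last 2 first.
- by apply: RL1D; [exact: I2.2|exact: RL1_cst].
- by apply: RL1Z; exact: iZ.1.
rewrite RintegralD//; [|exact: I2.2|exact: RL1_cst].
rewrite Rint_cst_circle RintegralZl//; last exact: iZ.1.
rewrite Rint_Re cintZ// -/i0 [cj i0 * i0]mulrC mulcJ h.
have -> : Rint (fun x => nc (I x) ^+ 2) = 1.
  rewrite -[RHS](Rint_cst_circle (1 : R)); apply: ae_eq_Rint.
  - by apply: meas_nc2; exact: I2.1.
  - exact: measurable_cst.
  - by apply: filterS I1 => x ->; rewrite expr1n.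
by rewrite expr1n -[Re _]/(1 : R); clear; ring.
Qed.

(* Write v = a + conj c and let e be the component of c orthogonal to I H^2.  As e
   need not vanish at 0, it is corrected by a multiple of 1 - conj i0 * I, which is
   I * conj (I - i0), with i0 the mean of I. *)
Lemma annihilator_split v : Loo v ->
  (forall f h, L2 f -> (forall k, fn f k = 0) -> L2 h -> (forall k, fn h k = 0) ->
     (\forall x \ae m, f x = I x * cj (h x)) -> cintm (fun x => f x * v x) = 0) ->
  exists a b, [/\ L2 a /\ (forall k, (0 < k)%N -> fn a k = 0),
    L2 b /\ (forall k, (0 < k)%N -> fn b k = 0) &
    \forall x \ae m, v x = a x + cj (I x * b x)].
Proof.
move=> voo vK; have v2 := Loo_L2 voo; have v1 := L2_L1 v2; have i1 := L2_L1 I2.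
have [a [a2 ac an]] := proj_exists v2; have a1 := L2_L1 a2.
pose c x := cj (v x - a x); have c2 : L2 c by exact/L2J/L2B.
have c1 := L2_L1 c2.
have cn k : fn c k = 0.
  by rewrite /c fnJ ?fcB ?ac ?subrr ?conjc0//; exact: L2_L1 (L2B v2 a2).
(* Multiplication by I is isometric, so I times the Riesz projection [b] of conj I * c is the
   projection of c on I H^2; the part [e] left over equals I conj h. *)
pose d x := cj (I x) * c x; have d2 : L2 d by apply: L2_mulbd => //; exact/LooJ/I_Loo.
have [b [b2 bc bn]] := proj_exists d2; have b1 := L2_L1 b2; have d1 := L2_L1 d2.
pose h x := cj (d x - b x); have h2 : L2 h by exact/L2J/L2B.
have h1 := L2_L1 h2.
have hn k : fn h k = 0.
  by rewrite /h fnJ ?fcB ?bc ?subrr ?conjc0//; exact: L2_L1 (L2B d2 b2).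
pose e x := c x - I x * b x.
have Ib2 : L2 (fun x => I x * b x) by apply: L2_mulbd => //; exact: I_Loo.
have e2 : L2 e by exact: L2B.
have e1 := L2_L1 e2.
have en k : (0 < k)%N -> fn e k = 0.
  move=> k0; rewrite fnB//; last exact: L2_L1.
  by rewrite cn (fn_mul2 I2 Ik b2 bn k0) subrr.
have eh : \forall x \ae m, e x = I x * cj (h x).
  by apply: filterS IJ1 => x Ix; rewrite /h conjcK /d mulrBr mulrA Ix mul1r.
pose i0 := cintm I.
(* [lam] makes the mean of e - lam (1 - conj i0 * I) vanish. If |i0| = 1 that correction has mean 0,
   but then I is constant and e has mean 0 already. *)
have [lam lamE] : exists lam, cintm e = lam * (1 - cj i0 * i0).
  have [n1|n1] := eqVneq (nc i0) 1; last first.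
    exists (cintm e / (1 - cj i0 * i0)); rewrite divfK// mulrC mulcJ subr_eq0 eq_sym.
    apply: contra n1 => /eqP/(congr1 (@complex.Re R)) /= E.
    by rewrite -(@pexpr_eq1 _ _ 2)// E.
  exists 0; rewrite mul0r -(cint_cst_circle 0).
  transitivity (cintm (fun x => i0 * cj (h x))).
    apply: ae_eq_cint; [exact: e2.1|exact: (L2Z i0 (L2J h2)).1|].
    by apply: filterS2 eh (I_mean1 n1) => x -> ->.
  rewrite cintZ//; last exact: cintbleJ.
  by rewrite cintJ// -fn0E hn conjc0 mulr0 cint0.
pose Jx x := 1 - cj i0 * I x.
have J2 : L2 Jx by apply: L2B; [exact/Loo_L2/Loo_cst|exact: L2Z].
have J1 := L2_L1 J2.
have c11 : L1 (fun=> 1 : C) by exact: cintble_cst_circle.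
have Jn k : fn Jx k = fn (fun=> 1 : C) k - cj i0 * fn I k.
  by rewrite /Jx fnB ?fnZ//; exact: cintbleZ.
pose e' x := e x - lam * Jx x; have e'2 : L2 e' by apply: L2B => //; exact: L2Z.
have e'1 := L2_L1 e'2.
have e'n k : fn e' k = 0.
  rewrite fnB//; last exact: cintbleZ.
  rewrite fnZ// Jn; case: k => [|k]; last by rewrite en// fn_cst// Ik// mulr0 subr0 mulr0 subr0.
  by rewrite !fn0E cint_cst_circle lamE subrr.
(* The correction seen from the other side: as 1 - conj i0 * I = I conj (I - i0), subtracting its
   multiple from e subtracts this one from h, and the mean of I - i0 is 0. *)
pose h' x := h x - cj lam * (I x - i0).
have Ii2 : L2 (fun x => I x - i0) by apply: L2B => //; exact/Loo_L2/Loo_cst.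
have h'2 : L2 h' by apply: L2B => //; exact: L2Z.
have h'n k : fn h' k = 0.
  rewrite fnB//; last by apply: cintbleZ => //; exact: L2_L1.
  rewrite fnZ; last exact: L2_L1.
  rewrite fnB//; last exact: cintble_cst_circle.
  rewrite hn; case: k => [|k]; first by rewrite !fn0E cint_cst_circle subrr mulr0 subr0.
  by rewrite (Ik (ltn0Sn k)) fn_cst// !subrr mulr0 subrr.
have e'h' : \forall x \ae m, e' x = I x * cj (h' x).
  apply: filterS2 eh IJ1 => x ex Ix.
  have -> : cj (h' x) = cj (h x) - lam * (cj (I x) - cj i0).
    by rewrite /h' conjcB conjcM (conjcK lam) conjcB.
  rewrite /e' ex /Jx; move: (I x) (cj (I x)) (cj (h x)) (cj i0) Ix => p q r s pq.
  by rewrite -[in LHS]pq; ring.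
have key := vK _ _ e'2 e'n h'2 h'n e'h'.
have vE x : v x = a x + cj (c x) by rewrite conjcK addrC subrK.
have cE x : c x = e' x + (lam + I x * (b x - lam * cj i0)).
  rewrite /e' /Jx /e; move: (c x) (I x) (b x) (cj i0) => p r s t; ring.
pose b' x := b x - lam * cj i0.
have b'2 : L2 b' by apply: L2B => //; exact/Loo_L2/Loo_cst.
have b'n k : (0 < k)%N -> fn b' k = 0.
  move=> k0; rewrite fnB//; last exact: cintble_cst_circle.
  by rewrite (bn _ k0) (fn_cst _ k0) subrr.
have a'2 : L2 (fun x => a x + cj lam) by apply: L2D => //; exact/Loo_L2/Loo_cst.
have a'n k : (0 < k)%N -> fn (fun x => a x + cj lam) k = 0.
  move=> k0; rewrite fnD//; last exact: cintble_cst_circle.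
  by rewrite (an _ k0) (fn_cst _ k0) addr0.
have e'0 : \forall x \ae m, e' x = 0.
  apply: (Rint_sqr0 e'2).
  have t1 := int_mul0 e'2 e'n a'2 a'n.
  have t2 := int_mul0 h'2 h'n b'2 b'n.
  have m1 := L2_mul e'2 a'2; have m2 := L2_mul h'2 b'2; have m3 := L2_mul e'2 (L2J e'2).
  (* This integrand equals e' v a.e. Its first two terms have mean zero by [int_mul0], so only the
     integral of |e'|^2 remains, and it must be 0. *)
  have : cintm (fun x => e' x * (a x + cj lam) + cj (h' x * b' x) + e' x * cj (e' x)) = 0.
    rewrite -[RHS]key; apply: ae_eq_cint.
    - apply: cmeasD; last exact: (cintble_meas m3).
      by apply: cmeasD; [exact: (cintble_meas m1)|apply: cmeasJ; exact: (cintble_meas m2)].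
    - by apply: cmeasM; [exact: e'2.1|exact: v2.1].
    apply: filterS2 e'h' IJ1 => x ex Ix.
    have -> : cj (h' x * b' x) = e' x * cj (I x * b' x).
      rewrite ex !conjcM; move: Ix; move: (I x) (cj (I x)) (cj (h' x)) (cj (b' x)) => p r s t pr.
      by transitivity ((p * r) * (s * t)); [rewrite pr mul1r|ring].
    rewrite vE cE !conjcD -/(b' x) !mulrDr.
    move: (e' x * a x) (e' x * cj lam) (e' x * cj (I x * b' x)) (e' x * cj (e' x)) => p1 p2 p3 p4.
    by ring.
  have m12 := cintbleD measurableT m1 (cintbleJ measurableT m2).
  rewrite (cintD measurableT m12 m3) (cintD measurableT m1 (cintbleJ measurableT m2)).
  rewrite (cintJ measurableT m2) t1 t2 conjc0 !add0r cint_sqr//.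
  by move/(congr1 (@complex.Re R)).
exists (fun x => a x + cj lam), b'; split=> //.
apply: filterS e'0 => x ex0; rewrite vE cE ex0 add0r conjcD addrA //.
Qed.

End inner.
End annihilator.

(** * The damping map on the cross *)

Section damping.
Variable R : realType.
Local Notation C := R[i].
Variables (eps c : R).
Hypotheses (e0 : 0 < eps) (ec : 36 * (eps * c ^+ 4) <= 1).

(** With exponent 2 the denominator could vanish on the vertical arm; with 4 it is bounded below on
    both arms, and the map commutes with multiplication by 'i because the fourth power of 'i is
    1. *)
Definition damp (z : C) : C := z / (1 + eps%:C * z ^+ 4).
Definition cross (z : C) := `|Re z| <= c \/ `|Im z| <= c.

Lemma Re_z4 (z : C) : Re (z ^+ 4) = Re z ^+ 4 - 6 * (Re z * Im z) ^+ 2 + Im z ^+ 4.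
Proof.
rewrite (_ : z ^+ 4 = (z * z) * (z * z)); last by rewrite !exprS expr0; ring.
by rewrite !ReM !ImM; move: (Re z) (Im z) => x y; ring.
Qed.

Lemma nc_z4 (z : C) : nc z ^+ 4 = (Re z ^+ 2 + Im z ^+ 2) ^+ 2.
Proof. by rewrite -sqr_nc -exprM. Qed.

Lemma den_real (x y : R) : `|x| <= c ->
  (1 + eps * (x ^+ 2 + y ^+ 2) ^+ 2) / 4 <= 1 + eps * (x ^+ 4 - 6 * (x * y) ^+ 2 + y ^+ 4).
Proof.
move=> xc; have x4 : x ^+ 4 <= c ^+ 4.
  rewrite -[leLHS](ger0_norm (exprn_even_ge0 x (isT : ~~ odd 4))) normrX.
  by rewrite lerXn2r ?nnegrE// (le_trans _ xc).
have h1 : eps * x ^+ 4 <= eps * c ^+ 4 by rewrite ler_wpM2l// ltW.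
(* Four times the difference of the two sides is 3 + eps (3 x^4 - 26 x^2 y^2 + 3 y^4). Completing
   this square leaves 3 - (160/3) eps x^4, which is nonnegative as 36 eps x^4 <= 1. *)
have h2 := mulr_ge0 (ltW e0) (sqr_ge0 (3 * y ^+ 2 - 13 * x ^+ 2)).
have h3 := mulr_ge0 (ltW e0) (sqr_ge0 (x ^+ 2)).
move: ec h1 h2 h3; clear; lra.
Qed.

Lemma den_ge z : cross z -> (1 + eps * nc z ^+ 4) / 4 <= nc (1 + eps%:C * z ^+ 4).
Proof.
move=> zc; apply: le_trans (le_trans (ler_norm _) (Re_le_nc _)).
have -> : Re (1 + eps%:C * z ^+ 4) = 1 + eps * Re (z ^+ 4).
  by rewrite ReD ReM /= mul0r subr0.
rewrite Re_z4 nc_z4; case: zc => h; first exact: den_real.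
have := den_real (Re z) h; rewrite [Im z * Re z]mulrC [Im z ^+ 2 + _]addrC.
by rewrite (_ : Im z ^+ 4 - _ + Re z ^+ 4 = Re z ^+ 4 - 6 * (Re z * Im z) ^+ 2 + Im z ^+ 4)//; ring.
Qed.

Lemma den_pos z : 0 < 1 + eps * nc z ^+ 4.
Proof. by rewrite ltr_pwDl// mulr_ge0 ?exprn_ge0// ltW. Qed.

Lemma den_neq z : cross z -> 1 + eps%:C * z ^+ 4 != 0.
Proof.
by move=> zc; rewrite -nc_gt0 (lt_le_trans _ (den_ge zc))// divr_gt0// den_pos.
Qed.

Lemma le_1X4 (t : R) : t <= 1 + t ^+ 4.
Proof.
have := sqr_ge0 (t ^+ 2 - 2^-1); have := sqr_ge0 (t - 2^-1).
by rewrite !sqrrB -exprM; lra.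
Qed.

Lemma damp_bd z : cross z -> nc (damp z) <= 4 * (1 + eps^-1).
Proof.
move=> zc; have d0 : 0 < nc (1 + eps%:C * z ^+ 4) by rewrite nc_gt0 den_neq.
rewrite /damp ncM ncV ler_pdivrMr//.
apply: (@le_trans _ _ (4 * (1 + eps^-1) * ((1 + eps * nc z ^+ 4) / 4))); last first.
  by rewrite ler_wpM2l ?den_ge// mulr_ge0// addr_ge0// invr_ge0 ltW.
have -> : 4 * (1 + eps^-1) * ((1 + eps * nc z ^+ 4) / 4) = 1 + nc z ^+ 4 + (eps^-1 + eps * nc z ^+ 4).
  by field; rewrite gt_eqF.
have n0 := nc_ge0 z; rewrite -[leLHS]addr0 lerD//; last first.
  by rewrite addr_ge0 ?mulr_ge0 ?exprn_ge0 ?invr_ge0// ltW.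
exact: le_1X4.
Qed.

Lemma Re_div (z w : C) : Re (z / w) = Re (z * cj w) / nc w ^+ 2.
Proof.
have [->|w0] := eqVneq w 0; first by rewrite invr0 conjc0 mulr0 mul0r.
have -> : z / w = z * cj w * ((nc w ^+ 2)^-1)%:C.
  have w1 : cj w != 0 by rewrite conjc_eq0.
  by rewrite rcV -mulcJ; field; rewrite w0 w1.
by rewrite ReM [Im _%:C]/= mulr0 subr0.
Qed.

(** The bound is uniform in eps, as dominated convergence will need. [Re z] factors out of the real
    part of z conj (denominator); what remains is at most 3 (1 + eps |z|^4), and the squared lower
    bound of the denominator brings a factor 16. *)
Lemma Re_damp z : `|Re z| <= c -> `|Re (damp z)| <= 48 * `|Re z|.
Proof.
move=> zc; have zx : cross z by left.
have p := den_pos z; have dg := den_ge zx.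
have d0 : 0 < nc (1 + eps%:C * z ^+ 4) by rewrite nc_gt0 den_neq.
rewrite /damp Re_div normrM normfV (ger0_norm (sqr_ge0 _)) ler_pdivrMr ?exprn_gt0//.
apply: (@le_trans _ _ (48 * `|Re z| * ((1 + eps * nc z ^+ 4) / 4) ^+ 2)); last first.
  by rewrite ler_wpM2l ?mulr_ge0// lerXn2r ?nnegrE ?divr_ge0// ltW.
have -> : Re (z * cj (1 + eps%:C * z ^+ 4)) =
    Re z * (1 + eps * (Re z ^+ 2 + Im z ^+ 2) * (Re z ^+ 2 - 3 * Im z ^+ 2)).
  rewrite conjcD conjcM conjcX conjcR conjc1 (_ : cj z ^+ 4 = (cj z * cj z) * (cj z * cj z)); last first.
    by rewrite !exprS expr0; ring.
  rewrite !(ReM, ImM, ReD, ImD, ReJ, ImJ) /=; move: (Re z) (Im z) => x y; ring.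
rewrite normrM [48 * _]mulrC -[leRHS]mulrA ler_wpM2l//.
rewrite nc_z4; move: (Re z) (Im z) => x y.
have h1 := mulr_ge0 (ltW e0) (sqr_ge0 (x ^+ 2 + y ^+ 2)).
have h2 : `|1 + eps * (x ^+ 2 + y ^+ 2) * (x ^+ 2 - 3 * y ^+ 2)| <= 3 * (1 + eps * (x ^+ 2 + y ^+ 2) ^+ 2).
  have x0 := sqr_ge0 x; have y0 := sqr_ge0 y.
  have a0 := mulr_ge0 (ltW e0) (addr_ge0 x0 y0).
  have a1 := mulr_ge0 a0 x0; have a2 := mulr_ge0 a0 y0.
  rewrite ler_norml; apply/andP; split; move: a1 a2; clear; lra.
apply: (le_trans h2); move: (eps * _) h1 => q q0.
by have := mulr_ge0 q0 q0; lra.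
Qed.

Lemma damp_i z : damp ('i * z) = 'i * damp z.
Proof.
rewrite /damp exprMn (_ : ('i : C) ^+ 4 = 1) ?mul1r ?mulrA//.
by rewrite (exprM 'i 2 2) sqr_i sqrrN expr1n.
Qed.

Lemma Re_iM (z : C) : Re ('i * z) = - Im z.
Proof. by case: z => a b; rewrite ReM /= mul0r mul1r sub0r. Qed.

Lemma Im_damp z : `|Im z| <= c -> `|Im (damp z)| <= 48 * `|Im z|.
Proof.
move=> zc; have := @Re_damp ('i * z); rewrite Re_iM normrN => /(_ zc).
by rewrite damp_i Re_iM normrN.
Qed.

(** The divided difference of [damp]. It keeps the factor s - d explicit, which is 2 I b in the
    application, so that divisibility by I is preserved. *)
Definition damp_slope (s d : C) := (1 - eps%:C * (s * d * (s ^+ 2 + s * d + d ^+ 2))) /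
  ((1 + eps%:C * s ^+ 4) * (1 + eps%:C * d ^+ 4)).

Lemma dampB s d : cross s -> cross d -> damp s - damp d = (s - d) * damp_slope s d.
Proof.
move=> /den_neq s0 /den_neq d0; rewrite /damp /damp_slope; field; apply/andP; split=> //.
Qed.

Lemma damp_slope_bd s d : cross s -> cross d -> nc (damp_slope s d) <= 48.
Proof.
move=> sc dc; have s0 := den_pos s; have d0 := den_pos d.
have sg0 := den_ge sc; have dg0 := den_ge dc.
have n1 : 0 < nc (1 + eps%:C * s ^+ 4) by rewrite nc_gt0 den_neq.
have n2 : 0 < nc (1 + eps%:C * d ^+ 4) by rewrite nc_gt0 den_neq.
rewrite /damp_slope ncM ncV ncM ler_pdivrMr ?mulr_gt0//.
apply: (@le_trans _ _ (48 * ((1 + eps * nc s ^+ 4) / 4 * ((1 + eps * nc d ^+ 4) / 4)))); last first.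
  by rewrite ler_wpM2l// ler_pM ?divr_ge0// ltW.
apply: (@le_trans _ _ (1 + eps * (nc s * nc d * (nc s ^+ 2 + nc s * nc d + nc d ^+ 2)))).
  rewrite (le_trans (ncB _ _))// nc1 lerD2l ncM ncR (ger0_norm (ltW e0)) ler_wpM2l ?(ltW e0)//.
  rewrite ncM ncM ler_wpM2l ?mulr_ge0//.
  apply: le_trans (ncD _ _) _; rewrite -!ncX lerD2r; apply: le_trans (ncD _ _) _.
  by rewrite -ncM.
have := nc_ge0 s; have := nc_ge0 d; move: (nc s) (nc d) => p q p0 q0.
have x1 := mulr_ge0 (ltW e0) (sqr_ge0 (p ^+ 2 - q ^+ 2)).
have x2 := mulr_ge0 (ltW e0) (sqr_ge0 (p ^+ 2 - p * q)).
have x3 := mulr_ge0 (ltW e0) (sqr_ge0 (q ^+ 2 - p * q)).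
have x4 := mulr_ge0 (mulr_ge0 (ltW e0) (sqr_ge0 (p ^+ 2))) (mulr_ge0 (ltW e0) (sqr_ge0 (q ^+ 2))).
have x5 := mulr_ge0 (ltW e0) (sqr_ge0 (p ^+ 2)).
have x6 := mulr_ge0 (ltW e0) (sqr_ge0 (q ^+ 2)).
move: x1 x2 x3 x4 x5 x6; clear; nra.
Qed.

Lemma damp_dist z : cross z -> nc (damp z - z) <= eps * (4 * nc z ^+ 5).
Proof.
move=> zc; have d0 := den_neq zc; have p := den_pos z; have dg := den_ge zc.
have n0 : 0 < nc (1 + eps%:C * z ^+ 4) by rewrite nc_gt0.
have -> : damp z - z = - (eps%:C * z ^+ 5) / (1 + eps%:C * z ^+ 4) by rewrite /damp; field.
rewrite ncM ncN ncV ncM ncR (ger0_norm (ltW e0)) ncX ler_pdivrMr// -mulrA ler_wpM2l ?(ltW e0)//.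
rewrite mulrAC ler_peMl ?exprn_ge0//.
have : 1 / 4 <= (1 + eps * nc z ^+ 4) / 4.
  by rewrite ler_wpM2r ?invr_ge0// lerDl mulr_ge0 ?exprn_ge0// ltW.
by move=> /le_trans/(_ dg); rewrite ler_pdivrMr// mulrC.
Qed.

Lemma holo_den (F : C -> C) z : holo F z -> holo (fun w => 1 + eps%:C * F w ^+ 4) z.
Proof.
by move=> hF; apply: holoD; [exact: holo_cst|apply: holoM; [exact: holo_cst|exact: holoX]].
Qed.

Lemma holo_damp (F : C -> C) z : holo F z -> cross (F z) -> holo (fun w => damp (F w)) z.
Proof.
move=> hF Fc; apply: (@holoM R F (fun w => (1 + eps%:C * F w ^+ 4)^-1) z hF).
by apply: holoV; [exact: den_neq|exact: holo_den].
Qed.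

Lemma holo_damp_slope (F G : C -> C) z : holo F z -> holo G z -> cross (F z) -> cross (G z) ->
  holo (fun w => damp_slope (F w) (G w)) z.
Proof.
move=> hF hG Fc Gc; apply: (@holoM R (fun w => 1 - eps%:C * (F w * G w * (F w ^+ 2 + F w * G w + G w ^+ 2)))
  (fun w => ((1 + eps%:C * F w ^+ 4) * (1 + eps%:C * G w ^+ 4))^-1)).
  apply: holoB; first exact: holo_cst.
  apply: holoM; first exact: holo_cst.
  apply: holoM; first exact: holoM.
  by apply: holoD; [apply: holoD; [exact: holoX|exact: holoM]|exact: holoX].
apply: holoV; first by rewrite mulf_neq0 ?den_neq.
by apply: holoM; exact: holo_den.
Qed.

End damping.

(** * Elements of Q annihilate the model space *)

Section quotient_annihilates.
Variable R : realType.
Local Notation C := R[i].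
Local Notation T := (circle R).
Local Notation m := (@circle_leb R).
Local Notation cintm := (cint m setT).
Local Notation L1 := (cintble m setT).
Local Notation RL1 u := (m.-integrable setT (fun x => (u x)%:E)).
Local Notation Rint := (Rintegral m setT).
Implicit Types f g h : T -> C.

(** The inverse is the conjugate times exp (- ln |f|^2), which is also right at zeros of f, where
    both sides are 0. *)
Lemma cmeasV f : cmeas setT f -> cmeas setT (fun x => (f x)^-1).
Proof.
move=> mf; pose q x := expR (- ln (nc (f x) ^+ 2)).
have mq : measurable_fun setT q.
  apply: measurableT_comp; first exact: measurable_expR.
  apply: measurable_funN; apply: measurableT_comp; first exact: measurable_ln.
  exact: meas_nc2.
have E x : (f x)^-1 = cj (f x) * (q x)%:C.
  have [->|f0] := eqVneq (f x) 0; first by rewrite invr0 conjc0 mul0r.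
  have n0 : 0 < nc (f x) ^+ 2 by rewrite exprn_gt0// nc_gt0.
  have j0 : cj (f x) != 0 by rewrite conjc_eq0.
  by rewrite /q expRN lnK ?posrE// rcV -mulcJ; field; rewrite f0 j0.
by rewrite (funext E); apply: cmeasM; [exact: cmeasJ|exact: cmeasR].
Qed.

Lemma cmeas_damp eps f : cmeas setT f -> cmeas setT (fun x => damp eps (f x)).
Proof.
move=> mf; apply: (cmeasM mf); apply: cmeasV; apply: cmeasD; first exact: cmeas_cst.
by apply: cmeasM; [exact: cmeas_cst|exact: cmeasX].
Qed.

Lemma nc_Poi_bd f M z : L1 f -> (\forall x \ae m, nc (f x) <= M) -> nc z < 1 -> nc (Poi f z) <= M.
Proof.
move=> i1 fM z1; apply: le_trans (nc_Poi i1 z1) _; rewrite -[leRHS](Pr_cst M z1).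
by apply: le_Pr => //; [exact: L1_RL1|exact: RL1_cst].
Qed.

Lemma normr_Pr_ae (u : T -> R) c z : RL1 u -> (\forall x \ae m, `|u x| <= c) -> nc z < 1 ->
  `|Pr u z| <= c.
Proof.
move=> iu uc z1; rewrite (le_trans (normr_Pr iu z1))// -[leRHS](Pr_cst c z1).
by apply: le_Pr => //; [exact: RL1_norm|exact: RL1_cst].
Qed.

Lemma N1_dil_mul (F G : C -> C) M K r : (forall z, nc z < 1 -> holo F z) ->
  (forall z, nc z < 1 -> holo G z) -> 0 <= r < 1 -> (forall z, nc z < 1 -> nc (G z) <= M) ->
  N1 (dilate F r) <= K -> N1 (dilate (fun z => F z * G z) r) <= M * K.
Proof.
move=> hF hG r01 GM FK.
have M0 : 0 <= M by apply: le_trans (GM 0 _); rewrite ?nc_ge0// nc0.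
have hFG z : nc z < 1 -> holo (fun z => F z * G z) z.
  by move=> z1; apply: holoM; [exact: hF|exact: hG].
have i1 := L1_RL1 (L1_dilate hF r01); have i2 := L1_RL1 (L1_dilate hFG r01).
apply: (@le_trans _ _ (M * N1 (dilate F r))); last by rewrite ler_wpM2l.
rewrite /N1 -RintegralZl//.
apply: (le_Rintegral measurableT i2 (RL1Z M i1)) => x _; rewrite /dilate.
have : nc (r%:C * zeta x) < 1 by case/andP: r01 => r0 r1; exact: nc_dil_lt1.
by move: (_ * _) => w w1; rewrite ncM mulrC ler_wpM2r ?nc_ge0// GM.
Qed.

(** The counterpart of [int_mul0] with exponents 1 and infinity: the extension of g is bounded, so
    the product still has means bounded in L^1. *)
Lemma int_mulL1 f g : L1 f -> (forall k, fn f k = 0) -> Loo g ->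
  (forall k, (0 < k)%N -> fn g k = 0) -> cintm (fun x => f x * g x) = 0.
Proof.
move=> f1 fk goo gk; have g1 := Loo_L1 goo; have [mg [M gM]] := goo.
pose f' x := cj (zeta x) * f x; have f'1 : L1 f' by exact: L1_valJ.
have f'k k : (0 < k)%N -> fn f' k = 0.
  case: k => [//|k _]; rewrite -(fn_shift f' k) -[RHS](fk k); apply: eq_cint => x _.
  by rewrite mulrA val_valJ mul1r.
have hF z : nc z < 1 -> holo (Poi f') z by move=> z1; exact: Poi_holo.
have hG z : nc z < 1 -> holo (Poi g) z by move=> z1; exact: Poi_holo.
have fg1 : L1 (fun x => f' x * g x).
  apply: (cintble_ae_le (g := fun x => M * nc (f' x))).
  - by apply: cmeasM; [exact: (cintble_meas f'1)|exact: mg].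
  - by apply: RL1Z; exact: L1_RL1.
  - by apply: filterS gM => x gx; rewrite ncM mulrC ler_wpM2r.
have hFG z : nc z < 1 -> holo (fun z => Poi f' z * Poi g z) z.
  by move=> z1; apply: holoM; [exact: hF|exact: hG].
have := @fn_boundary R (fun z => Poi f' z * Poi g z) (fun x => f' x * g x) (M * N1 f') hFG _ fg1 _ 1%N (ltn0Sn 0).
rewrite /fn => E; rewrite -[RHS]E.
- apply: eq_cint => x _; rewrite expr1 /f'.
  have := val_valJ x; move: (zeta x : C) (cj (zeta x)) (f x) (g x) => p q r s pq.
  by transitivity ((p * q) * (r * s)); [rewrite pq mul1r|ring].
- move=> r r01; apply: (N1_dil_mul hF hG r01); last exact: N1_Poi_dil.
  by move=> z z1; exact: (nc_Poi_bd g1 gM).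
- by apply: filterS2 (fatou_cradial f'1) (fatou_cradial g1) => x; exact: cradialM.
Qed.

Lemma cradial_comp (F G : C -> C) x a : cradial F x a -> holo G a ->
  cradial (fun z => G (F z)) x (G a).
Proof.
move=> hF hG e e0.
have /cvgrPdist_lt/(_ _ e0)/nbhs_nc[d d0 dP] := holo_cvg hG.
have d2 : 0 < d / 2 by rewrite divr_gt0.
have [d1 d10 h1] := hF _ d2; exists d1 => // s s0 s1 sd.
have := dP (F (s%:C * zeta x)); rewrite sub0r normrN ger0_norm// => H.
by apply/ltW/H; apply: le_lt_trans (h1 s s0 s1 sd) _; rewrite gtr_pMr// invf_lt1 ?ltr1n.
Qed.

Lemma cradialZ (F : C -> C) x l a : cradial F x l -> cradial (fun z => a * F z) x (a * l).
Proof.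
by move=> h; apply: cradialM => // e e0; exists 1 => // s _ _ _; rewrite subrr nc0 ltW.
Qed.

Lemma cradialD (F G : C -> C) x a b : cradial F x a -> cradial G x b ->
  cradial (fun z => F z + G z) x (a + b).
Proof.
by move=> /cradialP hF /cradialP hG; apply/cradialP; exact: (@cvgD _ C^o _ _ _ _ _ _ _ hF hG).
Qed.

Lemma cradial_damp_slope eps (F G : C -> C) x a b : cradial F x a -> cradial G x b ->
  1 + eps%:C * a ^+ 4 != 0 -> 1 + eps%:C * b ^+ 4 != 0 ->
  cradial (fun z => damp_slope eps (F z) (G z)) x (damp_slope eps a b).
Proof.
move=> hF hG a0 b0.
have hX (H : C -> C) y n : cradial H x y -> cradial (fun z => H z ^+ n) x (y ^+ n).
  by move=> hH; apply: (cradial_comp (G := fun w => w ^+ n) hH); apply: holoX; exact: holo_id.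
have h1 : cradial (fun=> 1) x 1 by move=> e e0; exists 1 => // s _ _ _; rewrite subrr nc0 ltW.
have hden (H : C -> C) y : cradial H x y -> cradial (fun z => 1 + eps%:C * H z ^+ 4) x (1 + eps%:C * y ^+ 4).
  by move=> hH; apply: cradialD => //; apply: cradialZ; exact: hX.
apply: cradialM; last first.
  apply: (cradial_comp (G := fun w => w^-1)); first by apply: cradialM; exact: hden.
  by apply: holoV; [rewrite mulf_neq0|exact: holo_id].
apply: cradialD => //; rewrite -mulN1r; under [X in cradial X]eq_fun do rewrite -mulN1r.
apply: (cradialZ (F := fun z => eps%:C * (F z * G z * (F z ^+ 2 + F z * G z + G z ^+ 2)))).
apply: (cradialZ (F := fun z => F z * G z * (F z ^+ 2 + F z * G z + G z ^+ 2))).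
apply: cradialM; first exact: cradialM.
by apply: cradialD; [apply: cradialD; [exact: hX|exact: cradialM]|exact: hX].
Qed.

Section cross_functions.
Variables (s d : T -> C) (c eps : R).
Hypotheses (e0 : 0 < eps) (ec : 36 * (eps * c ^+ 4) <= 1).
Hypotheses (s1 : L1 s) (sk : forall k, (0 < k)%N -> fn s k = 0).
Hypotheses (d1 : L1 d) (dk : forall k, (0 < k)%N -> fn d k = 0).
Hypotheses (sc : \forall x \ae m, `|Re (s x)| <= c) (dc : \forall x \ae m, `|Im (d x)| <= c).

(** A bound on the boundary real part passes to the interior because the extension is a Poisson
    integral. *)
Lemma cross_s z : nc z < 1 -> cross c (Poi s z).
Proof. by move=> z1; left; rewrite PoiE//=; exact: (normr_Pr_ae s1.1 sc z1). Qed.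

Lemma cross_d z : nc z < 1 -> cross c (Poi d z).
Proof. by move=> z1; right; rewrite PoiE//=; exact: (normr_Pr_ae d1.2 dc z1). Qed.

Lemma fn_damp g k : L1 g -> (forall k, (0 < k)%N -> fn g k = 0) ->
  (forall z, nc z < 1 -> cross c (Poi g z)) -> (\forall x \ae m, cross c (g x)) ->
  Loo (fun x => damp eps (g x)) /\ ((0 < k)%N -> fn (fun x => damp eps (g x)) k = 0).
Proof.
move=> g1 gk gc gcx.
have goo : Loo (fun x => damp eps (g x)).
  split; first by apply: cmeas_damp; exact: (cintble_meas g1).
  by exists (4 * (1 + eps^-1)); apply: filterS gcx => x; exact: damp_bd.
have hP z : nc z < 1 -> holo (fun w => damp eps (Poi g w)) z.
  by move=> z1; apply: (holo_damp e0 ec); [exact: Poi_holo|exact: gc].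
split=> // k0; apply: (@fn_boundary R (fun w => damp eps (Poi g w)) _ (4 * (1 + eps^-1)) hP) => //.
- move=> r r01; rewrite -[leRHS]Rint_cst_circle; apply: le_Rintegral => //.
  + by apply: L1_RL1; exact: (L1_dilate hP r01).
  + exact: RL1_cst.
  + move=> x _; apply: (damp_bd e0 ec); apply: gc.
    by case/andP: r01 => r0 r1; exact: nc_dil_lt1.
- exact: Loo_L1.
- apply: filterS2 (fatou_cradial g1) gcx => x xg xc.
  by apply: (cradial_comp (G := damp eps) xg); apply: (holo_damp e0 ec (F := id)) => //; exact: holo_id.
Qed.

(** The slope of the two extensions is holomorphic and bounded by 48 in the disc, so its product
    with the extension of b has means bounded in L^1 and Riesz's theorem applies. *)
Lemma fn_damp_slope b k : L1 b -> (forall k, (0 < k)%N -> fn b k = 0) -> (0 < k)%N ->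
  L1 (fun x => b x * damp_slope eps (s x) (d x)) ->
  fn (fun x => b x * damp_slope eps (s x) (d x)) k = 0.
Proof.
move=> b1 bk k0 bd1.
have hb z : nc z < 1 -> holo (Poi b) z by move=> z1; exact: Poi_holo.
have hd z : nc z < 1 -> holo (fun w => damp_slope eps (Poi s w) (Poi d w)) z.
  move=> z1; apply: (holo_damp_slope e0 ec); [exact: Poi_holo|exact: Poi_holo|exact: cross_s|exact: cross_d].
have hP z : nc z < 1 -> holo (fun w => Poi b w * damp_slope eps (Poi s w) (Poi d w)) z.
  by move=> z1; apply: holoM; [exact: hb|exact: hd].
apply: (@fn_boundary R _ _ (48 * N1 b) hP) => //.
- move=> r r01; apply: (N1_dil_mul hb hd r01); last exact: N1_Poi_dil.
  by move=> z z1; apply: (damp_slope_bd e0 ec); [exact: cross_s|exact: cross_d].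
- have hs : \forall x \ae m, cradial (Poi s) x (s x) /\ cross c (s x).
    by apply: filterS2 (fatou_cradial s1) sc => x xs xc; split=> //; left.
  have hd' : \forall x \ae m, cradial (Poi d) x (d x) /\ cross c (d x).
    by apply: filterS2 (fatou_cradial d1) dc => x xd xc; split=> //; right.
  apply: filterS3 (fatou_cradial b1) hs hd' => x xb [xs cs] [xd cd].
  by apply: cradialM => //; apply: cradial_damp_slope => //; exact: (den_neq e0 ec).
Qed.

End cross_functions.

Section annihilation.
Variables (I f h a b v : T -> C).
Hypotheses (I2 : L2 I) (Ik : forall k, (0 < k)%N -> fn I k = 0).
Hypothesis I1 : \forall x \ae m, nc (I x) = 1.
Hypotheses (f1 : L1 f) (fk : forall k, fn f k = 0).
Hypotheses (h1 : L1 h) (hk : forall k, fn h k = 0).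
Hypothesis fIh : \forall x \ae m, f x = I x * cj (h x).
Hypotheses (a2 : L2 a) (ak : forall k, (0 < k)%N -> fn a k = 0).
Hypotheses (b2 : L2 b) (bk : forall k, (0 < k)%N -> fn b k = 0).
Hypotheses (voo : Loo v) (vab : \forall x \ae m, v x = a x + cj (I x * b x)).

Let s x := a x + I x * b x.
Let d x := a x - I x * b x.
(** The bounded approximation of v. As v = Re s + i Im d, the damping acts on each part through the
    function that is controlled in that direction. *)
Let w eps x := ((Re (damp eps (s x))) +i* (Im (damp eps (d x))) : C).

Let Ib2 : L2 (fun x => I x * b x).
Proof. by apply: L2_mulbd => //; exact: I_Loo. Qed.

Let s1 : L1 s. Proof. by apply: L2_L1; exact: L2D. Qed.
Let d1 : L1 d. Proof. by apply: L2_L1; exact: L2B. Qed.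

Let sk k : (0 < k)%N -> fn s k = 0.
Proof.
move=> k0; rewrite fnD; [|exact: L2_L1|exact: L2_L1].
by rewrite ak// (fn_mul2 I2 Ik b2 bk k0) addr0.
Qed.

Let dk k : (0 < k)%N -> fn d k = 0.
Proof.
move=> k0; rewrite fnB; [|exact: L2_L1|exact: L2_L1].
by rewrite ak// (fn_mul2 I2 Ik b2 bk k0) subrr.
Qed.

Lemma Re_v : \forall x \ae m, Re (s x) = Re (v x) /\ Im (d x) = Im (v x).
Proof. by apply: filterS vab => x ->; rewrite /s /d ReD ImB ReD ImD ReJ ImJ. Qed.

Lemma sd_w eps x : w eps x =
  (2^-1)%:C * (damp eps (s x) + damp eps (d x)) + cj ((2^-1)%:C * (damp eps (s x) - damp eps (d x))).
Proof.
rewrite /w; move: (damp _ _) (damp _ _) => p q.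
by apply: eqcP; rewrite !(ReD, ReM, ReJ, ImD, ImM, ImJ, ReB, ImB) /=; field.
Qed.

(** By [sd_w] and [dampB], w = A + conj (I g) with A and g bounded and analytic. Since f conj I =
    conj h, the integral of f w is that of f A plus the conjugate of that of h g, and both
    vanish. *)
Lemma int_w eps c : 0 < eps -> 36 * (eps * c ^+ 4) <= 1 ->
  (\forall x \ae m, nc (v x) <= c) -> cintm (fun x => f x * w eps x) = 0.
Proof.
move=> e0 ec vc.
have sc : \forall x \ae m, `|Re (s x)| <= c.
  by apply: filterS2 Re_v vc => x [-> _]; apply: le_trans; exact: Re_le_nc.
have dc : \forall x \ae m, `|Im (d x)| <= c.
  by apply: filterS2 Re_v vc => x [_ ->]; apply: le_trans; exact: Im_le_nc.
have cs : \forall x \ae m, cross c (s x) by apply: filterS sc => x; left.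
have cd : \forall x \ae m, cross c (d x) by apply: filterS dc => x; right.
have hs := fn_damp e0 ec _ s1 sk (cross_s s1 sc) cs.
have hd := fn_damp e0 ec _ d1 dk (cross_d d1 dc) cd.
have soo := (hs 0%N).1; have doo := (hd 0%N).1.
have [_ [Ms hMs]] := soo; have [_ [Md hMd]] := doo.
pose A x := (2^-1)%:C * (damp eps (s x) + damp eps (d x)).
pose g x := b x * damp_slope eps (s x) (d x).
have mA : cmeas setT A.
  by apply: cmeasM; [exact: cmeas_cst|apply: cmeasD; [exact: soo.1|exact: doo.1]].
have h2 : nc ((2^-1)%:C : C) = 2^-1 by rewrite ncR ger0_norm// invr_ge0.
have Aoo : Loo A.
  split=> //; exists (2^-1 * (Ms + Md)); apply: filterS2 hMs hMd => x xs xd.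
  by rewrite ncM h2 ler_wpM2l ?invr_ge0// (le_trans (ncD _ _))// lerD.
have Ak k : (0 < k)%N -> fn A k = 0.
  move=> k0; rewrite fnZ; last by apply: cintbleD => //; exact: Loo_L1.
  by rewrite fnD; [rewrite (hs k).2// (hd k).2// addr0 mulr0|exact: Loo_L1|exact: Loo_L1].
have Bg : \forall x \ae m, (2^-1)%:C * (damp eps (s x) - damp eps (d x)) = I x * g x.
  apply: filterS2 cs cd => x xs xd; rewrite (dampB e0 ec xs xd) /g; move: (damp_slope eps (s x) (d x)) => p; rewrite /s /d.
  have hh : (2^-1)%:C + (2^-1)%:C = 1 :> C by rewrite -rcD half_half.
  move: (a x) (I x) (b x) hh; move: (2^-1)%:C => h' q r t hh.
  by transitivity ((h' + h') * (r * (t * p))); [ring|rewrite hh mul1r].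
have mg : cmeas setT g.
  apply: cmeasM; [exact: b2.1|]; apply: cmeasM.
    apply: cmeasB; first exact: cmeas_cst.
    apply: cmeasM; first exact: cmeas_cst.
    have ms := cintble_meas s1; have md := cintble_meas d1.
    apply: cmeasM; first exact: cmeasM.
    by apply: cmeasD; [apply: cmeasD; [exact: cmeasX|exact: cmeasM]|exact: cmeasX].
  have mden (u : T -> C) : cmeas setT u -> cmeas setT (fun x => 1 + eps%:C * u x ^+ 4).
    move=> mu'; apply: cmeasD; first exact: cmeas_cst.
    by apply: cmeasM; [exact: cmeas_cst|exact: cmeasX].
  by apply: cmeasV; apply: cmeasM; apply: mden; [exact: (cintble_meas s1)|exact: (cintble_meas d1)].
(* g contains b, which is only in L^2; but |g| = |I g|, and I g is half the difference of two
   bounded functions. *)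
have goo : Loo g.
  split=> //; exists (2^-1 * (Ms + Md)).
  have hM : \forall x \ae m, nc (damp eps (s x) - damp eps (d x)) <= Ms + Md.
    by apply: filterS2 hMs hMd => x xs xd; rewrite (le_trans (ncB _ _))// lerD.
  apply: filterS3 I1 Bg hM => x xI xB xs.
  have -> : nc (g x) = nc (I x * g x) by rewrite ncM xI mul1r.
  by rewrite -xB ncM h2 ler_wpM2l ?invr_ge0.
have gk k : (0 < k)%N -> fn g k = 0.
  move=> k0; apply: (fn_damp_slope e0 ec s1 sk d1 dk sc dc (L2_L1 b2) bk k0).
  exact: Loo_L1 goo.
have t1 := int_mulL1 f1 fk Aoo Ak.
have t2 := int_mulL1 h1 hk goo gk.
have L1Loo (p q : T -> C) : L1 p -> Loo q -> L1 (fun x => p x * q x).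
  move=> p1 [mq [M qM]]; apply: (cintble_ae_le (g := fun x => M * nc (p x))).
  - by apply: cmeasM; [exact: (cintble_meas p1)|exact: mq].
  - by apply: RL1Z; exact: L1_RL1.
  - by apply: filterS qM => x xM; rewrite ncM mulrC ler_wpM2r.
have i1 := L1Loo _ _ f1 Aoo; have i2 := L1Loo _ _ h1 goo.
transitivity (cintm (fun x => f x * A x + cj (h x * g x))); last first.
  rewrite (cintD measurableT i1 (cintbleJ measurableT i2)) (cintJ measurableT i2).
  by rewrite t1 t2 conjc0 addr0.
apply: ae_eq_cint.
- apply: cmeasM; first exact: (cintble_meas f1).
  by split; [exact: soo.1.1|exact: doo.1.2].
- by apply: cmeasD; [exact: (cintble_meas i1)|apply: cmeasJ; exact: (cintble_meas i2)].
- apply: filterS3 fIh Bg (IJ1 I1) => x xf xB xI; rewrite sd_w xB mulrDr -/(A x); congr (_ + _).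
  rewrite xf (conjcM (I x) (g x)) (conjcM (h x) (g x)).
  move: (I x) (cj (I x)) (cj (h x)) (cj (g x)) xI => p q r t pq.
  by transitivity ((p * q) * (r * t)); [ring|rewrite pq mul1r].
Qed.

Lemma int_fv : cintm (fun x => f x * v x) = 0.
Proof.
have [mv [M vM]] := voo; pose c := Num.max M 0.
have c0 : 0 <= c by rewrite le_max lexx orbT.
have vc : \forall x \ae m, nc (v x) <= c by apply: filterS vM => x xM; rewrite le_max xM.
(* With eps = 1 / (K (n + 1)) the smallness condition on eps holds for every n. *)
pose K := 36 * c ^+ 4 + 1; have K0 : 0 < K by rewrite ltr_wpDl// mulr_ge0// exprn_ge0.
pose ep n : R := K^-1 / n.+1%:R.
have ep0 n : 0 < ep n by rewrite divr_gt0 ?invr_gt0.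
have epc n : 36 * (ep n * c ^+ 4) <= 1.
  rewrite mulrCA /ep mulrAC -mulrA ler_pdivrMl// mulr1 ler_pdivrMr//.
  apply: (@le_trans _ _ K); first by rewrite lerDl.
  by rewrite ler_peMr ?(ltW K0)// ler1n.
have sc : \forall x \ae m, `|Re (s x)| <= c.
  by apply: filterS2 Re_v vc => x [-> _]; apply: le_trans; exact: Re_le_nc.
have dc : \forall x \ae m, `|Im (d x)| <= c.
  by apply: filterS2 Re_v vc => x [_ ->]; apply: le_trans; exact: Im_le_nc.
have mw n : cmeas setT (w (ep n)).
  by split; [exact: (cmeas_damp (ep n) (cintble_meas s1)).1|exact: (cmeas_damp (ep n) (cintble_meas d1)).2].
have mf := cintble_meas f1.
have mfw n : cmeas setT (fun x => f x * w (ep n) x) by exact: cmeasM.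
have mfv : cmeas setT (fun x => f x * v x) by exact: cmeasM.
have wb n : \forall x \ae m, nc (w (ep n) x) <= 96 * c.
  apply: filterS2 sc dc => x xs xd; apply: le_trans (nc_le_ReIm _) _ => /=.
  have -> : 96 * c = 48 * c + 48 * c by rewrite -mulrDl; congr (_ * _); rewrite -natrD.
  apply: lerD; [apply: le_trans (Re_damp (ep0 n) (epc n) xs) _|apply: le_trans (Im_damp (ep0 n) (epc n) xd) _].
    by rewrite ler_wpM2l.
  by rewrite ler_wpM2l.
have wv : \forall x \ae m, (fun n => nc (w (ep n) x - v x)) @ \oo --> (0 : R).
  apply: filterS3 Re_v sc dc => x [xs xd] cs cd.
  pose B := 4 * nc (s x) ^+ 5 + 4 * nc (d x) ^+ 5.
  apply: (@squeeze_cvgr _ _ _ _ (fun=> 0) (fun n => ep n * B)); [|exact: cvg_cst|].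
    apply: nearW => n; rewrite nc_ge0 andTb; apply: le_trans (nc_le_ReIm _) _.
    rewrite ReB ImB -xs -xd /B mulrDr; apply: lerD.
      rewrite -[Re (w (ep n) x)]/(Re (damp (ep n) (s x))) -ReB.
      by apply: le_trans (Re_le_nc _) _; apply: (damp_dist (ep0 n) (epc n)); left.
    rewrite -[Im (w (ep n) x)]/(Im (damp (ep n) (d x))) -ImB.
    by apply: le_trans (Im_le_nc _) _; apply: (damp_dist (ep0 n) (epc n)); right.
  rewrite -[X in _ --> X](mul0r B); apply: cvgM; last exact: cvg_cst.
  by rewrite -[X in _ --> X](mulr0 K^-1); apply: cvgM; [exact: cvg_cst|exact: cvg_harmonic].
have ifw n : L1 (fun x => f x * w (ep n) x).
  apply: (cintble_ae_le (g := fun x => 96 * c * nc (f x)) (mfw n)).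
    by apply: RL1Z; exact: L1_RL1.
  by apply: filterS (wb n) => x xw; rewrite ncM mulrC ler_wpM2r.
have ifv : L1 (fun x => f x * v x).
  apply: (cintble_ae_le (g := fun x => c * nc (f x)) mfv).
    by apply: RL1Z; exact: L1_RL1.
  by apply: filterS vc => x xw; rewrite ncM mulrC ler_wpM2r.
have [|||||_ _ H] := @Rint_dct R (fun n x => nc (f x * w (ep n) x - f x * v x)) (fun=> 0)
    (fun x => (97 * c) * nc (f x)).
- by move=> n; apply: meas_nc; exact: cmeasB.
- exact: measurable_cst.
- by apply: RL1Z; exact: L1_RL1.
- apply: filterS wv => x hx; under eq_fun do rewrite -mulrBr ncM.
  have := cvgM (@cvg_cst _ (nc (f x)) _ \oo _) hx; rewrite mulr0; exact.
- move=> n; apply: filterS2 (wb n) vc => x xw xv.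
  rewrite ger0_norm ?nc_ge0// -mulrBr ncM mulrC ler_wpM2r//.
  apply: le_trans (ncB _ _) _; apply: le_trans (lerD xw xv) _.
  by move: (c) => t; rewrite le_eqVlt; apply/orP; left; apply/eqP; ring.
apply: nc_small_eq => e e0; move/cvgrPdist_le: H => /(_ e e0)[N _ NP].
have := NP N (leqnn N); rewrite Rint_cst_circle sub0r normrN ger0_norm; last first.
  by apply: Rintegral_ge0 => x _; exact: nc_ge0.
apply: le_trans; rewrite subr0.
have := nc_cintm (cintbleB measurableT (ifw N) ifv); rewrite (cintB measurableT (ifw N) ifv).
by rewrite (int_w (ep0 N) (epc N) vc) sub0r ncN.
Qed.

End annihilation.
End quotient_annihilates.

(** * Extension and representation of functionals *)

Section hahn_banach.
Variables (R : realType) (V : lmodType R[i]).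
Local Notation C := R[i].
Implicit Types (E K : set V) (p : V -> R) (x y : V).

(* Partial extensions are represented by their graphs, so that single-valuedness
   follows from linearity and the bound by p. *)
Lemma real_hahn_banach E K p (u : V -> R) :
  (forall a x y, E x -> E y -> E (a *: x + y)) -> K `<=` E -> K 0 ->
  (forall (a : R) x y, K x -> K y -> K (a%:C *: x + y)) ->
  (forall x y, E x -> E y -> p (x + y) <= p x + p y) ->
  (forall (a : R) x, E x -> 0 <= a -> p (a%:C *: x) = a * p x) ->
  (forall (a : R) x y, K x -> K y -> u (a%:C *: x + y) = a * u x + u y) ->
  (forall x, K x -> u x <= p x) ->
  exists U : V -> R, [/\ forall (a : R) x y, E x -> E y -> U (a%:C *: x + y) = a * U x + U y,
    forall x, K x -> U x = u x & forall x, E x -> U x <= p x].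
Proof.
move=> Elin KE K0 Klin pD pZ ulin up.
have E0 : E 0 by exact: KE.
have EZ a x : E x -> E (a *: x) by move=> Ex; rewrite -[_ *: _]addr0; exact: Elin.
have ED x y : E x -> E y -> E (x + y) by move=> Ex Ey; rewrite -[x]scale1r; exact: Elin.
pose good (G : set (V * R)) := [/\ forall x, K x -> G (x, u x),
  forall (a : R) x r y s, G (x, r) -> G (y, s) -> G (a%:C *: x + y, a * r + s) &
  forall x r, G (x, r) -> E x /\ r <= p x].
have p0 : p 0 = 0.
  by have := pZ 0 0 E0 (lexx 0); rewrite scaler0 mul0r.
have fun_ G x r s : good G -> G (x, r) -> G (x, s) -> r = s.
  move=> [_ Glin GE] xr xs.
  have h := Glin (-1) _ _ _ _ xs xr; have h' := Glin (-1) _ _ _ _ xr xs.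
  have e : (-1)%:C *: x + x = 0.
    by rewrite (_ : (-1)%:C = -1 :> C) ?scaleN1r ?addNr// rcN.
  have := (GE _ _ h).2; have := (GE _ _ h').2; rewrite e p0 => ? ?.
  by apply/eqP; rewrite eq_le; apply/andP; split; lra.
pose G0 : set (V * R) := [set xr | K xr.1 /\ xr.2 = u xr.1].
have G0good : good G0.
  split=> [x Kx|a x r y s [/= Kx ->] [/= Ky ->]|x r [/= Kx ->]]; first by [].
    by split; [exact: Klin|rewrite ulin].
  by split; [exact: KE|exact: up].
have [|G [Gor Gmax']] := @Zorn_bigcup _ [set G | G = set0 \/ good G].
  move=> F FP Ftot; have [[t0 At0 t0N]|F0] := pselect (exists2 t, F t & t <> set0); last first.
    left; apply/seteqP; split=> // z [X FX Xz]; apply: F0; exists X => // X0.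
    by rewrite X0 in Xz.
  have goodX X z : F X -> X z -> good X.
    by move=> FX Xz; have [X0|//] := FP _ FX; rewrite X0 in Xz.
  right; split.
  + move=> x Kx; exists t0 => //; have [//|[h _ _]] := FP _ At0; exact: h.
  + move=> a x r y s [t1 A1 xr] [t2 A2 ys].
    have [h|h] := Ftot _ _ A1 A2.
      by exists t2 => //; have [_ hl _] := goodX _ _ A2 ys; apply: hl => //; exact: h.
    by exists t1 => //; have [_ hl _] := goodX _ _ A1 xr; apply: hl => //; exact: h.
  + by move=> x r [t At xr]; have [_ _] := goodX _ _ At xr; apply.
have Ggood : good G.
  have [G0'|//] := Gor; exfalso; apply: (Gmax' G0); last by right.
  by rewrite G0'; split=> // /(_ (0, u 0)); apply.
have {}Gmax H : good H -> G `<=` H -> H `<=` G.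
  by move=> Hgood GH; apply: contrapT => HG; apply: (Gmax' H); [split|right].
have [GK Glin GE] := Ggood.
have G00 : G (0, 0).
  have := GK _ K0; rewrite (_ : u 0 = 0)//.
  by have := ulin (-1) 0 0 K0 K0; rewrite scaler0 addr0 mulN1r addNr.
have GZ (a : R) x r : G (x, r) -> G (a%:C *: x, a * r).
  by move=> xr; have := Glin a _ _ _ _ xr G00; rewrite !addr0.
have total x0 : E x0 -> exists r, G (x0, r).
  (* The value at [x0] must lie between all s - p (y - x0) and all p (y + x0) - s; subadditivity
     makes these compatible, and the supremum of the former is chosen. *)
  move=> Ex0; pose A := [set xr.2 - p (xr.1 - x0) | xr in G].
  have EB x : E x -> E (x - x0) by move=> Ex; apply: ED => //; rewrite -scaleN1r; exact: EZ.
  have ubA y s : G (y, s) -> ubound A (p (y + x0) - s).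
    move=> ys _ [[x r] /= xr <-]; rewrite lerBlDr addrAC lerBrDr.
    have h := Glin 1 _ _ _ _ xr ys; rewrite mul1r (_ : 1%:C = 1 :> C)// scale1r in h.
    rewrite (le_trans (GE _ _ h).2)//.
    have -> : x + y = (y + x0) + (x - x0) by rewrite addrC addrA [X in _ = X - _]addrAC addrK.
    by apply: pD; [apply: ED => //; exact: (GE _ _ ys).1|apply: EB; exact: (GE _ _ xr).1].
  have supA : has_sup A.
    split; first by exists (0 - p (0 - x0)); exists (0, 0).
    by exists (p (0 + x0) - 0); exact: ubA.
  pose al := sup A.
  have al_ub y s : G (y, s) -> al <= p (y + x0) - s.
    by move=> ys; apply: ge_sup; [exact: supA.1|exact: ubA].
  have al_lb y s : G (y, s) -> s - p (y - x0) <= al.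
    by move=> ys; apply: ub_le_sup; [exact: supA.2|exists (y, s)].
  pose H : set (V * R) := [set xr | exists y s t, G (y, s) /\ xr = (y + t%:C *: x0, s + t * al)].
  have GH : G `<=` H.
    by move=> [y s] ys; exists y, s, 0; rewrite mul0r addr0 scale0r addr0.
  have Hgood : good H.
    split.
    - by move=> x Kx; apply: GH; exact: GK.
    - move=> a x r y s [x1 [r1 [t1 [g1 [-> ->]]]]] [x2 [r2 [t2 [g2 [-> ->]]]]].
      exists (a%:C *: x1 + x2), (a * r1 + r2), (a * t1 + t2); split; first exact: Glin.
      congr (_, _); last by ring.
      by rewrite scalerDr scalerA rcD rcM scalerDl addrACA.
    - move=> x r [y [s [t [ys [-> ->]]]]].
      have Ey := (GE _ _ ys).1.
      split; first by apply: ED => //; exact: EZ.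
      have [->|t0] := eqVneq t 0.
        by rewrite mul0r addr0 scale0r addr0; exact: (GE _ _ ys).2.
      have tC : t%:C != 0 :> C by apply: contra t0 => /eqP/(congr1 (@complex.Re R))/= ->.
      have /orP[tp|tn] : (0 < t) || (t < 0) by rewrite -neq_lt eq_sym.
        have := al_ub _ _ (GZ t^-1 _ _ ys) => h.
        have -> : y + t%:C *: x0 = t%:C *: ((t^-1)%:C *: y + x0).
          by rewrite scalerDr scalerA -rcM mulfV// scale1r.
        rewrite (pZ _ _ _ (ltW tp)); last by apply: ED => //; exact: EZ.
        have -> : s + t * al = t * (t^-1 * s + al) by rewrite mulrDr mulrA mulfV// mul1r.
        by rewrite ler_pM2l// addrC -lerBrDr.
      pose q := - t; have q0 : 0 < q by rewrite oppr_gt0.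
      have := al_lb _ _ (GZ q^-1 _ _ ys) => h.
      have -> : y + t%:C *: x0 = q%:C *: ((q^-1)%:C *: y - x0).
        by rewrite scalerBr scalerA -rcM mulfV ?gt_eqF// scale1r rcN scaleNr opprK.
      rewrite (pZ _ _ _ (ltW q0)); last by apply: EB; exact: EZ.
      have -> : s + t * al = q * (q^-1 * s - al).
        by rewrite mulrBr mulrA mulfV ?gt_eqF// mul1r mulNr opprK.
      by rewrite ler_pM2l// lerBlDr addrC -lerBlDr.
  exists al; apply: (Gmax _ Hgood GH); exists 0, 0, 1; split=> //.
  by rewrite (_ : 1%:C = 1 :> C)// scale1r mul1r !add0r.
have [|U UP] := @choice V R (fun x r => E x -> G (x, r)).
  move=> x; have [Ex|nEx] := pselect (E x); last by exists 0.
  by have [r xr] := total x Ex; exists r.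
exists U; split.
- move=> a x y Ex Ey; apply: (fun_ G (a%:C *: x + y)) => //; first by apply: UP; exact: Elin.
  by apply: Glin; exact: UP.
- by move=> x Kx; apply: (fun_ G x) => //; [apply: UP; exact: KE|exact: GK].
- by move=> x Ex; exact: (GE _ _ (UP _ Ex)).2.
Qed.

(** The real part is extended and the complex functional recovered from it; the bound follows after
    rotating L x to its modulus. A subset [E] occurs because the ambient module will be that of all
    functions on the circle, with L^1 as a subspace on which [p] is a seminorm. *)
Theorem hahn_banach E K p (l : V -> C) :
  (forall a x y, E x -> E y -> E (a *: x + y)) -> K `<=` E -> K 0 ->
  (forall a x y, K x -> K y -> K (a *: x + y)) ->
  (forall x y, E x -> E y -> p (x + y) <= p x + p y) ->
  (forall x, E x -> 0 <= p x) ->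
  (forall a x, E x -> p (a *: x) = nc a * p x) ->
  (forall a x y, K x -> K y -> l (a *: x + y) = a * l x + l y) ->
  (forall x, K x -> nc (l x) <= p x) ->
  exists L : V -> C, [/\ forall a x y, E x -> E y -> L (a *: x + y) = a * L x + L y,
    forall x, K x -> L x = l x & forall x, E x -> nc (L x) <= p x].
Proof.
move=> Elin KE K0 Klin pD pge0 pZ llin lp.
have E0 : E 0 by exact: KE.
have EZ a x : E x -> E (a *: x) by move=> Ex; rewrite -[_ *: _]addr0; exact: Elin.
have KZ a x : K x -> K (a *: x) by move=> Kx; rewrite -[_ *: _]addr0; exact: Klin.
have [||||U [Ulin UK Up]] := @real_hahn_banach E K p (fun x => Re (l x)) Elin KE K0 _ pD.
- by move=> a x y; exact: Klin.
- by move=> a x Ex a0; rewrite pZ// ncR ger0_norm.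
- by move=> a x y Kx Ky; rewrite llin// ReD ReM /= mul0r subr0.
- by move=> x Kx; apply: le_trans (lp _ Kx); apply: le_trans (Re_le_nc _); exact: ler_norm.
have UD x y : E x -> E y -> U (x + y) = U x + U y.
  move=> Ex Ey; have := Ulin 1 x y Ex Ey.
  by rewrite (_ : 1%:C = 1 :> C)// scale1r mul1r.
have UZ (a : R) x : E x -> U (a%:C *: x) = a * U x.
  move=> Ex; have U00 : U 0 = 0 by have := UD 0 0 E0 E0; rewrite addr0; lra.
  by have := Ulin a x 0 Ex E0; rewrite !addr0 U00 addr0.
have UC a x : E x -> U (a *: x) = Re a * U x + Im a * U ('i *: x).
  move=> Ex; have -> : a *: x = (Re a)%:C *: x + (Im a)%:C *: ('i *: x).
    rewrite scalerA -scalerDl; congr (_ *: x); apply: eqcP; rewrite ?ReD ?ImD ?ReM ?ImM /=; by ring.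
  have Ei := EZ 'i _ Ex; by rewrite (Ulin _ _ _ Ex (EZ _ _ Ei)) (UZ _ _ Ei).
(* A complex-linear functional is determined by its real part U as U x - i U (i x). *)
pose L x : C := U x +i* (- U ('i *: x)).
have iiE x : 'i *: ('i *: x) = - x :> V.
  by rewrite scalerA -expr2 sqr_i scaleN1r.
have UN x : E x -> U (- x) = - U x.
  by move=> Ex; rewrite -scaleN1r UC// ReN ImN /= oppr0 mul0r addr0 mulN1r.
have Llin a x y : E x -> E y -> L (a *: x + y) = a * L x + L y.
  move=> Ex Ey; rewrite /L; have Ei := EZ 'i x Ex; have Ea := EZ a x Ex.
  have Eai := EZ a _ Ei; have Eiy := EZ 'i _ Ey.
  have -> : 'i *: (a *: x + y) = a *: ('i *: x) + 'i *: y.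
    by rewrite scalerDr !scalerA [_ * a]mulrC.
  rewrite (UD _ _ Ea Ey) (UD _ _ Eai Eiy).
  rewrite (UC a x Ex) (UC a _ Ei) iiE UN//.
  apply: eqcP; rewrite ?ReD ?ImD ?ReM ?ImM /=; by ring.
exists L; split=> //.
- move=> x Kx; rewrite /L !UK//; last exact: KZ.
  have -> : l ('i *: x) = 'i * l x.
    have l0 : l 0 = 0.
      by have := llin (-1) 0 0 K0 K0; rewrite scaler0 addr0 mulN1r addNr.
    by have := llin 'i x 0 Kx K0; rewrite !addr0 l0 addr0.
  by apply: eqcP => //=; rewrite Re_iM opprK.
- move=> x Ex; have [c c1 cL] := phaseP (L x).
  have LZ : L (c *: x) = c * L x.
    have L0 : L 0 = 0.
      by have := Llin (-1) 0 0 E0 E0; rewrite scaler0 addr0 mulN1r addNr.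
    by have := Llin c x 0 Ex E0; rewrite !addr0 L0 addr0.
  have := Up _ (EZ c x Ex); rewrite pZ//.
  have -> : U (c *: x) = nc (L x) by have := congr1 (@complex.Re R) (etrans LZ cL).
  by move=> /le_trans; apply; rewrite ler_piMl// pge0.
Qed.

End hahn_banach.

(** * Representation of functionals on H^1 by bounded functions *)

Section representation.
Variable R : realType.
Local Notation C := R[i].
Local Notation T := (circle R).
Local Notation m := (@circle_leb R).
Local Notation cintm := (cint m setT).
Local Notation L1 := (cintble m setT).
Local Notation RL1 u := (m.-integrable setT (fun x => (u x)%:E)).
Local Notation Rint := (Rintegral m setT).
Implicit Types f g h : T -> C.

(** The Poisson kernel at 0 is 1, so this is an instance of [Pr_sqr]. *)
Lemma sqr_N1_le f : L2 f -> N1 f ^+ 2 <= N2 f.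
Proof.
move=> f2; have [_ i2] := f2; have i1 := L1_RL1 (L2_L1 f2).
rewrite /N1 /N2 -!Pr0; apply: Pr_sqr => //; by rewrite nc0.
Qed.

Lemma LooD f g : Loo f -> Loo g -> Loo (fun x => f x + g x).
Proof.
move=> [mf [M fM]] [mg [N gN]]; split; first exact: cmeasD.
by exists (M + N); apply: filterS2 fM gN => x p q; rewrite (le_trans (ncD _ _))// lerD.
Qed.

Lemma LooB f g : Loo f -> Loo g -> Loo (fun x => f x - g x).
Proof.
move=> [mf [M fM]] [mg [N gN]]; split; first exact: cmeasB.
by exists (M + N); apply: filterS2 fM gN => x p q; rewrite (le_trans (ncB _ _))// lerD.
Qed.

Lemma czJ_tp (z : C) n (x : T) : nc z < 1 ->
  nc (cj (cz z x) - tp (fun k => cj z ^+ k) n x) <= nc z ^+ n * (1 - nc z)^-1.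
Proof.
move=> z1; have E : cj (cz z x) = (1 - cj z * zeta x)^-1.
  transitivity (cj (1 - z * cj (zeta x)))^-1; first exact: fmorphV.
  by rewrite conjcB conjcM conjcK conjc1.
have d0 : 1 - cj z * zeta x != 0.
  rewrite -invr_eq0 -E conjc_eq0 invr_eq0; exact: den_neq0.
have tE : tp (fun k => cj z ^+ k) n x = \sum_(k < n) (cj z * zeta x) ^+ k.
  by apply: eq_bigr => k _; rewrite exprMn.
have := geom_cz n d0; rewrite -E -tE => ->.
rewrite addrAC subrr add0r ncM ncX ncM ncJ nc_val mulr1 ncJ.
by apply: ler_wpM2l; [exact: exprn_ge0|exact: nc_cz].
Qed.

Section uniform_limits.
Variables (D : (T -> C) -> C) (B : R).
Hypothesis Dlin : forall a f g, Loo f -> Loo g -> D (fun x => a * f x + g x) = a * D f + D g.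
Hypothesis Dbd : forall h s, Loo h -> (forall x, nc (h x) <= s) -> nc (D h) <= B * s.
Hypothesis DX : forall k, D (fun x => zeta x ^+ k) = 0.

Lemma D0 : D (fun=> 0) = 0.
Proof.
have := Dlin (-1) (Loo_cst 0) (Loo_cst 0).
by under eq_fun do rewrite mulr0 addr0; rewrite mulN1r addNr.
Qed.

Lemma D_tp c n : D (tp c n) = 0.
Proof.
elim: n => [|n IH].
  by rewrite (_ : tp c 0 = fun=> 0) ?D0//; apply/funext => x; rewrite /tp big_ord0.
have -> : tp c n.+1 = fun x => c n * zeta x ^+ n + tp c n x by rewrite tpS; apply/funext => x; rewrite addrC.
by rewrite Dlin ?DX ?IH ?mulr0 ?addr0//; [exact: valX_Loo|exact: tp_Loo].
Qed.

(** A functional bounded for the uniform norm and zero on the powers of [zeta] vanishes on uniform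
    limits of analytic polynomials. *)
Lemma D_unif h c q K : Loo h -> 0 <= q < 1 -> (forall n x, nc (h x - tp c n x) <= q ^+ n * K) -> D h = 0.
Proof.
move=> h1 q01 hq.
apply: nc_small_eq => e e0; rewrite subr0.
have [n hn] := geom_small (B * K) q01 e0.
have E : D h = D (fun x => h x - tp c n x).
  have := Dlin (-1) (tp_Loo c n) h1; rewrite D_tp mulr0 add0r => <-.
  by congr D; apply/funext => x; rewrite mulN1r addrC.
have i1 : Loo (fun x => h x - tp c n x) by apply: LooB => //; exact: tp_Loo.
rewrite E; apply: le_trans (Dbd i1 (hq n)) _; rewrite mulrCA; exact: ltW.
Qed.

End uniform_limits.

Section functional.
Variables (L : (T -> C) -> C) (M : R).
Hypothesis M0 : 0 <= M.
Hypothesis Llin : forall a f g, L1 f -> L1 g -> L (fun x => a * f x + g x) = a * L f + L g.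
Hypothesis Lbd : forall f, L1 f -> nc (L f) <= M * N1 f.

Lemma L1_0 : L1 (fun=> 0 : C). Proof. exact: cintble_cst_circle. Qed.

Lemma L_0 : L (fun=> 0) = 0.
Proof.
have := Llin (-1) L1_0 L1_0.
by under eq_fun do rewrite mulr0 addr0; rewrite mulN1r addNr.
Qed.

Lemma N1_ext f g : (forall x, nc (f x) = nc (g x)) -> N1 f = N1 g.
Proof. by move=> fg; congr Rintegral; apply/funext. Qed.

Lemma sum_L (e_ : nat -> T -> C) (c : nat -> C) n : (forall k, L1 (e_ k)) ->
  L1 (fun x => \sum_(k < n) c k * e_ k x) /\
  L (fun x => \sum_(k < n) c k * e_ k x) = \sum_(k < n) c k * L (e_ k).
Proof.
move=> e1; elim: n => [|n [IH1 IH2]].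
  under eq_fun do rewrite big_ord0; rewrite big_ord0; split; [exact: L1_0|exact: L_0].
have E : (fun x => \sum_(k < n.+1) c k * e_ k x) = fun x => c n * e_ n x + \sum_(k < n) c k * e_ k x.
  by apply/funext => x; rewrite big_ord_recr addrC.
rewrite E Llin// IH2 big_ord_recr addrC; split=> //.
by apply: cintbleD => //; exact: cintbleZ.
Qed.

(** Duality: evaluating L at the combination with coefficients conj L(e_k) gives the sum A itself,
    so A <= M N1 with N1^2 <= A, whence A <= M^2. *)
Lemma functional_l2 (e_ : nat -> T -> C) n : (forall k, L1 (e_ k)) ->
  (forall c : nat -> C, N1 (fun x => \sum_(k < n) c k * e_ k x) ^+ 2 <= \sum_(k < n) nc (c k) ^+ 2) ->
  \sum_(k < n) nc (L (e_ k)) ^+ 2 <= M ^+ 2.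
Proof.
move=> e1 eN; have [s1 sE] := sum_L (fun k => cj (L (e_ k))) n e1.
set A := \sum_(k < n) _.
have LA : L (fun x => \sum_(k < n) cj (L (e_ k)) * e_ k x) = A%:C.
  rewrite sE /A rmorph_sum; apply: eq_bigr => k _; by rewrite mulrC mulcJ.
have A0 : 0 <= A by apply: sumr_ge0 => k _; exact: sqr_ge0.
have := Lbd s1; rewrite LA ncR (ger0_norm A0) => h.
have := eN (fun k => cj (L (e_ k))); rewrite (eq_bigr (fun k : 'I_n => nc (L (e_ k)) ^+ 2)); last first.
  by move=> k _; rewrite ncJ.
rewrite -/A; move: (N1 _) h => t h h2; have := sqr_ge0 (M - t); rewrite sqrrB; lra.
Qed.

Lemma tpJ (c : nat -> C) n (x : T) : cj (tp c n x) = \sum_(k < n) cj (c k) * cj (zeta x) ^+ k.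
Proof.
elim: n => [|n IH]; first by rewrite /tp !big_ord0 conjc0.
by rewrite tpS conjcD IH big_ord_recr conjcM conjcX.
Qed.

Lemma valJX_L1 k : L1 (fun x : T => cj (zeta x) ^+ k).
Proof.
have [mX _] := LooJ (valX_Loo R k).
by move: (Loo_L1 (LooJ (valX_Loo R k))); under eq_fun do rewrite conjcX.
Qed.

Lemma functional_coef : exists w : T -> C, [/\ L2 w,
  forall k, cintm (fun x => zeta x ^+ k * w x) = L (fun x => zeta x ^+ k) &
  forall k, cintm (fun x => cj (zeta x) ^+ k * w x) = L (fun x => cj (zeta x) ^+ k)].
Proof.
pose c k := L (fun x : T => cj (zeta x) ^+ k).
(* The constant character is accounted for by [c]; [d] starts with 0 so that it is not counted
   twice. *)
pose d k := if k is k'.+1 then cj (L (fun x : T => zeta x ^+ k'.+1)) else 0.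
have cB n : \sum_(k < n) nc (c k) ^+ 2 <= M ^+ 2.
  apply: (@functional_l2 (fun k x => cj (zeta x) ^+ k) n valJX_L1).
  move=> a; rewrite (_ : N1 _ = N1 (tp (fun k => cj (a k)) n)).
    have := sqr_N1_le (Loo_L2 (tp_Loo (fun k => cj (a k)) n)); rewrite N2_tp.
    by move=> /le_trans; apply; apply: ler_sum => k _; rewrite ncJ.
  apply: N1_ext => x; rewrite -[RHS]ncJ tpJ; congr nc.
  by apply: eq_bigr => k _; rewrite conjcK.
have dB n : \sum_(k < n) nc (d k) ^+ 2 <= M ^+ 2.
  apply: (@le_trans _ _ (\sum_(k < n) nc (L (fun x : T => zeta x ^+ k)) ^+ 2)).
    apply: ler_sum => -[[|k] kn] _; last by rewrite -[d _]/(cj _) ncJ.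
    by rewrite -[d _]/(0 : C) nc0 expr0n sqr_ge0.
  apply: (@functional_l2 (fun k x => zeta x ^+ k) n (fun k => Loo_L1 (valX_Loo R k))).
  move=> a; rewrite -[X in N1 X]/(tp a n) -N2_tp; exact: sqr_N1_le (Loo_L2 (tp_Loo a n)).
have [a [a2 ac an]] := riesz_fischer cB; have [b [b2 bc bn]] := riesz_fischer dB.
have a1 := L2_L1 a2; have b1 := L2_L1 b2; have bJ := L2J b2; have bJ1 := L2_L1 bJ.
have bn0 k : fn b k = 0.
  by case: k => [|k]; [rewrite fn0E -fc0E bc|exact: bn].
have w2 : L2 (fun x => a x + cj (b x)) by exact: L2D.
have cE k : cintm (fun x => cj (zeta x) ^+ k * (a x + cj (b x))) = L (fun x => cj (zeta x) ^+ k).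
  under eq_fun do rewrite mulrC; rewrite -[LHS]/(fc _ k) fcD// ac fcJ// bn0 conjc0 addr0.
  by [].
exists (fun x => a x + cj (b x)); split=> // k.
case: k => [|k]; first exact: (cE 0%N).
under eq_fun do rewrite mulrC; rewrite -[LHS]/(fn _ k.+1) fnD// an// fnJ// bc add0r.
exact: conjcK.
Qed.

(** Equality is claimed only for f in H^1: it holds on uniform limits of analytic polynomials, such
    as the dilates of f, which converge to f in L^1. The bound on w uses the values of L outside
    H^1. *)
Lemma functional_repr : exists w : T -> C, [/\ cmeas setT w,
  \forall x \ae m, nc (w x) <= M &
  forall f, L1 f -> (forall k, (0 < k)%N -> fn f k = 0) -> L f = cintm (fun x => f x * w x)].
Proof.
have [w [w2 wn wc]] := functional_coef; have w1 := L2_L1 w2; have [mw _] := w2.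
(* The defect of the representation; until w is known to be bounded it makes sense for bounded h
   only. *)
pose De h := L h - cintm (fun x => h x * w x).
have bdw h s : Loo h -> (forall x, nc (h x) <= s) -> L1 (fun x => h x * w x) /\
    nc (cintm (fun x => h x * w x)) <= N1 w * s.
  move=> h1 hs; have i1 := L2_L1 (L2_mulbd w2 h1).
  split=> //; apply: le_trans (nc_cintm i1) _; rewrite /N1 mulrC -RintegralZl//; last exact: L1_RL1.
  apply: le_Rintegral => //; [exact: L1_RL1|apply: RL1Z; exact: L1_RL1|].
  by move=> x _; rewrite ncM ler_wpM2r.
have Delin a f g : Loo f -> Loo g -> De (fun x => a * f x + g x) = a * De f + De g.
  move=> foo goo; rewrite /De (Llin a (Loo_L1 foo) (Loo_L1 goo)).
  have i1 := L2_L1 (L2_mulbd w2 foo); have i2 := L2_L1 (L2_mulbd w2 goo).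
  have -> : cintm (fun x => (a * f x + g x) * w x) = a * cintm (fun x => f x * w x) + cintm (fun x => g x * w x).
    rewrite -(cintZ measurableT a i1) -(cintD measurableT (cintbleZ measurableT a i1) i2).
    by apply: eq_cint => x _; rewrite mulrDl mulrA.
  by move: (L f) (L g) (cintm _) (cintm _) => p q r t; ring.
have Debd h s : Loo h -> (forall x, nc (h x) <= s) -> nc (De h) <= (M + N1 w) * s.
  move=> hoo hs; have [i1 h2] := bdw h s hoo hs; have h1 := Loo_L1 hoo.
  apply: le_trans (ncB _ _) _; rewrite mulrDl; apply: lerD => //.
  apply: le_trans (Lbd h1) _; rewrite ler_wpM2l// -[leRHS]Rint_cst_circle.
  by apply: le_Rintegral => //; [exact: L1_RL1|exact: RL1_cst].
have DeX k : De (fun x => zeta x ^+ k) = 0 by rewrite /De wn subrr.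
(* Conjugation turns the negative powers of [zeta] into positive ones, so that [D_unif] also covers
   the Cauchy kernel itself. *)
pose De' h := cj (De (fun x => cj (h x))).
have De'lin a f g : Loo f -> Loo g -> De' (fun x => a * f x + g x) = a * De' f + De' g.
  move=> foo goo; rewrite /De' -{2}[a]conjcK -conjcM -conjcD; congr cj.
  rewrite -(Delin _ _ _ (LooJ foo) (LooJ goo)); congr De; apply/funext => x.
  by rewrite conjcD conjcM.
have De'bd h s : Loo h -> (forall x, nc (h x) <= s) -> nc (De' h) <= (M + N1 w) * s.
  by move=> hoo hs; rewrite ncJ; apply: Debd; [exact: LooJ|move=> x; rewrite ncJ].
have De'X k : De' (fun x => zeta x ^+ k) = 0.
  rewrite /De'; under eq_fun do rewrite conjcX.
  by rewrite /De wc subrr conjc0.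
have czoo (z : C) : nc z < 1 -> Loo (cz z).
  move=> z1; split; first exact: cmeas_cz.
  by exists (1 - nc z)^-1; apply: nearW => x; exact: nc_cz.
have DeczJ z : nc z < 1 -> De (fun x => cj (cz z x)) = 0.
  move=> z1; apply: (D_unif Delin Debd DeX (c := fun k => cj z ^+ k) (LooJ (czoo z z1)) (q := nc z)
    (K := (1 - nc z)^-1)); first by rewrite nc_ge0.
  by move=> n x; exact: czJ_tp.
have Decz z : nc z < 1 -> De (cz z) = 0.
  move=> z1; have := D_unif De'lin De'bd De'X (c := fun k => cj z ^+ k) (LooJ (czoo z z1)) (q := nc z)
    (K := (1 - nc z)^-1) _ (fun n x => czJ_tp n x z1).
  rewrite nc_ge0 z1 => /(_ isT); rewrite /De'; under eq_fun do rewrite conjcK.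
  by move/(congr1 (@conjc R)); rewrite conjcK conjc0.
have Depz z : nc z < 1 -> De (fun x => (pz z x)%:C) = 0.
  move=> z1; have o1 : Loo (fun=> 1 : C) by exact: Loo_cst.
  have De1 : De (fun=> 1) = 0 by have := DeX 0%N; under eq_fun do rewrite expr0.
  have -> : (fun x => (pz z x)%:C) = fun x => 1 * cz z x + ((-1) * 1 + cj (cz z x)).
    by apply/funext => x; rewrite pzE//; ring.
  have o2 : Loo (fun x => (-1) * 1 + cj (cz z x)).
    by apply: LooD; [exact: Loo_cst|exact/LooJ/czoo].
  rewrite (Delin 1 _ _ (czoo z z1) o2) (Delin (-1) _ _ o1 (LooJ (czoo z z1))).
  by rewrite Decz// De1 DeczJ// !mulr0 !addr0.
(* The Poisson integral of w is the value of L at the Poisson kernel, hence at most M; Fatou's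
   theorem passes the bound to w. *)
have Poiw z : nc z < 1 -> nc (Poi w z) <= M.
  move=> z1; have ip := cintbleR (integrable_pz z1).
  have := Depz z z1; rewrite /De => /eqP; rewrite subr_eq0 => /eqP E.
  have -> : Poi w z = L (fun x => (pz z x)%:C).
    by rewrite E; apply: eq_cint => x _; rewrite mulrC.
  apply: le_trans (Lbd ip) _; rewrite -[leRHS]mulr1 ler_wpM2l// -(Poi1 z1).
  rewrite le_eqVlt; apply/orP; left; apply/eqP; congr Rintegral; apply/funext => x.
  by rewrite ncR (ger0_norm (pz_ge0 x z1)).
have wM : \forall x \ae m, nc (w x) <= M.
  apply: filterS (fatou_cradial w1) => x hx; apply/ler_addgt0Pr => e e0.
  have [d d0 dP] := hx _ e0; have [N NP] := rs_cvg d0.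
  have := dP _ (rs_ge0 R N) (rs_lt1 R N) (NP N (leqnn N)).
  rewrite ncBC => h; rewrite -[w x](subrK (Poi w ((rs R N)%:C * zeta x))).
  apply: le_trans (ncD _ _) _; rewrite addrC; apply: lerD => //; apply: Poiw.
  by apply: nc_dil_lt1; [exact: rs_ge0|exact: rs_lt1].
have woo : Loo w by split=> //; exists M.
exists w; split=> // f f1 fk.
have hP z : nc z < 1 -> holo (Poi f) z by move=> z1; exact: Poi_holo.
pose G n := dilate (Poi f) (rs R n).
have Goo n : Loo (G n).
  have [B B0 BP] := bounded_dilate hP (rs01 R n).
  by split; [exact: (cintble_meas (L1_dilate hP (rs01 R n)))|exists B; exact: nearW].
have DeG n : De (G n) = 0.
  have r01 := rs01 R n; have /andP[r0 r1] := r01.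
  apply: (D_unif Delin Debd DeX (c := fun k => ((rs R n) ^+ k)%:C * fc f k) (Goo n) r01
    (K := (1 - rs R n)^-1 * N1 f)) => k x.
  have w1' := nc_dil_lt1 x r0 r1; rewrite /G /dilate Poi_Cau//.
  have := Cau_partial k f1 w1'; rewrite nc_dil (ger0_norm r0) mulrA; apply: le_trans.
  rewrite le_eqVlt; apply/orP; left; apply/eqP; congr (nc (_ - _)); apply: eq_bigr => i _.
  by rewrite exprMn rcX; ring.
have lim := dilate_cvg_L1 f1 hP (fun z z1 => nc_Poi f1 z1) (fatou_cradial f1).
have fw1 h : L1 h -> L1 (fun x => h x * w x).
  move=> h1; apply: (cintble_ae_le (g := fun x => M * nc (h x))).
  - by apply: cmeasM => //; exact: (cintble_meas h1).
  - by apply: RL1Z; exact: L1_RL1.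
  - by apply: filterS wM => x xM; rewrite ncM mulrC ler_wpM2r.
have fwM h : L1 h -> nc (cintm (fun x => h x * w x)) <= M * N1 h.
  move=> h1; apply: le_trans (nc_cintm (fw1 h h1)) _.
  rewrite /N1 -RintegralZl//; last exact: L1_RL1.
  apply: ae_le_Rint; [exact: L1_RL1 (fw1 h h1)|apply: RL1Z; exact: L1_RL1|].
  by apply: filterS wM => x xM; rewrite ncM mulrC ler_wpM2r.
apply: nc_small_eq => e e0.
have K0 : 0 < 2 * M + 1 by rewrite ltr_wpDl// mulr_ge0.
have e1 : 0 < e / (2 * M + 1) by rewrite divr_gt0.
move/cvgrPdist_le: lim => /(_ _ e1)[N _ NP]; have := NP N (leqnn N).
rewrite sub0r normrN (ger0_norm (N1_ge0 _)) -/(dilate _ _) => hN.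
have G1 := Loo_L1 (Goo N).
pose h x := G N x - f x; have h1 : L1 h by exact: cintbleB.
have hE : (fun x => (-1) * f x + G N x) = h by apply/funext => x; rewrite mulN1r addrC.
have E1 : L h = - L f + L (G N) by rewrite -hE Llin// mulN1r.
have E2 : cintm (fun x => h x * w x) = cintm (fun x => G N x * w x) - cintm (fun x => f x * w x).
  rewrite -(cintB measurableT (fw1 _ G1) (fw1 _ f1)); apply: eq_cint => x _.
  by rewrite mulrBl.
have := DeG N; rewrite /De => /eqP; rewrite subr_eq0 => /eqP E3.
have -> : L f - cintm (fun x => f x * w x) = cintm (fun x => h x * w x) - L h.
  by rewrite E1 E2 E3; move: (L f) (cintm _) (cintm _) => p q r; ring.
apply: le_trans (ncB _ _) _; apply: le_trans (lerD (fwM h h1) (Lbd h1)) _.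
have Nh0 := N1_ge0 h.
apply: (@le_trans _ _ ((2 * M + 1) * N1 h)).
  by rewrite -mulrDl ler_wpM2r// -[leLHS]addr0 mulr_natl mulr2n lerD2l.
by rewrite mulrC -ler_pdivlMr.
Qed.

End functional.
End representation.

(** * Duality for the model space *)

Section main.
Variable R : realType.
Local Notation C := R[i].
Local Notation T := (circle R).
Local Notation m := (@circle_leb R).
Local Notation cintm := (cint m setT).
Local Notation L1 := (cintble m setT).
Local Notation RL1 u := (m.-integrable setT (fun x => (u x)%:E)).
Local Notation Rint := (Rintegral m setT).
Implicit Types f g h v w q : T -> C.

Lemma pairingE v f : pairing v f = cintm (fun x => f x * v x).
Proof. by []. Qed.

Lemma L1_mul_Loo f v : L1 f -> Loo v -> L1 (fun x => f x * v x).
Proof.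
move=> f1 [mv [M vM]]; apply: (cintble_ae_le (g := fun x => M * nc (f x))).
- by apply: cmeasM => //; exact: (cintble_meas f1).
- by apply: RL1Z; exact: L1_RL1.
- by apply: filterS vM => x xM; rewrite ncM mulrC ler_wpM2r.
Qed.

Lemma pairing_le v f M : L1 f -> cmeas setT v -> (\forall x \ae m, nc (v x) <= M) ->
  nc (pairing v f) <= M * N1 f.
Proof.
move=> f1 mv vM; have voo : Loo v by split=> //; exists M.
have i1 := L1_mul_Loo f1 voo; rewrite pairingE; apply: le_trans (nc_cintm i1) _.
rewrite /N1 -RintegralZl//; last exact: L1_RL1.
apply: ae_le_Rint; [exact: L1_RL1 i1|apply: RL1Z; exact: L1_RL1|].
by apply: filterS vM => x xM; rewrite ncM mulrC ler_wpM2r.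
Qed.

Lemma pairingD v w f : L1 f -> Loo v -> Loo w ->
  pairing (fun x => v x + w x) f = pairing v f + pairing w f.
Proof.
move=> f1 voo woo; rewrite !pairingE.
rewrite -(cintD measurableT (L1_mul_Loo f1 voo) (L1_mul_Loo f1 woo)).
by apply: eq_cint => x _; rewrite mulrDr.
Qed.

Lemma pairingB v w f : L1 f -> Loo v -> Loo w ->
  pairing (fun x => v x - w x) f = pairing v f - pairing w f.
Proof.
move=> f1 voo woo; rewrite !pairingE.
rewrite -(cintB measurableT (L1_mul_Loo f1 voo) (L1_mul_Loo f1 woo)).
by apply: eq_cint => x _; rewrite mulrBr.
Qed.

Lemma pairing_lin v a f g : L1 f -> L1 g -> Loo v ->
  pairing v (fun x => a * f x + g x) = a * pairing v f + pairing v g.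
Proof.
move=> f1 g1 voo; rewrite !pairingE; have i1 := L1_mul_Loo f1 voo; have i2 := L1_mul_Loo g1 voo.
rewrite -(cintZ measurableT a i1) -(cintD measurableT (cintbleZ measurableT a i1) i2).
by apply: eq_cint => x _; rewrite mulrDl mulrA.
Qed.

Lemma N1Z a f : L1 f -> N1 (fun x => a * f x) = nc a * N1 f.
Proof.
move=> f1; rewrite /N1 -RintegralZl//; last exact: L1_RL1.
by congr Rintegral; apply/funext => x; rewrite ncM.
Qed.

Lemma N1D f g : L1 f -> L1 g -> N1 (fun x => f x + g x) <= N1 f + N1 g.
Proof.
move=> f1 g1; rewrite /N1 -RintegralD//; [|exact: L1_RL1|exact: L1_RL1].
apply: le_Rintegral => //.
- by apply: L1_RL1; exact: cintbleD.
- by apply: RL1D; exact: L1_RL1.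
- by move=> x _; exact: ncD.
Qed.

Section fixed_inner.
Variable I : T -> C.
Hypothesis hI : inner I.

Let I2 : L2 I. Proof. by have [/hardy2P[]] := hI. Qed.
Let Ik k : (0 < k)%N -> fn I k = 0. Proof. by have [/hardy2P[_ h] _] := hI; exact: h. Qed.
Let I1 : \forall x \ae m, nc (I x) = 1.
Proof.
have [_] := hI; apply: filterS => x; rewrite normcE.
by move/(congr1 (@complex.Re R)).
Qed.

Local Notation K := (model_space0 I).
Local Notation Q := (Qspace I).

Lemma KP f : K f <-> [/\ L1 f, forall k, fn f k = 0 & exists h, [/\ L1 h, forall k, fn h k = 0 &
  \forall x \ae m, f x = I x * cj (h x)]].
Proof.
split=> [[[_ [h /hardy01P[h1 hk] fh]] /hardy01P[f1 fk]]|[f1 fk [h [h1 hk fh]]]].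
  by split=> //; exists h.
split; last exact/hardy01P.
split; first by apply/hardy1P; split=> // k _; exact: fk.
by exists h => //; exact/hardy01P.
Qed.

Lemma K_L1 f : K f -> L1 f. Proof. by move=> /KP[]. Qed.

Lemma K_lin a f g : K f -> K g -> K (fun x => a * f x + g x).
Proof.
move=> /KP[f1 fk [h [h1 hk fh]]] /KP[g1 gk [j [j1 jk gj]]]; apply/KP.
have af1 := cintbleZ measurableT a f1; have ah1 := cintbleZ measurableT (cj a) h1.
split; first exact: cintbleD.
  by move=> k; rewrite fnD// fnZ// fk gk mulr0 addr0.
exists (fun x => cj a * h x + j x); split; first exact: cintbleD.
  by move=> k; rewrite fnD// fnZ// hk jk mulr0 addr0.
apply: filterS2 fh gj => x -> ->.
by rewrite conjcD conjcM conjcK mulrDr mulrCA.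
Qed.

Lemma K_0 : K (fun=> 0).
Proof.
have z k : fn (fun=> 0 : C) k = 0.
  by rewrite /fn; under eq_fun do rewrite mul0r; rewrite cint0.
apply/KP; split=> //; first exact: cintble_cst_circle.
exists (fun=> 0); split=> //; first exact: cintble_cst_circle.
by apply: nearW => x; rewrite conjc0 mulr0.
Qed.

(** Q is the annihilator of K; this reduces everything about cosets to the pairing. The converse
    direction tests against elements of K in L^2 only. *)
Lemma QP q : Q q <-> Loo q /\ forall f, K f -> pairing q f = 0.
Proof.
split=> [[/Lpoo_spaceP qoo [a [b [/hardy2P[a2 ak] /hardy2P[b2 bk] qab]]]]|[qoo qK]].
  split=> // f /KP[f1 fk [h [h1 hk fh]]]; rewrite pairingE.
  exact: (int_fv I2 Ik I1 f1 fk h1 hk fh a2 ak b2 bk qoo qab).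
split; first exact/Lpoo_spaceP.
have [|a [b [a2 b2 qab]]] := annihilator_split I2 Ik I1 qoo.
  move=> f h f2 fk h2 hk fh; apply: qK; apply/KP; split=> //; first exact: L2_L1.
  by exists h; split=> //; exact: L2_L1.
by exists a, b; split=> //; exact/hardy2P.
Qed.

Lemma Q_0 : Q (fun=> 0).
Proof.
apply/QP; split; first exact: Loo_cst.
by move=> f _; rewrite pairingE; under eq_fun do rewrite mulr0; rewrite cint0.
Qed.

Lemma coset_eq v w : Loo v -> Loo w -> (forall f, K f -> pairing v f = pairing w f) ->
  coset Q v `<=` coset Q w.
Proof.
move=> voo woo vw _ [q Qq ->]; have /QP[qoo qK] := Qq.
have vwoo : Loo (fun x => v x - w x) by exact: LooB.
exists (fun x => (v x - w x) + q x).
  apply/QP; split; first exact: LooD.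
  move=> f Kf; have f1 := K_L1 Kf.
  by rewrite pairingD// pairingB// vw// subrr add0r qK.
by apply/funext => x; rewrite addrA addrCA subrr addr0.
Qed.

(** The constant M is preserved from the functional to its representing function; this gives
    existence in [dual_repr] and the exact norm in [dual_norm]. *)
Lemma K_repr (l : (T -> C) -> C) M : 0 <= M ->
  (forall a f g, K f -> K g -> l (fun x => a * f x + g x) = a * l f + l g) ->
  (forall f, K f -> nc (l f) <= M * N1 f) ->
  exists w, [/\ cmeas setT w, \forall x \ae m, nc (w x) <= M & forall f, K f -> l f = pairing w f].
Proof.
move=> M0 llin lM.
have [|||||||||L [Llin LK LM]] := @hahn_banach R (T -> C^o) (fun f => L1 f) K (fun f => M * N1 f) l.
- by move=> a f g f1 g1; apply: cintbleD => //; exact: cintbleZ.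
- by move=> f; exact: K_L1.
- exact: K_0.
- exact: K_lin.
- by move=> f g f1 g1; rewrite -mulrDr ler_wpM2l// N1D.
- by move=> f _; rewrite mulr_ge0// N1_ge0.
- by move=> a f f1; rewrite [N1 _]N1Z// mulrCA.
- exact: llin.
- exact: lM.
have [w [mw wM wL]] := @functional_repr R L M M0 Llin LM.
exists w; split=> // f Kf; have /KP[f1 fk _] := Kf.
by rewrite -LK// pairingE -wL.
Qed.

Lemma dual_repr l : L1_dual K l <->
  exists! V : set (T -> C), Linfty_quotient Q V /\
    (forall v, V v -> forall f, K f -> l f = pairing v f).
Proof.
split=> [[llin [M lM]]|[V [[[v /Lpoo_spaceP voo VE] Vl] _]]].
(* The given bound may be negative when all elements of K have norm 0. *)
- pose M' := Num.max M 0; have M0 : 0 <= M' by rewrite le_max lexx orbT.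
  have lM' f : K f -> nc (l f) <= M' * N1 f.
    move=> Kf; have := lM f Kf; rewrite Lp_norm1; last exact: K_L1.
    rewrite -EFinM lee_fin => /le_trans; apply.
    by rewrite ler_wpM2r ?N1_ge0// le_max lexx.
  have [w [mw wM wl]] := K_repr M0 llin lM'.
  have woo : Loo w by split=> //; exists M'.
  exists (coset Q w); split.
    split; first by exists w => //; exact/Lpoo_spaceP.
    move=> _ [q /QP[qoo qK] ->] f Kf.
    by rewrite pairingD ?qK ?addr0 ?wl//; exact: K_L1.
  move=> _ [[v /Lpoo_spaceP voo ->] vl].
  have vw f : K f -> pairing v f = pairing w f.
    move=> Kf; rewrite -wl// (vl v)//; exists (fun=> 0); first exact: Q_0.
    by apply/funext => x; rewrite addr0.
  by apply/seteqP; split; apply: coset_eq => // f Kf; rewrite vw.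
- have lv f : K f -> l f = pairing v f.
    move=> Kf; apply: Vl => //; rewrite VE; exists (fun=> 0); first exact: Q_0.
    by apply/funext => x; rewrite addr0.
  split=> [a f g Kf Kg|].
    by rewrite !lv ?pairing_lin//; [exact: K_L1|exact: K_L1|exact: K_lin].
  have [mv [M vM]] := voo; exists M => f Kf.
  rewrite Lp_norm1; last exact: K_L1.
  by rewrite lv// -EFinM lee_fin; apply: pairing_le => //; exact: K_L1.
Qed.

(** The upper bound holds for each representative v + q. For the lower one, [K_repr] with the norm
    of the functional as constant yields a representative attaining the infimum. *)
Lemma dual_norm v : Lp_space +oo%E v -> L1_dual_norm K (pairing v) = quotient_norm Q v.
Proof.
move=> /Lpoo_spaceP voo; have [mv [B vB]] := voo.
apply/eqP; rewrite eq_le; apply/andP; split.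
  apply: ge_ereal_sup => _ [f [Kf f_le] <-]; have f1 := K_L1 Kf.
  apply: le_ereal_inf_tmp => _ [q /QP[qoo qK] <-].
  have vqoo := LooD voo qoo; have [_ vqf] := (Lpoo_spaceP _).2 vqoo.
  have n0 : (0 <= Lp_norm +oo (fun x => (v x + q x)%R))%E by exact: Lnorm_ge0.
  have nf : Lp_norm +oo%E (fun x => v x + q x) \is a fin_num by rewrite ge0_fin_numE.
  rewrite -(fineK nf) lee_fin.
  have r0 : 0 <= fine (Lp_norm +oo%E (fun x => v x + q x)) by exact: fine_ge0.
  have /Lpoo_le rM : (Lp_norm +oo (fun x => (v x + q x)%R) <=
      (fine (Lp_norm +oo (fun x => (v x + q x)%R)))%:E)%E by rewrite fineK.
  rewrite -[pairing v f]addr0 -(qK f Kf) -pairingD//.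
  apply: le_trans (pairing_le f1 vqoo.1 rM) _.
  by rewrite ler_piMr// -lee_fin -Lp_norm1.
set S := L1_dual_norm K (pairing v).
have S_ub f : K f -> N1 f <= 1 -> ((nc (pairing v f))%:E <= S)%E.
  by move=> Kf f_le; apply: ereal_sup_ubound; exists f => //; split=> //; rewrite Lp_norm1 ?lee_fin//; exact: K_L1.
have S0 : (0 <= S)%E.
  apply: le_trans (S_ub _ K_0 _); first by rewrite lee_fin.
  by rewrite /N1; under eq_Rintegral do rewrite nc0; rewrite Rint_cst_circle.
have B0' : 0 <= Num.max B 0 by rewrite le_max lexx orbT.
have vB' : \forall x \ae m, nc (v x) <= Num.max B 0 by apply: filterS vB => x xB; rewrite le_max xB.
have Sfin : S \is a fin_num.
  rewrite ge0_fin_numE//; apply: (@le_lt_trans _ _ (Num.max B 0)%:E); last exact: ltry.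
  apply: ge_ereal_sup => _ [f [Kf f_le] <-]; have f1 := K_L1 Kf.
  rewrite lee_fin; apply: le_trans (pairing_le f1 mv vB') _.
  by rewrite ler_piMr// -lee_fin -Lp_norm1.
have M0 : 0 <= fine S by exact: fine_ge0.
have [||w [mw wM wl]] := @K_repr (pairing v) (fine S) M0.
- by move=> a f g Kf Kg; apply: pairing_lin => //; exact: K_L1.
- move=> f Kf; have f1 := K_L1 Kf.
  (* Functions are not identified a.e., so a nonzero f may have norm 0 and cannot be normalised; the
     crude bound settles this case. *)
  have [n0|n0] := eqVneq (N1 f) 0.
    by have := pairing_le f1 mv vB'; rewrite n0 !mulr0.
  have n1 : 0 < N1 f by rewrite lt_neqAle eq_sym n0 N1_ge0.
  pose g x := (N1 f)^-1%:C * f x.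
  have Kg : K g.
    have := K_lin (N1 f)^-1%:C Kf K_0.
    by under [X in K X -> _]eq_fun do rewrite addr0.
  have pg : pairing v g = (N1 f)^-1%:C * pairing v f.
    rewrite !pairingE -(cintZ measurableT _ (L1_mul_Loo f1 voo)).
    by apply: eq_cint => x _; rewrite mulrA.
  have Ng : N1 g <= 1.
    by rewrite [N1 g]N1Z// ncR ger0_norm ?invr_ge0 ?N1_ge0// mulVf.
  have := S_ub g Kg Ng; rewrite pg -(fineK Sfin) lee_fin ncM ncR ger0_norm ?invr_ge0 ?N1_ge0//.
  by rewrite ler_pdivrMl// mulrC.
have woo : Loo w by split=> //; exists (fine S).
rewrite -(fineK Sfin); apply: (@le_trans _ _ (Lp_norm +oo%E w)); last exact/Lpoo_le.
have wvoo : Loo (fun x => w x - v x) by exact: LooB.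
(* w and v define the same functional on K, so they differ by an element of Q. *)
apply: ereal_inf_lbound; exists (fun x => w x - v x).
  apply/QP; split=> // f Kf.
  by rewrite pairingB ?wl ?subrr//; exact: K_L1.
by congr Lp_norm; apply/funext => x; rewrite addrC subrK.
Qed.

End fixed_inner.
End main.

Theorem theorem2p2 (R : realType) (I : circle R -> R[i]) (hI : inner I) :
  (forall l : (circle R -> R[i]) -> R[i],
     L1_dual (model_space0 I) l <->
     exists! V : set (circle R -> R[i]),
       Linfty_quotient (Qspace I) V /\
       (forall v, V v -> forall f, model_space0 I f -> l f = pairing v f)) /\
  (forall v : circle R -> R[i], Lp_space +oo%E v ->
     L1_dual_norm (model_space0 I) (pairing v) = quotient_norm (Qspace I) v).
Proof. by split=> [l|v]; [exact: dual_repr|exact: dual_norm]. Qed.
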